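(* For all $n\in\mathbb N$ and $k\in\{1,\ldots,n\}$, $$ \binom{2n}{n}\tilde{\mathbf J}_{n,k}\Big(\frac{n+1}{2}\Big)=\binom nk\binom{n+k}{k}-\binom{n-2}{k}\binom{n-2+k}{k}, $$ with the conventions $\binom{-1}{1}=-1$ and $\binom01=\binom02=0$ (and $\binom ab=0$ for integers $0\le a<b$).
   Context: For $d\in\mathbb N$ and $\beta>d/2$ the $d$-dimensional beta' distribution has density $\tilde f_{d,\beta}(x)=\tilde c_{d,\beta}(1+\|x\|^2)^{-\beta}$ with $\tilde c_{d,\beta}=\Gamma(\beta)/(\pi^{d/2}\Gamma(\beta-\frac d2))$. The internal angle $\beta(F,T)$ of a simplex $T\subset\mathbb R^d$ at a face $F$ is $\lim_{r\downarrow0}\mathrm{Vol}_d(B_r(z)\cap T)/\mathrm{Vol}_d(B_r(z))$, $z$ in the relative interior of $F$ (full angle $=1$). For $n\ge2$, $\beta>\frac{n-1}{2}$ and $\tilde X_1,\ldots,\tilde X_n$ i.i.d. in $\mathbb R^{n-1}$ with density $\tilde f_{n-1,\beta}$, $\tilde{\mathbf J}_{n,k}(\beta)=\binom nk\,\mathbb E\,\beta([\tilde X_1,\ldots,\tilde X_k],[\tilde X_1,\ldots,\tilde X_n])$; by convention $\tilde{\mathbf J}_{n,n}(\beta)=1$ for all $n\in\mathbb N$. *)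

(* Defs.v *)
From HB Require Import structures.
From mathcomp Require Import all_boot all_order all_algebra.
From mathcomp Require Import all_classical all_reals all_analysis.
Set Implicit Arguments. Unset Strict Implicit. Unset Printing Implicit Defensive.
Import Order.TTheory GRing.Theory Num.Theory.
Import numFieldNormedType.Exports.
Local Open Scope ring_scope.
Local Open Scope classical_set_scope.

Section BetaPrime.
Variable R : realType.

(** Lebesgue integration on R^N of a nonnegative function, realised as the
    iterated integral over the coordinates 0..N-1 (Tonelli); a vector of R^N
    is encoded as a sequence [nat -> R] (coordinates >= N are set to 0). *)
Definition ncons (x : R) (v : nat -> R) : nat -> R :=
  fun i => if i is j.+1 then v j else x.

Fixpoint iter_int (N : nat) (f : (nat -> R) -> \bar R) : \bar R :=
  match N with
  | 0 => f (fun _ => 0)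
  | N'.+1 => (\int[@lebesgue_measure R]_(x in setT)
                 iter_int N' (fun v => f (ncons x v)))%E
  end.

Definition vol (d : nat) (A : set 'rV[R]_d) : \bar R :=
  iter_int d (fun v => (\1_A (\row_(j < d) v j) : R)%:E).

(** Integral over configurations of n points of R^d (rows of an n x d matrix)
    w.r.t. Lebesgue measure on (R^d)^n. *)
Definition cfg_int (n d : nat) (f : 'M[R]_(n, d) -> \bar R) : \bar R :=
  iter_int (n * d) (fun v => f (\matrix_(i < n, j < d) v (i * d + j)%N)).

Definition sqnorm (d : nat) (x : 'rV[R]_d) : R := \sum_(j < d) x 0 j ^+ 2.

Definition Gamma (s : R) : R :=
  fine (\int[@lebesgue_measure R]_(t in [set t : R | (0 < t)%R])
          ((powR t (s - 1) * expR (- t))%R)%:E)%E.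

Definition ctilde (d : nat) (beta : R) : R :=
  Gamma beta / (pi `^ (d%:R / 2) * Gamma (beta - d%:R / 2)).

Definition dens_bp (d : nat) (beta : R) (x : 'rV[R]_d) : R :=
  ctilde d beta * (1 + sqnorm x) `^ (- beta).

Definition hull (n d : nat) (X : 'I_n -> 'rV[R]_d) (A : pred 'I_n) :
    set 'rV[R]_d :=
  [set y | exists l : 'I_n -> R,
     [/\ forall i, 0 <= l i, forall i, ~~ A i -> l i = 0,
         \sum_(i < n) l i = 1 & y = \sum_(i < n) l i *: X i]].

Definition eball (d : nat) (z : 'rV[R]_d) (r : R) : set 'rV[R]_d :=
  [set y | sqnorm (y - z) < r ^+ 2].

(** internal angle of the simplex T = [X_1,...,X_n] at its face
    F = [X_1,...,X_k] (indices 0..k-1), computed at the barycenter z of F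
    (which lies in the relative interior of F for a nondegenerate simplex). *)
Definition int_angle (n d k : nat) (X : 'I_n -> 'rV[R]_d) : R :=
  let T := hull X predT in
  let z := (k%:R)^-1 *: \sum_(i < n | (i < k)%N) X i in
  lim ((fun r : R => (fine (vol (eball z r `&` T)) / fine (vol (eball z r)) : R))
         @ (0 : R)^'+).

Definition exp_angle (n k : nat) (beta : R) : R :=
  fine (cfg_int (fun M : 'M[R]_(n, n.-1) =>
     (int_angle k (fun i => row i M) *
      \prod_(i < n) dens_bp beta (row i M))%:E)).

Definition Jt (n k : nat) (beta : R) : R :=
  if k == n then 1 else 'C(n, k)%:R * exp_angle n k beta.

(** generalized binomial coefficient binom(a, b) = a(a-1)...(a-b+1)/b!,
    for a integer: gives binom(-1,1) = -1 and binom(a,b) = 0 for 0 <= a < b *)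
Definition gbin (a : int) (b : nat) : R :=
  (\prod_(i < b) (a%:~R - i%:R)) / (b`!)%:R.

End BetaPrime.

(* Main.v *)
Require Import Defs.
From HB Require Import structures.
From mathcomp Require Import all_boot all_order all_algebra perm.
From mathcomp Require Import all_classical all_reals all_analysis.
From mathcomp Require Import measurable_realfun ring lra zify.
Set Implicit Arguments. Unset Strict Implicit. Unset Printing Implicit Defensive.
Import Order.TTheory GRing.Theory Num.Theory.
Import numFieldNormedType.Exports.
Local Open Scope ring_scope.
Local Open Scope classical_set_scope.

(** Write [n = d + 1] and let [A] be the edge matrix of the simplex at its first
    vertex. The internal angle at [X_1, ..., X_k] is [|det A|] times the volume of
    the [l] with [|l A| < 1] and [l_i >= 0] for [i >= k], over the volume of the
    unit ball, so the expected angle is a Lebesgue integral [Pk k] up to a constant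
    independent of [k], and [Pk n] calibrates that constant.

    For [beta = (n + 1) / 2] the density is a mixture of Gaussians: with
    [X_i = G_i / rho_i] the factors [rho_i ^ n] provided by the mixture are exactly
    absorbed by the Jacobian and by [det (1 | X) * prod rho = det (rho | G)].
    An orthogonal change of coordinates taking [rho] and [m_i = l_i / rho_i]
    ([l_0 = - sum l_i], so that [m] is orthogonal to [rho]) to two coordinate axes
    shows that the inner integral depends on [|rho|] and [|m|] only. Since the
    cones are homogeneous, in both radial variables the profile can be traded for a
    Gaussian one, at the price of factors independent of [k]. There remains
    [int exp (- sum_i (rho_i^2 + l_i^2 / rho_i^2))], where integrating out [rho]
    gives [exp (- 2 sum_i |l_i|)], the density of a sum of Laplace variables.
    With [E] and [F] the convolutions with the two halves of [exp (- 2 |x|)] and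
    [L = E + F], the integral over the cone is [L^(k-1) E^(n-k) phi] at [0], and
    the relation [4 E F = E + F] makes it a binomial coefficient. *)

(** * Lebesgue measure on row vectors *)

(** The parameter (n + 1) / 2 comes from counting powers of [rho_i]. The function (1 +
    |x|^2)^(-beta) is a mixture of exp (- rho^2 (1 + |x|^2)) with weight rho^(2 beta - 1), and the
    substitution of the Gaussian vectors uses up exactly n powers of each [rho_i]: d = n - 1 in the
    Jacobian and one in the determinant. Hence 2 beta - 1 = n. The integrals of the discarded radial
    profiles are never evaluated. They are constants in [0, +oo] common to all [k], so the
    identities are kept in multiplied form; the case k = n, where the cone is the whole space, shows
    that the constant is finite and then removes it. The relation between E and F is a partial
    fraction: on exp (i t s) they act as multiplication by 1 / (2 - i t) and 1 / (2 + i t).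
    Iterated, it is Pascal's rule, with boundary values E^p phi (0) = F^p phi (0) = 4^(-p). The
    volumes of the statement are nested one-dimensional integrals, which make sense without
    measurability. The measure [lebrv] is built so that Tonelli's theorem and linear substitutions
    become available for them. *)

Section MatrixMeasurable.
Variables (R : realType) (m n : nat).

(** The product sigma-algebra, generated by the entries. Points and configurations are both
    matrices, so one instance serves for both. *)
Definition mx_cylinder : set (set 'M[R]_(m, n)) :=
  [set A | exists (i : 'I_m) (j : 'I_n) (B : set R), measurable B /\ A = [set M : 'M[R]_(m, n) | B (M i j)]].

Let mx0 : <<s mx_cylinder >> set0. Proof. exact: sigma_algebra0. Qed.
Let mxC A : <<s mx_cylinder >> A -> <<s mx_cylinder >> (~` A).
Proof. exact: sigma_algebraC. Qed.
Let mxU (F : (set 'M[R]_(m, n))^nat) : (forall i, <<s mx_cylinder >> (F i)) ->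
  <<s mx_cylinder >> (\bigcup_i (F i)).
Proof. exact: sigma_algebra_bigcup. Qed.

HB.instance Definition _ := @isMeasurable.Build default_measure_display
  'M[R]_(m, n) <<s mx_cylinder >> mx0 mxC mxU.

Lemma measurable_entry (i : 'I_m) (j : 'I_n) :
  measurable_fun setT (fun M : 'M[R]_(m, n) => M i j).
Proof.
move=> _ B mB; rewrite setTI; apply: sub_sigma_algebra.
by exists i, j, B.
Qed.

Lemma measurable_fun_mx d (T : measurableType d) (f : T -> 'M[R]_(m, n)) :
  (forall i j, measurable_fun setT (fun t => f t i j)) -> measurable_fun setT f.
Proof.
move=> mf; apply: (measurability mx_cylinder) => //.
move=> _ [_ [i [j [B [mB ->]]]] <-]; rewrite setTI.
by rewrite -[X in measurable X]setTI; exact: mf.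
Qed.

End MatrixMeasurable.

Section Tonelli.
Context d1 d2 (T1 : measurableType d1) (T2 : measurableType d2) (R : realType).
Variables (f : T1 -> T2 -> \bar R).
Hypothesis mf : measurable_fun setT (fun p : T1 * T2 => f p.1 p.2).
Hypothesis f0 : forall x y, (0 <= f x y)%E.

Lemma tonelli (m1 : {sigma_finite_measure set T1 -> \bar R})
    (m2 : {sigma_finite_measure set T2 -> \bar R}) :
  (\int[m1]_x \int[m2]_y f x y = \int[m2]_y \int[m1]_x f x y)%E.
Proof. exact: (fubini_tonelli (fun p => f p.1 p.2)). Qed.

Lemma measurable_integralr (m2 : {sigma_finite_measure set T2 -> \bar R}) :
  measurable_fun setT (fun x => \int[m2]_y f x y)%E.
Proof. exact: (measurable_fun_fubini_tonelli_F (fun p => f p.1 p.2)). Qed.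

Lemma measurable_integrall (m1 : {sigma_finite_measure set T1 -> \bar R}) :
  measurable_fun setT (fun y => \int[m1]_x f x y)%E.
Proof. exact: (measurable_fun_fubini_tonelli_G (fun p => f p.1 p.2)). Qed.

End Tonelli.

Section Affine.
Variable R : realType.
Local Notation mu := (@lebesgue_measure R).

Definition affine_fun (a b : R) : measurableTypeR R -> measurableTypeR R :=
  fun x => a * x + b.

Lemma measurable_affine (a b : R) : measurable_fun setT (affine_fun a b).
Proof. by apply: measurable_funD => //; apply: measurable_funM. Qed.

HB.instance Definition _ a b :=
  isMeasurableFun.Build _ _ _ _ (affine_fun a b) (measurable_affine a b).

(** The rescaled push-forward agrees with Lebesgue measure on half-open intervals, which determine
    it. *)
Lemma lebesgue_measure_affine (a b : R) (A : set R) : a != 0 -> measurable A ->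
  (`|a|%:E * mu ((fun x : R => (a * x + b)%R) @^-1` A) = mu A)%E.
Proof.
move=> a0 mA; pose phi := affine_fun a b.
pose nu : {measure set (measurableTypeR R) -> \bar R} :=
  mscale (NngNum (normr_ge0 a)) (pushforward mu phi).
change (nu (@measurable_affine a b) A = mu A); apply/esym/lebesgue_measure_unique => //= _ [[x y]] _ <-.
rewrite /nu /= /mscale /pushforward /=.
have [alt0|agt0|aE0] := ltgtP a 0; last by rewrite aE0 eqxx in a0.
(* For [a < 0] the order is reversed and the preimage is half-open on the other side, with the same
   length. *)
- rewrite /pushforward (_ : phi @^-1` _ = `[(y - b) / a, (x - b) / a[%classic); last first.
    apply/seteqP; split=> z; rewrite /= !in_itv /= /phi.
      by rewrite ler_ndivrMr ?ltr_ndivlMr// lerBrDr ltrBlDr mulrC => /andP[-> ->].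
    by rewrite ler_ndivrMr ?ltr_ndivlMr// lerBrDr ltrBlDr mulrC => /andP[-> ->].
  rewrite !lebesgue_measure_itv /= !lte_fin ltr_nM2r ?invr_lt0// ltrD2r.
  case: ifPn => xy; last by rewrite mule0.
  rewrite -!EFinB -EFinM ltr0_norm//; congr EFin.
  by field.
- rewrite /pushforward (_ : phi @^-1` _ = `](x - b) / a, (y - b) / a]%classic); last first.
    apply/seteqP; split=> z; rewrite /= !in_itv /= /phi.
      by rewrite ler_pdivlMr ?ltr_pdivrMr// lerBrDr ltrBlDr mulrC => /andP[-> ->].
    by rewrite ler_pdivlMr ?ltr_pdivrMr// lerBrDr ltrBlDr mulrC => /andP[-> ->].
  rewrite !lebesgue_measure_itv /= !lte_fin ltr_pM2r ?invr_gt0// ltrD2r.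
  case: ifPn => xy; last by rewrite mule0.
  rewrite -!EFinB -EFinM gtr0_norm//; congr EFin.
  by field.
Qed.

Lemma integral_affine (f : R -> \bar R) (a b : R) : a != 0 ->
  measurable_fun setT f -> (forall x, (0 <= f x)%E) ->
  (\int[mu]_x f x = `|a|%:E * \int[mu]_x f (a * x + b)%R)%E.
Proof.
move=> a0 mf f0; pose phi := affine_fun a b.
rewrite -[X in (_ * X)%E](@ge0_integral_pushforward _ _ _ _ _ phi (@measurable_affine a b) mu setT f)//.
pose pm :
    {measure set (measurableTypeR R) -> \bar R} := pushforward mu phi.
have := @ge0_integral_mscale _ _ _ (pm (@measurable_affine a b)) setT measurableT
  (NngNum (normr_ge0 a)) f mf (fun x _ => f0 x).
rewrite /pm => /= <-.
apply: eq_measure_integral => A mA _; exact/esym/lebesgue_measure_affine.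
Qed.

End Affine.

Section lebrv.
Variable R : realType.
Local Notation mu := (@lebesgue_measure R).

Definition rcons0 N (p : measurableTypeR R * 'rV[R]_N) : 'rV[R]_N.+1 :=
  row_mx (p.1%:M : 'M[R]_1) p.2.
Definition runcons0 N (u : 'rV[R]_N.+1) : measurableTypeR R * 'rV[R]_N :=
  (u 0 0, rsubmx (u : 'rV_(1 + N))).

Lemma rcons0K N : cancel (@rcons0 N) (@runcons0 N).
Proof.
move=> [x u]; rewrite /runcons0 /rcons0 /= row_mxKr; congr pair.
by rewrite mxE; case: splitP => // j _; rewrite !ord1 mxE.
Qed.

Lemma measurable_rcons0 N : measurable_fun setT (@rcons0 N).
Proof.
apply: measurable_fun_mx => i j; under eq_fun do rewrite mxE; case: splitP => k _.
  by under eq_fun do rewrite !ord1 mxE eqxx mulr1n; exact: measurable_fst.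
by apply: (@measurableT_comp _ _ _ _ _ _ (fun M : 'rV_N => M i k)) => //;
  exact: measurable_entry.
Qed.

Lemma measurable_runcons0 N : measurable_fun setT (@runcons0 N).
Proof.
apply/measurable_fun_pairP; split; first exact: measurable_entry.
apply: measurable_fun_mx => i j /=; under eq_fun do rewrite mxE.
exact: measurable_entry.
Qed.

Definition lebS N (m : {sigma_finite_measure set 'rV[R]_N -> \bar R}) :
    set 'rV[R]_N.+1 -> \bar R :=
  pushforward (mu \x m)%E (@rcons0 N).

Section lebS.
Variables (N : nat) (m : {sigma_finite_measure set 'rV[R]_N -> \bar R}).

Let lebS0 : lebS m set0 = 0%E.
Proof. by rewrite /lebS /pushforward preimage_set0 measure0. Qed.

Let lebS_ge0 A : (0 <= lebS m A)%E.
Proof. by rewrite /lebS /pushforward; apply: integral_ge0. Qed.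

Let lebS_sigma_additive : semi_sigma_additive (lebS m).
Proof.
have mr (A : set 'rV[R]_N.+1) : measurable A -> measurable (@rcons0 N @^-1` A).
  by move=> mA; rewrite -[X in measurable X]setTI; exact: measurable_rcons0.
move=> F mF tF mUF; rewrite /lebS /pushforward preimage_bigcup.
apply: measure_semi_sigma_additive.
- by move=> n; exact: mr.
- apply/trivIsetP => /= i j _ _ ij; rewrite -preimage_setI.
  by move/trivIsetP : tF => /(_ _ _ _ _ ij) ->//; rewrite preimage_set0.
- by rewrite -preimage_bigcup; exact: mr.
Qed.

HB.instance Definition _ := isMeasure.Build _ _ _ (lebS m)
  lebS0 lebS_ge0 lebS_sigma_additive.

Lemma lebS_sigma_finite : sigma_finite setT (lebS m).
Proof.
have /sigma_finiteP[F [TF ndF Foo]] := sigma_finiteT mu.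
have /sigma_finiteP[G [TG ndG Goo]] := sigma_finiteT m.
exists (fun n => @runcons0 N @^-1` (F n `*` G n)).
  rewrite -preimage_bigcup -[LHS](preimage_setT (@runcons0 N)); congr preimage.
  rewrite -setXTT TF TG predeqE => -[x y]; split.
    move=> [/= [n _ Fnx] [k _ Gky]]; exists (maxn n k) => //; split.
    - by move: x Fnx; exact/subsetPset/ndF/leq_maxl.
    - by move: y Gky; exact/subsetPset/ndG/leq_maxr.
  by move=> [n _ []/= ? ?]; split; exists n.
move=> k; have [mF Fk] := Foo k; have [mG Gk] := Goo k; split.
  rewrite -[X in measurable X]setTI; apply: measurable_runcons0 => //.
  exact: measurableX.
rewrite /lebS /pushforward -comp_preimage (_ : _ \o _ = id).
  by rewrite preimage_id product_measure1E// lte_mul_pinfty// ge0_fin_numE.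
by apply/funext => p /=; rewrite rcons0K.
Qed.

HB.instance Definition _ := Measure_isSigmaFinite.Build _ _ _ (lebS m)
  lebS_sigma_finite.
End lebS.

(** Coordinates are split off in the order used by [iter_int]. Sigma-finiteness is carried along the
    recursion because each use of Tonelli's theorem asks for it. *)
Fixpoint lebrv N : {sigma_finite_measure set 'rV[R]_N -> \bar R} :=
  match N with
  | 0 => \d_(0 : 'rV[R]_0)
  | N'.+1 => lebS (lebrv N')
  end.

Lemma integral_lebrvS N (f : 'rV[R]_N.+1 -> \bar R) :
  measurable_fun setT f -> (forall u, (0 <= f u)%E) ->
  (\int[lebrv N.+1]_u f u = \int[mu]_x \int[lebrv N]_u f (rcons0 (x, u)))%E.
Proof.
move=> mf f0.
have E := @ge0_integral_pushforward _ _ _ _ _ _ (@measurable_rcons0 N)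
  (mu \x lebrv N)%E setT f measurableT mf (fun u _ => f0 u).
rewrite preimage_setT in E.
rewrite [LHS]E.
rewrite fubini_tonelli1//; last by move=> p; exact: f0.
exact: (measurableT_comp mf (@measurable_rcons0 N)).
Qed.

Lemma iter_int_lebrv N (f : 'rV[R]_N -> \bar R) :
  measurable_fun setT f -> (forall u, (0 <= f u)%E) ->
  iter_int N (fun v => f (\row_j v j)) = (\int[lebrv N]_u f u)%E.
Proof.
elim: N f => [|N IH] f mf f0.
  rewrite /= integral_dirac// diracE in_setT mul1e; congr f.
  by apply/rowP => -[].
rewrite integral_lebrvS//=; apply: eq_integral => x _.
rewrite -IH; last 2 first.
- exact: (measurableT_comp mf (measurableT_comp (@measurable_rcons0 N) (pair1_measurable x))).
- by move=> u.
congr iter_int; apply/funext => v; congr f; apply/rowP => i; rewrite !mxE.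
by case: splitP => j ij; rewrite !mxE /= ij ?ord1.
Qed.

End lebrv.

Section MeasurableMatrixOps.
Context d (T : measurableType d) (R : realType).
Implicit Types m n p : nat.

Lemma measurable_mx_entry m n (f : T -> 'M[R]_(m, n)) i j :
  measurable_fun setT f -> measurable_fun setT (fun t => f t i j).
Proof.
move=> mf; apply: (@measurableT_comp _ _ _ _ _ _ (fun M : 'M[R]_(m, n) => M i j)) => //.
exact: measurable_entry.
Qed.

Lemma measurable_mulmx m n p (f : T -> 'M[R]_(m, n)) (g : T -> 'M[R]_(n, p)) :
  measurable_fun setT f -> measurable_fun setT g ->
  measurable_fun setT (fun t => f t *m g t).
Proof.
move=> mf mg; apply: measurable_fun_mx => i j; under eq_fun do rewrite mxE.
by apply: measurable_sum => k; apply: measurable_funM; exact: measurable_mx_entry.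
Qed.

Lemma measurable_addmx m n (f g : T -> 'M[R]_(m, n)) :
  measurable_fun setT f -> measurable_fun setT g ->
  measurable_fun setT (fun t => f t + g t).
Proof.
move=> mf mg; apply: measurable_fun_mx => i j; under eq_fun do rewrite mxE.
by apply: measurable_funD; exact: measurable_mx_entry.
Qed.

Lemma measurable_oppmx m n (f : T -> 'M[R]_(m, n)) :
  measurable_fun setT f -> measurable_fun setT (fun t => - f t).
Proof.
move=> mf; apply: measurable_fun_mx => i j; under eq_fun do rewrite mxE.
by apply: measurable_funN; exact: measurable_mx_entry.
Qed.

Lemma measurable_scalemx m n (c : T -> R) (f : T -> 'M[R]_(m, n)) :
  measurable_fun setT c -> measurable_fun setT f ->
  measurable_fun setT (fun t => c t *: f t).
Proof.
move=> mc mf; apply: measurable_fun_mx => i j; under eq_fun do rewrite mxE.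
by apply: measurable_funM => //; exact: measurable_mx_entry.
Qed.

Lemma measurable_rcons0_comp n (f : T -> measurableTypeR R * 'rV[R]_n) :
  measurable_fun setT f -> measurable_fun setT (fun t => rcons0 (f t)).
Proof.
move=> mf; apply: (@measurableT_comp _ _ _ _ _ _ (@rcons0 R n)) => //.
exact: measurable_rcons0.
Qed.

Lemma measurable_det n (f : T -> 'M[R]_n) :
  measurable_fun setT f -> measurable_fun setT (fun t => \det (f t)).
Proof.
move=> mf; rewrite /determinant; apply: measurable_sum => s.
apply: measurable_funM => //; apply: measurable_prod => i _.
exact: measurable_mx_entry.
Qed.

End MeasurableMatrixOps.

(* Goal-directed measurability; [meas] is redefined below each time new
   operations receive their measurability lemma. *)
Ltac meas1 :=
  lazymatch goal with
  | |- measurable_fun _ (fun x => x) => exact: measurable_id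
  | |- measurable_fun _ (fun x => fst x) => exact: measurable_fst
  | |- measurable_fun _ (fun x => snd x) => exact: measurable_snd
  | |- measurable_fun _ (fun x => @mulmx _ _ _ _ (@?f x) (@?g x)) => apply: measurable_mulmx
  | |- measurable_fun _ (fun x => @rcons0 _ _ (@?f x)) => apply: measurable_rcons0_comp
  | |- measurable_fun _ (fun x => @pair _ _ (@?f x) (@?g x)) => apply: measurable_fun_pair
  | |- measurable_fun _ (fun x => @GRing.scale _ _ (@?f x) (@?g x)) => apply: measurable_scalemx
  | |- measurable_fun _ (fun x => @determinant _ _ (@?f x)) => apply: measurable_det
  | |- measurable_fun _ (fun x => @fun_of_matrix _ _ _ (@?f x) _ _) => apply: measurable_mx_entry
  | |- measurable_fun _ (fun x => @GRing.mul _ (@?f x) (@?g x)) => apply: measurable_funM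
  | |- measurable_fun _ (fun x => @Algebra.add _ (@?f x) (@?g x)) =>
      first [apply: measurable_addmx | apply: measurable_funD]
  | |- measurable_fun _ (fun x => @Algebra.opp _ (@?f x)) =>
      first [apply: measurable_oppmx | apply: measurable_funN]
  | |- _ => exact: measurable_cst
  end.
Ltac meas := repeat meas1.

(** * Affine changes of variables in R^N *)

Section ChangeOfVariables.
Variable R : realType.
Local Notation mu := (@lebesgue_measure R).
Local Open Scope ereal_scope.

Lemma rcons0_mul_block N (x : R) (v : 'rV[R]_N) (A : 'M[R]_(1 + N)) (t : 'rV[R]_N.+1) :
  (rcons0 (x, v) *m A + t = rcons0
    ((A 0 0 * x + ((v *m dlsubmx A) 0 0 + t 0 0)),
     (x *: ursubmx A + v *m drsubmx A + (runcons0 t).2)))%R.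
Proof.
have E : (row_mx (x%:M : 'M[R]_1) v *m A =
    row_mx (x%:M *m ulsubmx A + v *m dlsubmx A)
           (x%:M *m ursubmx A + v *m drsubmx A))%R.
  by rewrite -mul_row_block submxK.
rewrite /rcons0 [X in (X + _)%R]E /=; apply/rowP => i; rewrite mxE [RHS]mxE.
rewrite [X in (X + _)%R]mxE; case: splitP => j ij.
  rewrite !ord1 !mxE big_ord1 !mxE eqxx mulr1n -!addrA.
  congr (_ + (_ + _))%R; last by congr (t _ _); apply/val_inj; rewrite /= ij ord1.
  by rewrite mulrC; congr (A _ _ * _)%R; exact/val_inj.
rewrite mul_scalar_mx !mxE; congr (_ + t _ _)%R; exact/val_inj.
Qed.

Lemma measurable_section2 d1 d2 (T1 : measurableType d1) (T2 : measurableType d2)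
    (f : T1 -> T2 -> \bar R) y :
  measurable_fun setT (fun p : T1 * T2 => f p.1 p.2) -> measurable_fun setT (f ^~ y).
Proof.
by move=> mf; exact: (measurableT_comp mf (pair2_measurable y)).
Qed.

Lemma measurable_flip d1 d2 (T1 : measurableType d1) (T2 : measurableType d2)
    (f : T1 -> T2 -> \bar R) :
  measurable_fun setT (fun p : T1 * T2 => f p.1 p.2) ->
  measurable_fun setT (fun p : T2 * T1 => f p.2 p.1).
Proof.
move=> mf.
have ms : measurable_fun setT (fun p : T2 * T1 => (p.2, p.1)).
  by apply: measurable_fun_pair; meas.
exact: (measurableT_comp mf ms).
Qed.

Definition schur N (A : 'M[R]_(1 + N)) : 'M[R]_N :=
  (drsubmx A - (A 0 0)^-1 *: (dlsubmx A *m ursubmx A))%R.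

(** Block elimination: the left factor is unipotent, the right one block triangular with diagonal
    blocks [A 0 0] and the Schur complement. *)
Lemma det_schur N (A : 'M[R]_(1 + N)) : (A 0 0 != 0)%R ->
  (\det A = A 0 0 * \det (schur A))%R.
Proof.
move=> a0.
have ulE : (ulsubmx A = (A 0 0)%:M)%R.
  by apply/matrixP => i j; rewrite !ord1 !mxE eqxx mulr1n; congr (A _ _); exact/val_inj.
have AE : A = (block_mx 1%:M 0 ((A 0 0)^-1 *: dlsubmx A) 1%:M *m
             block_mx (A 0 0)%:M (ursubmx A) 0 (schur A))%R.
  rewrite mulmx_block !mul1mx !mul0mx !addr0 -scalemxAl.
  rewrite mul_mx_scalar scalerA mulVf// scale1r -scalemxAl /schur addrC subrK.
  by rewrite -ulE submxK.
by rewrite {1}AE det_mulmx det_lblock det_ublock !det1 !mul1r det_scalar1.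
Qed.

Section pivot.
Variable N : nat.
Hypothesis IH : forall (A : 'M[R]_N) (t : 'rV[R]_N) (f : 'rV[R]_N -> \bar R),
  A \in unitmx -> measurable_fun setT f -> (forall u, 0 <= f u) ->
  \int[lebrv R N]_u f u =
    `|\det A|%:E * \int[lebrv R N]_u f (u *m A + t)%R.

(** With a nonzero pivot, the first coordinate is replaced at fixed [v] by a one-dimensional
    substitution. At a fixed new coordinate [y] what remains is affine in [v] with linear part
    [schur A]. Its translation depends on [y], which is why the induction hypothesis ranges over all
    translations. *)
Lemma integral_affine_pivot (A : 'M[R]_N.+1) (t : 'rV[R]_N.+1)
    (f : 'rV[R]_N.+1 -> \bar R) : (A 0 0 != 0)%R ->
  A \in unitmx -> measurable_fun setT f -> (forall u, 0 <= f u) ->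
  \int[lebrv R N.+1]_u f u =
    `|\det A|%:E * \int[lebrv R N.+1]_u f (u *m A + t)%R.
Proof.
move=> a0 uA mf f0.
have dS : schur (A : 'M[R]_(1 + N)) \in unitmx.
  move: uA; rewrite !unitmxE !unitfE det_schur// mulf_eq0 negb_or.
  by case/andP.
pose b := ursubmx (A : 'M[R]_(1 + N)); pose c := dlsubmx (A : 'M[R]_(1 + N)).
pose D := drsubmx (A : 'M[R]_(1 + N)); pose t' := (runcons0 t).2.
pose s (v : 'rV[R]_N) := ((v *m c) 0 0 + t 0 0)%R.
pose h (x : measurableTypeR R) (v : 'rV[R]_N) :=
  f (rcons0 (A 0 0 * x + s v, x *: b + v *m D + t'))%R.
(* [g] is [h] in the new first coordinate, the old one being recovered as [(y - s v) / A 0 0]. *)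
pose g (y : measurableTypeR R) (v : 'rV[R]_N) :=
  f (rcons0 (y, ((y - s v) / A 0 0) *: b + v *m D + t'))%R.
have mh : measurable_fun setT (fun p : measurableTypeR R * 'rV[R]_N => h p.1 p.2).
  by apply: (measurableT_comp mf); rewrite ?/s; meas.
have mg : measurable_fun setT (fun p : measurableTypeR R * 'rV[R]_N => g p.1 p.2).
  by apply: (measurableT_comp mf); rewrite ?/s; meas.
have -> : \int[lebrv R N.+1]_u f (u *m A + t)%R =
          \int[mu]_x \int[lebrv R N]_v h x v.
  rewrite integral_lebrvS; last 2 first.
  - by apply: (measurableT_comp mf); rewrite ?/s; meas.
  - by move=> u; exact: f0.
  by apply: eq_integral => x _; apply: eq_integral => v _; rewrite rcons0_mul_block.
rewrite det_schur// normrM EFinM -muleA muleCA tonelli//; last by move=> *; exact: f0.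
have f0' x v : 0 <= h x v by exact: f0.
rewrite -ge0_integralZl//; last 2 first.
- exact: measurable_integrall.
- by move=> v _; apply: integral_ge0.
under eq_integral.
  move=> v _.
  have -> : `|(A 0 0)%R|%:E * \int[mu]_x h x v = \int[mu]_y g y v.
    rewrite (@integral_affine R (g ^~ v) (A 0 0)%R (s v) a0); last 2 first.
    - exact: (measurable_section2 v mg).
    - by move=> y; exact: f0.
    congr (_ * _); apply: eq_integral => x _; rewrite /g /h.
    by congr (f (rcons0 (_, _ *: b + _ + _)))%R; field.
  over.
rewrite (tonelli (f := fun v y => g y v)); last 2 first.
- exact: measurable_flip mg.
- by move=> *; exact: f0.
rewrite -ge0_integralZl//; last 2 first.
- by apply: measurable_integralr => // *; exact: f0.
- by move=> v _; apply: integral_ge0 => *; exact: f0.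
rewrite integral_lebrvS//; apply: eq_integral => y _.
rewrite (IH (((y - t 0 0) / A 0 0) *: b + t')%R dS); last 2 first.
- by apply: (measurableT_comp mf); rewrite ?/s; meas.
- by move=> v; exact: f0.
congr (_ * _); apply: eq_integral => v _; rewrite /g /s.
congr (f (rcons0 (_, _))).
rewrite /schur mulmxBr -scalemxAr mulmxA -/c -/b -/D.
set z := ((v *m c) 0 0)%R; have -> : (v *m c = z%:M)%R.
  by apply/matrixP => i j; rewrite !ord1 [RHS]mxE eqxx mulr1n.
rewrite mul_scalar_mx; apply/rowP => i; rewrite !mxE.
set w := (\sum_(_ < _) _)%R; field.
exact: a0.
Qed.

End pivot.

(** If the pivot vanishes, adding to the first row some row with a nonzero entry in column 0 creates
    one. This row operation is a shear: at fixed [x] it translates [v] by [x] times a basis vector,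
    so it preserves the integral by the induction hypothesis for the identity matrix. *)
Lemma integral_lebrv_affine N (A : 'M[R]_N) (t : 'rV[R]_N) (f : 'rV[R]_N -> \bar R) :
  A \in unitmx -> measurable_fun setT f -> (forall u, 0 <= f u) ->
  \int[lebrv R N]_u f u =
    `|\det A|%:E * \int[lebrv R N]_u f (u *m A + t)%R.
Proof.
elim: N A t f => [|N IH] A t f uA mf f0.
  rewrite /= !integral_dirac//; last first.
    by apply: (measurableT_comp mf); rewrite ?/s; meas.
  by rewrite det_mx00 normr1 mul1e; congr (_ * f _); apply/rowP => -[].
have [a0|a0] := eqVneq (A 0 0)%R 0%R; last exact: integral_affine_pivot.
have [i Ai] : exists i : 'I_N, (dlsubmx (A : 'M[R]_(1 + N)) i 0 != 0)%R.
  apply/existsP; apply: contraLR uA; rewrite negb_exists => /forallP A0.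
  rewrite unitmxE unitfE negbK (expand_det_col _ 0%R) big1// => j _.
  have -> : (A j 0 = 0)%R; last by rewrite mul0r.
  case: (unliftP 0%R j) => [k ->|->//].
  have := A0 k; rewrite negbK => /eqP; rewrite !mxE => <-.
  by congr (A _ _); exact/val_inj.
pose B : 'M[R]_(1 + N) := (block_mx 1%:M (delta_mx 0 i) 0 1%:M)%R.
have BAE : (B *m (A : 'M[R]_(1 + N)) = block_mx
    (ulsubmx (A : 'M[R]_(1 + N)) + row i (dlsubmx (A : 'M[R]_(1 + N))))
    (ursubmx (A : 'M[R]_(1 + N)) + row i (drsubmx (A : 'M[R]_(1 + N))))
    (dlsubmx (A : 'M[R]_(1 + N))) (drsubmx (A : 'M[R]_(1 + N))))%R.
  rewrite -[X in (_ *m X)%R](@submxK _ 1 N 1 N A) mulmx_block.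
  by rewrite !mul1mx !mul0mx !add0r -!rowE.
have BA00 : ((B *m (A : 'M[R]_(1 + N))) 0 0 != 0)%R.
  have -> : (0 : 'I_(1 + N))%R = lshift N (0 : 'I_1)%R by exact: val_inj.
  have E1 : (ulsubmx (A : 'M[R]_(1 + N)) 0 0 = 0)%R.
    by rewrite !mxE -[RHS]a0; congr (A _ _); exact/val_inj.
  rewrite BAE block_mxEul; move: E1 Ai; set P := ulsubmx _; set Q := dlsubmx _.
  by move=> E1 Ai; rewrite mxE E1 add0r mxE.
have detB : (\det B = 1)%R by rewrite det_ublock !det1 mulr1.
have uBA : (B *m (A : 'M[R]_(1 + N))) \in unitmx.
  by rewrite unitmx_mul uA andbT unitmxE detB unitr1.
rewrite (integral_affine_pivot IH t BA00 uBA mf f0) det_mulmx detB mul1r.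
congr (_ * _).
have mg : measurable_fun setT (fun u : 'rV[R]_N.+1 => f (u *m A + t)%R).
  by apply: (measurableT_comp mf); meas.
rewrite !integral_lebrvS; last 4 first.
- exact: mg.
- by move=> u; exact: f0.
- by apply: (measurableT_comp mf); meas.
- by move=> u; exact: f0.
apply: eq_integral => x _.
rewrite [RHS](IH 1%:M%R (x *: delta_mx 0 i)%R (fun v => f (rcons0 (x, v) *m A + t)%R)).
- rewrite det1 normr1 mul1e; apply: eq_integral => v _.
  congr (f (_ + _))%R; rewrite mulmxA; congr (_ *m _)%R.
  have E : (row_mx (x%:M : 'M[R]_1) v *m B = row_mx x%:M (v + x *: delta_mx 0 i))%R.
    by rewrite mul_row_block mulmx0 addr0 !mulmx1 mul_scalar_mx addrC.
  by apply: (eq_trans E); rewrite mulmx1.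
- exact: unitmx1.
- by apply: (measurableT_comp mf); meas.
- by move=> v; exact: f0.
Qed.

End ChangeOfVariables.

(** * Measurability of real and matrix expressions *)

Section MeasurableReal.
Context d (T : measurableType d) (R : realType).

Lemma measurable_invr (f : T -> R) :
  measurable_fun setT f -> measurable_fun setT (fun x => (f x)^-1).
Proof.
(* The square makes the base of the real power nonnegative; at zeros of [f] both sides are 0. *)
move=> mf; have -> : (fun x => (f x)^-1) = (fun x => f x * (f x ^+ 2) `^ (-1)).
  apply/funext => x; have [->|fx0] := eqVneq (f x) 0; first by rewrite invr0 mul0r.
  by rewrite powR_inv1 ?sqr_ge0// expr2; field.
apply: measurable_funM => //.
apply: (@measurableT_comp _ _ _ _ _ _ (@powR R ^~ (-1))); first exact: measurable_powR.
exact: measurable_funX.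
Qed.

Lemma measurable_sqrtr (f : T -> R) :
  measurable_fun setT f -> measurable_fun setT (fun x => Num.sqrt (f x)).
Proof.
move=> mf; apply: (@measurableT_comp _ _ _ _ _ _ (@Num.sqrt R)) => //.
by apply: continuous_measurable_fun => x; exact: sqrt_continuous.
Qed.

Lemma measurable_expRr (f : T -> R) :
  measurable_fun setT f -> measurable_fun setT (fun x => expR (f x)).
Proof. by move=> mf; apply: measurableT_comp. Qed.

Lemma measurable_normrr (f : T -> R) :
  measurable_fun setT f -> measurable_fun setT (fun x => `|f x|).
Proof. by move=> mf; apply: measurableT_comp. Qed.

Lemma measurable_powRc (f : T -> R) p :
  measurable_fun setT f -> measurable_fun setT (fun x => f x `^ p).
Proof.
by move=> mf; apply: (@measurableT_comp _ _ _ _ _ _ (@powR R ^~ p)).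
Qed.

Lemma measurable_boolr (b : T -> bool) :
  measurable_fun setT b -> measurable_fun setT (fun x => (b x)%:R : R).
Proof.
move=> mb; have -> : (fun x => (b x)%:R : R) = (fun x => if b x then 1 else 0).
  by apply/funext => x; case: (b x).
exact: measurable_fun_ifT.
Qed.

Lemma measurable_ltr_ind (f g : T -> R) :
  measurable_fun setT f -> measurable_fun setT g ->
  measurable_fun setT (fun x => (f x < g x)%R%:R : R).
Proof. by move=> mf mg; apply: measurable_boolr; exact: measurable_fun_ltr. Qed.

Lemma measurable_ler_ind (f g : T -> R) :
  measurable_fun setT f -> measurable_fun setT g ->
  measurable_fun setT (fun x => (f x <= g x)%R%:R : R).
Proof. by move=> mf mg; apply: measurable_boolr; exact: measurable_fun_ler. Qed.

Lemma measurable_eqr_ind (f g : T -> R) :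
  measurable_fun setT f -> measurable_fun setT g ->
  measurable_fun setT (fun x => (f x == g x)%R%:R : R).
Proof. by move=> mf mg; apply: measurable_boolr; exact: measurable_fun_eqr. Qed.

Lemma measurable_neqr_ind (f g : T -> R) :
  measurable_fun setT f -> measurable_fun setT g ->
  measurable_fun setT (fun x => (f x != g x)%R%:R : R).
Proof.
move=> mf mg; have -> : (fun x => (f x != g x)%R%:R : R) = (fun x => 1 - (f x == g x)%R%:R).
  by apply/funext => x; case: eqP; rewrite ?subr0 ?subrr.
by apply: measurable_funB => //; exact: measurable_eqr_ind.
Qed.

Lemma measurable_EFinr (f : T -> R) :
  measurable_fun setT f -> measurable_fun setT (fun x => (f x)%:E).
Proof. by move=> mf; exact/measurable_EFinP. Qed.

Lemma measurable_sqnorm n (f : T -> 'rV[R]_n) :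
  measurable_fun setT f -> measurable_fun setT (fun x => sqnorm (f x)).
Proof.
move=> mf; apply: measurable_sum => i; apply: measurable_funX.
exact: measurable_mx_entry.
Qed.

Lemma measurable_vec_mx m n (f : T -> 'rV[R]_(m * n)) :
  measurable_fun setT f -> measurable_fun setT (fun x => vec_mx (f x)).
Proof.
move=> mf; apply: measurable_fun_mx => i j; under eq_fun do rewrite mxE.
exact: measurable_mx_entry.
Qed.

Lemma measurable_row m n i (f : T -> 'M[R]_(m, n)) :
  measurable_fun setT f -> measurable_fun setT (fun x => row i (f x)).
Proof.
move=> mf; apply: measurable_fun_mx => k j; under eq_fun do rewrite mxE.
exact: measurable_mx_entry.
Qed.

Lemma measurable_trmx m n (f : T -> 'M[R]_(m, n)) :
  measurable_fun setT f -> measurable_fun setT (fun x => (f x)^T).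
Proof.
move=> mf; apply: measurable_fun_mx => k j; under eq_fun do rewrite mxE.
exact: measurable_mx_entry.
Qed.

Lemma measurable_row_mx m n1 n2 (f : T -> 'M[R]_(m, n1)) (g : T -> 'M[R]_(m, n2)) :
  measurable_fun setT f -> measurable_fun setT g ->
  measurable_fun setT (fun x => row_mx (f x) (g x)).
Proof.
move=> mf mg; apply: measurable_fun_mx => k j; under eq_fun do rewrite mxE.
by case: splitP => ? _; exact: measurable_mx_entry.
Qed.

End MeasurableReal.

Ltac meas2 :=
  lazymatch goal with
  | |- measurable_fun _ (fun x => x) => exact: measurable_id
  | |- measurable_fun _ (@fst _ _) => exact: measurable_fst
  | |- measurable_fun _ (@snd _ _) => exact: measurable_snd
  | |- measurable_fun _ (fun x => fst x) => exact: measurable_fst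
  | |- measurable_fun _ (fun x => snd x) => exact: measurable_snd
  | |- measurable_fun _ (fun x => fst (@?f x)) => apply: measurableT_comp; [exact: measurable_fst|]
  | |- measurable_fun _ (fun x => snd (@?f x)) => apply: measurableT_comp; [exact: measurable_snd|]
  | |- measurable_fun _ (fun x => @pair _ _ (@?f x) (@?g x)) => apply: measurable_fun_pair
  | |- measurable_fun _ (fun x => @integral _ _ _ _ _ (@?f x)) => apply: measurable_integralr
  | |- measurable_fun _ (fun x => @EFin _ (@?f x)) => apply: measurable_EFinr
  | |- measurable_fun _ (fun x => @mule _ (@?f x) (@?g x)) => apply: emeasurable_funM
  | |- measurable_fun _ (fun x => (nat_of_bool (~~ (@eq_op _ (@?f x) (@?g x))))%:R) => apply: measurable_neqr_ind
  | |- measurable_fun _ (fun x => (nat_of_bool (@eq_op _ (@?f x) (@?g x)))%:R) => apply: measurable_eqr_ind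
  | |- measurable_fun _ (fun x => (nat_of_bool (@Order.lt _ _ (@?f x) (@?g x)))%:R) => apply: measurable_ltr_ind
  | |- measurable_fun _ (fun x => (nat_of_bool (@Order.le _ _ (@?f x) (@?g x)))%:R) => apply: measurable_ler_ind
  | |- measurable_fun _ (fun x => @mulmx _ _ _ _ (@?f x) (@?g x)) => apply: measurable_mulmx
  | |- measurable_fun _ (fun x => @rcons0 _ _ (@?f x)) => apply: measurable_rcons0_comp
  | |- measurable_fun _ (fun x => @GRing.scale _ _ (@?f x) (@?g x)) => apply: measurable_scalemx
  | |- measurable_fun _ (fun x => @determinant _ _ (@?f x)) => apply: measurable_det
  | |- measurable_fun _ (fun x => @sqnorm _ _ (@?f x)) => apply: measurable_sqnorm
  | |- measurable_fun _ (fun x => @vec_mx _ _ _ (@?f x)) => apply: measurable_vec_mx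
  | |- measurable_fun _ (fun x => @row _ _ _ _ (@?f x)) => apply: measurable_row
  | |- measurable_fun _ (fun x => @trmx _ _ _ (@?f x)) => apply: measurable_trmx
  | |- measurable_fun _ (fun x => @row_mx _ _ _ _ (@?f x) (@?g x)) => apply: measurable_row_mx
  | |- measurable_fun _ (fun x => @fun_of_matrix _ _ _ (@?f x) _ _) => apply: measurable_mx_entry
  | |- measurable_fun _ (fun x => @GRing.mul _ (@?f x) (@?g x)) => apply: measurable_funM
  | |- measurable_fun _ (fun x => @GRing.inv _ (@?f x)) => apply: measurable_invr
  | |- measurable_fun _ (fun x => @GRing.exp _ (@?f x) _) => apply: measurable_funX
  | |- measurable_fun _ (fun x => expR (@?f x)) => apply: measurable_expRr
  | |- measurable_fun _ (fun x => Num.sqrt (@?f x)) => apply: measurable_sqrtr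
  | |- measurable_fun _ (fun x => powR (@?f x) _) => apply: measurable_powRc
  | |- measurable_fun _ (fun x => @Num.norm _ _ (@?f x)) => apply: measurable_normrr
  | |- measurable_fun _ (fun x => @Algebra.add _ (@?f x) (@?g x)) =>
      first [apply: measurable_addmx | apply: measurable_funD]
  | |- measurable_fun _ (fun x => @Algebra.opp _ (@?f x)) =>
      first [apply: measurable_oppmx | apply: measurable_funN]
  | |- measurable_fun _ (fun x => @bigop.body _ _ _ _ _) =>
      first [apply: measurable_sum => ? | apply: measurable_prod => ? _]
  | |- measurable_fun _ (fun _ => _) => first [assumption | exact: measurable_cst]
  | |- measurable_fun ?D ?f =>
      first [assumption | change (measurable_fun D (fun x => f x))]
  end.
Ltac meas ::= repeat meas2.

(** * Integrals over configurations *)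

Section MatrixIntegral.
Variable R : realType.
Local Notation mu := (@lebesgue_measure R).

Definition intM n d (f : 'M[R]_(n, d) -> \bar R) : \bar R :=
  (\int[lebrv R (n * d)]_u f (vec_mx u))%E.

Lemma lebrv_col_perm N (s : {perm 'I_N}) (f : 'rV[R]_N -> \bar R) :
  measurable_fun setT f -> (forall u, (0 <= f u)%E) ->
  (\int[lebrv R N]_u f u = \int[lebrv R N]_u f (col_perm s u))%E.
Proof.
move=> mf f0.
have uP : perm_mx s^-1 \in @unitmx R N by rewrite unitmx_perm.
rewrite (integral_lebrv_affine 0 uP mf f0) det_perm normrX normrN1 expr1n mul1e.
by apply: eq_integral => u _; rewrite addr0 -col_permE.
Qed.

(** [cfg_int] numbers the entries row by row as [i * d + j], whereas [vec_mx] follows the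
    enumeration of pairs of indices. The two orders differ by a permutation of the coordinates, of
    determinant 1 or -1, which need not be known explicitly. *)
Lemma cfg_int_intM n d (f : 'M[R]_(n, d) -> \bar R) :
  measurable_fun setT f -> (forall u, (0 <= f u)%E) -> cfg_int f = intM f.
Proof.
move=> mf f0; rewrite /cfg_int /intM.
have idx_subproof (i : 'I_n) (j : 'I_d) : (i * d + j < n * d)%N.
  case: i => i /= ilt; case: j => j /= jlt.
  by rewrite (leq_trans (n := i * d + d))// ?ltn_add2l// -mulSnr leq_mul2r ilt orbT.
pose idx i j := Ordinal (idx_subproof i j).
have idx_inj i j i' j' : idx i j = idx i' j' -> (i, j) = (i', j').
  move=> /(congr1 val) /= E.
  have d0 : (0 < d)%N by case: j {E} => [j] /= /(leq_trans _); apply.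
  congr pair; apply/val_inj.
    by have := congr1 (divn^~ d) E; rewrite !divnMDl// !divn_small// !addn0.
  by have := congr1 (modn^~ d) E; rewrite !modnMDl !modn_small.
pose p (a : 'I_(n * d)) := enum_val (cast_ord (esym (mxvec_cast n d)) a).
have pE i j : p (mxvec_index i j) = (i, j).
  by rewrite /p /mxvec_index cast_ordK enum_rankK.
have p_inj : injective p by move=> a b /enum_val_inj /cast_ord_inj.
have sigma_inj : injective (fun a => idx (p a).1 (p a).2).
  by move=> a b /idx_inj; rewrite -!surjective_pairing => /p_inj.
pose s := perm sigma_inj.
pose mat (u : 'rV[R]_(n * d)) := vec_mx (col_perm s u).
have matE u i j : mat u i j = u 0 (idx i j) by rewrite !mxE permE pE.
rewrite (lebrv_col_perm s (f := fun u => f (vec_mx u))); last 2 first.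
- by apply: (measurableT_comp mf); meas.
- by move=> u.
have mmat : measurable_fun setT mat.
  by apply: measurable_fun_mx => i j; under eq_fun do rewrite matE;
  exact: measurable_entry.
transitivity (\int[lebrv R (n * d)]_u f (mat u))%E; last by [].
have mfm : measurable_fun setT (fun u => f (mat u)) by exact: (measurableT_comp mf mmat).
rewrite -(iter_int_lebrv mfm)//; congr iter_int; apply/funext => v; congr f; apply/matrixP => i j.
by rewrite matE !mxE.
Qed.

Lemma lin_mulmx_entry n d (B : 'M[R]_n) i j k l :
  (lin_mulmx B : 'M[R]_(n * d)) (mxvec_index i j) (mxvec_index k l) =
  B k i * (j == l)%:R.
Proof.
rewrite /lin_mulmx /lin_mx /lin1_mx mxE /= mxvecE.
rewrite vec_mx_delta mxE (bigD1 i)//= big1 ?addr0.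
  by rewrite mxE eqxx eq_sym.
by move=> p pi; rewrite mxE (negbTE pi) mulr0.
Qed.

Lemma lin_mulmx_mul n d (A B : 'M[R]_n) :
  (lin_mulmx A : 'M[R]_(n * d)) *m lin_mulmx B = lin_mulmx (B *m A).
Proof.
apply/row_matrixP => i; rewrite !rowE mulmxA !mul_rV_lin /= mxvecK.
by rewrite mulmxA.
Qed.

Lemma lin_mulmx1 n d : (lin_mulmx 1%:M : 'M[R]_(n * d)) = 1%:M.
Proof.
by apply/row_matrixP => i; rewrite !rowE mul_rV_lin /= mul1mx vec_mxK mulmx1.
Qed.

Lemma lin_mulmx_tr n d (A : 'M[R]_n) :
  (lin_mulmx A : 'M[R]_(n * d))^T = lin_mulmx A^T.
Proof.
apply/matrixP => a b; rewrite mxE.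
case/mxvec_indexP: a => i j; case/mxvec_indexP: b => k l.
by rewrite !lin_mulmx_entry mxE eq_sym.
Qed.

Lemma lin_mulmx_unit n d (B : 'M[R]_n) :
  B \in unitmx -> (lin_mulmx B : 'M[R]_(n * d)) \in unitmx.
Proof.
move=> uB; have /mulmx1_unit[] // : (lin_mulmx B : 'M[R]_(n * d)) *m lin_mulmx (invmx B) = 1%:M.
by rewrite lin_mulmx_mul mulVmx// lin_mulmx1.
Qed.

(** Transposing left multiplication by [Q] gives left multiplication by the transpose of [Q], so the
    determinant has square 1. *)
Lemma det_lin_mulmx_orth n d (Q : 'M[R]_n) : Q *m Q^T = 1%:M ->
  `|\det (lin_mulmx Q : 'M[R]_(n * d))| = 1.
Proof.
move=> QQ; have QQ' : Q^T *m Q = 1%:M by exact: mulmx1C.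
have : `|\det (lin_mulmx Q : 'M[R]_(n * d))| ^+ 2 = 1.
  rewrite real_normK ?num_real// expr2 -{2}det_tr lin_mulmx_tr -det_mulmx.
  by rewrite lin_mulmx_mul QQ' lin_mulmx1 det1.
by move/eqP; rewrite sqrf_eq1 => /orP[/eqP//|/eqP E]; have := normr_ge0 (\det (lin_mulmx Q : 'M[R]_(n * d))); rewrite E oppr_ge0 ler10.
Qed.

Lemma det_lin_mulmx_diag n d (c : 'rV[R]_n) :
  \det (lin_mulmx (diag_mx c) : 'M[R]_(n * d)) = (\prod_i c 0 i) ^+ d.
Proof.
pose e : 'rV[R]_(n * d) := mxvec (\matrix_(i, j) c 0 i).
have -> : lin_mulmx (diag_mx c) = diag_mx e :> 'M[R]_(n * d).
  apply/matrixP => a b; case/mxvec_indexP: a => i j; case/mxvec_indexP: b => k l.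
  rewrite lin_mulmx_entry [RHS]mxE mxvecE !mxE.
  have -> : (mxvec_index i j == mxvec_index k l) = (i == k) && (j == l).
    by rewrite /mxvec_index (inj_eq (@cast_ord_inj _ _ _)) (inj_eq enum_rank_inj).
  rewrite (eq_sym k); case: eqVneq => [->|]; rewrite ?mul0r ?mulr0n//=.
  by case: eqP; rewrite ?mulr1 ?mulr0 ?mulr1n.
rewrite det_diag (reindex _ (@curry_mxvec_bij n d)) /=.
transitivity (\prod_(p : 'I_n * 'I_d) e 0 (mxvec_index p.1 p.2)).
  by apply: eq_bigr => -[].
rewrite -prodrXl -(pair_bigA _ (fun i j => e 0 (mxvec_index i j))) /=.
apply: eq_bigr => i _; under eq_bigr do rewrite mxvecE mxE.
by rewrite prodr_const card_ord.
Qed.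

Lemma intM_lmul n d (B : 'M[R]_n) (f : 'M[R]_(n, d) -> \bar R) : B \in unitmx ->
  measurable_fun setT f -> (forall u, (0 <= f u)%E) ->
  (intM f = `|\det (lin_mulmx B : 'M[R]_(n * d))|%:E * intM (fun M => f (B *m M)))%E.
Proof.
move=> uB mf f0; rewrite /intM.
rewrite (@integral_lebrv_affine _ _ (lin_mulmx B) 0 (fun u => f (vec_mx u)))//.
- by congr (_ * _)%E; apply: eq_integral => u _; rewrite addr0 mx_rV_lin.
- exact: lin_mulmx_unit.
- by apply: (measurableT_comp mf); meas.
Qed.

Lemma rcons0_0 N (x : measurableTypeR R) (u : 'rV[R]_N) : rcons0 (x, u) 0 0 = x.
Proof. by have := rcons0K (x, u); rewrite /runcons0 => -[]. Qed.

Lemma rcons0_S N (x : measurableTypeR R) (u : 'rV[R]_N) (i : 'I_N) j :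
  rcons0 (x, u) j (lift ord0 i) = u 0 i.
Proof.
rewrite mxE; case: splitP => k /= ik; first by rewrite (ord1 k) in ik.
by rewrite ord1; congr (u _ _); apply/val_inj; move: ik; rewrite /bump leq0n !add1n => -[].
Qed.

Lemma lebrv_prod N (h : 'I_N -> R -> R) :
  (forall i, measurable_fun setT (h i)) -> (forall i x, 0 <= h i x) ->
  (\int[lebrv R N]_u (\prod_i h i (u 0 i))%:E =
   \prod_i \int[mu]_x (h i x)%:E)%E.
Proof.
elim: N h => [|N IH] h mh h0.
  under eq_integral do rewrite big_ord0.
  by rewrite big_ord0 /= integral_dirac// diracE in_setT mul1e.
rewrite integral_lebrvS; last 2 first.
- apply: measurable_EFinr; apply: measurable_prod => i _.
  by apply: measurableT_comp => //; meas.
- by move=> u; rewrite lee_fin prodr_ge0.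
rewrite big_ord_recl.
under eq_integral => x _.
  under eq_integral => u _.
    rewrite big_ord_recl rcons0_0 EFinM.
    under eq_bigr do rewrite rcons0_S.
    over.
  rewrite ge0_integralZl//; last 3 first.
  - apply: measurable_EFinr; apply: measurable_prod => i _.
    by apply: measurableT_comp => //; meas.
  - by move=> u _; rewrite lee_fin prodr_ge0.
  - by rewrite lee_fin.
  rewrite (IH (fun i => h (lift ord0 i)))//.
  over.
rewrite ge0_integralZr//.
- by apply: measurable_EFinr; exact: mh.
- by move=> x _; rewrite lee_fin.
- by apply: (big_ind (fun x => 0 <= x)%E) => // [x y|i _]; [exact: mule_ge0|apply: integral_ge0 => x _; rewrite lee_fin].
Qed.

End MatrixIntegral.

(** * Reflections and orthogonal changes of coordinates *)

Section Rotations.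
Variable R : realType.
Implicit Types n d : nat.

Lemma sqnormE n (u : 'rV[R]_n) : sqnorm u = (u *m u^T) 0 0.
Proof. by rewrite /sqnorm mxE; apply: eq_bigr => i _; rewrite mxE expr2. Qed.

Lemma sqnorm_ge0 n (u : 'rV[R]_n) : 0 <= sqnorm u.
Proof. by apply: sumr_ge0 => i _; exact: sqr_ge0. Qed.

Lemma sqnorm_eq0 n (u : 'rV[R]_n) : (sqnorm u == 0) = (u == 0).
Proof.
apply/eqP/eqP => [u0|->]; last first.
  by rewrite /sqnorm big1// => i _; rewrite mxE expr0n.
apply/rowP => i; rewrite mxE; apply/eqP; rewrite -sqrf_eq0; apply/eqP.
by apply: (psumr_eq0P _ u0) => // j _; exact: sqr_ge0.
Qed.

Lemma sqnormZ n (a : R) (u : 'rV[R]_n) : sqnorm (a *: u) = a ^+ 2 * sqnorm u.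
Proof. by rewrite /sqnorm mulr_sumr; apply: eq_bigr => i _; rewrite mxE exprMn. Qed.

Lemma sqnorm_orth n (Q : 'M[R]_n) (u : 'rV[R]_n) : Q *m Q^T = 1%:M ->
  sqnorm (u *m Q) = sqnorm u.
Proof. by move=> QQ; rewrite !sqnormE trmx_mul mulmxA -(mulmxA u) QQ mulmx1. Qed.

Lemma sqnorm_delta n (i : 'I_n) : sqnorm (delta_mx 0 i : 'rV[R]_n) = 1.
Proof.
rewrite /sqnorm (bigD1 i)//= big1 ?addr0 => [|j ji]; rewrite mxE eqxx ?eqxx ?expr1n//=.
by rewrite (negbTE ji) expr0n.
Qed.

(** The Householder reflection in the hyperplane orthogonal to [w]. For [w = 0] it is the identity,
    so it is orthogonal for every [w]. *)
Definition refl_mx n (w : 'rV[R]_n) : 'M[R]_n :=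
  1%:M - (2 / sqnorm w) *: (w^T *m w).

Lemma mx11_scal (M : 'M[R]_1) : M = (M 0 0)%:M.
Proof. by apply/matrixP => i j; rewrite !ord1 mxE eqxx mulr1n. Qed.

Lemma mul_refl_mx n (u w : 'rV[R]_n) :
  u *m refl_mx w = u - (2 / sqnorm w * (u *m w^T) 0 0) *: w.
Proof.
rewrite mulmxBr mulmx1 -scalemxAr mulmxA {1}(mx11_scal (u *m w^T)).
by rewrite mul_scalar_mx scalerA.
Qed.

Lemma refl_mx_orth n (w : 'rV[R]_n) : refl_mx w *m (refl_mx w)^T = 1%:M.
Proof.
have -> : (refl_mx w)^T = refl_mx w.
  by rewrite /refl_mx linearB/= trmx1 linearZ/= trmx_mul trmxK.
have [->|w0] := eqVneq w 0; first by rewrite /refl_mx mulmx0 scaler0 subr0 mulmx1.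
have {w0} s0 : sqnorm w != 0 by rewrite sqnorm_eq0.
apply/row_matrixP => i; rewrite !rowE mulmxA !mul_refl_mx mulmx1 mulmxBl -scalemxAl.
set x := delta_mx 0 i; set t := (x *m w^T) 0 0.
set a := 2 / sqnorm w.
have -> : (x *m w^T - (a * t) *: (w *m w^T)) 0 0 = t - a * t * sqnorm w.
  have E (M N : 'M[R]_1) c : (M - c *: N) 0 0 = M 0 0 - c * N 0 0 by rewrite !mxE.
  by rewrite E -sqnormE.
rewrite -addrA -opprD -scalerDl.
rewrite (_ : a * t + a * (t - a * t * sqnorm w) = 0) ?scale0r ?oppr0 ?addr0//.
by rewrite /a; field.
Qed.

(** For vectors of equal length, |u - v|^2 = 2 <u, u - v>, so the coefficient of [u - v] subtracted
    by the reflection is 1. *)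
Lemma refl_mx_map n (u v : 'rV[R]_n) : sqnorm u = sqnorm v ->
  u *m refl_mx (u - v) = v.
Proof.
move=> uv; have [->|w0] := eqVneq u v.
  by rewrite subrr /refl_mx mulmx0 scaler0 subr0 mulmx1.
have s0 : sqnorm (u - v) != 0 by rewrite sqnorm_eq0 subr_eq0.
rewrite mul_refl_mx (_ : _ * _ = 1) ?scale1r ?subKr//.
suff E : sqnorm (u - v) = 2 * (u *m (u - v)^T) 0 0.
  by rewrite E; field; move: s0; rewrite E mulf_eq0 pnatr_eq0.
have vu : (v *m u^T) 0 0 = (u *m v^T) 0 0.
  by rewrite !mxE; apply: eq_bigr => i _; rewrite !mxE mulrC.
have E2 : (v *m v^T) 0 0 = (u *m u^T) 0 0 by rewrite -!sqnormE.
rewrite sqnormE linearB/= !mulmxBl !mulmxBr.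
move: vu E2; move: (v *m u^T) (v *m v^T) (u *m v^T) (u *m u^T) => A B C D.
by rewrite !mxE => -> ->; ring.
Qed.

Lemma refl_mx_fix n (u w : 'rV[R]_n) : u *m w^T = 0 -> u *m refl_mx w = u.
Proof. by move=> uw; rewrite mul_refl_mx uw mxE mulr0 scale0r subr0. Qed.

(** A first reflection takes [rho] to the axis 0, a second one takes the image of [m] to the axis 1.
    The second fixes the axis 0, because the image of [m] and its target are both orthogonal to
    it. *)
Lemma orth_two_axes n (rho m : 'rV[R]_n.+2) : rho != 0 -> m *m rho^T = 0 ->
  exists Q : 'M[R]_n.+2, [/\ Q *m Q^T = 1%:M,
    rho *m Q = Num.sqrt (sqnorm rho) *: delta_mx 0 0 &
    m *m Q = Num.sqrt (sqnorm m) *: delta_mx 0 1].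
Proof.
move=> rho0 mrho.
pose v := Num.sqrt (sqnorm rho) *: delta_mx 0 0 : 'rV[R]_n.+2.
have s0 : Num.sqrt (sqnorm rho) != 0.
  by rewrite sqrtr_eq0 -ltNge lt_def sqnorm_ge0 sqnorm_eq0 rho0.
have normE (u : 'rV[R]_n.+2) i : sqnorm u = sqnorm (Num.sqrt (sqnorm u) *: delta_mx 0 i : 'rV[R]_n.+2).
  by rewrite sqnormZ sqnorm_delta mulr1 sqr_sqrtr// sqnorm_ge0.
have [H1 H1o rH1] : exists2 H1 : 'M[R]_n.+2, H1 *m H1^T = 1%:M & rho *m H1 = v.
  exists (refl_mx (rho - v)); first exact: refl_mx_orth.
  exact/refl_mx_map/normE.
pose m' := m *m H1; pose v' := Num.sqrt (sqnorm m) *: delta_mx 0 1 : 'rV[R]_n.+2.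
have m'v' : sqnorm m' = sqnorm v' by rewrite sqnorm_orth//; exact: normE.
have := refl_mx_orth (m' - v'); have := refl_mx_map m'v'.
have := @refl_mx_fix _ v (m' - v').
move: (refl_mx (m' - v')) => H2 H2f H2m H2o.
exists (H1 *m H2); split.
- by rewrite trmx_mul mulmxA -(mulmxA H1) H2o mulmx1.
- rewrite mulmxA rH1; apply: H2f.
  have e01 : (delta_mx 0 0 : 'rV[R]_n.+2) *m (delta_mx 0 1 : 'rV[R]_n.+2)^T = 0.
    by rewrite trmx_delta mul_delta_mx_0.
  have vm' : v *m m'^T = 0.
    rewrite -rH1 trmx_mul mulmxA -(mulmxA rho) H1o mulmx1.
    by rewrite -[LHS]trmxK trmx_mul trmxK mrho trmx0.
  rewrite linearB/= mulmxBr vm' sub0r linearZ/= -scalemxAr /v -scalemxAl e01.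
  by rewrite !scaler0 oppr0.
- by rewrite mulmxA.
Qed.

Definition frob n d (G : 'M[R]_(n, d)) : R := \sum_i sqnorm (row i G).

Lemma frobE n d (G : 'M[R]_(n, d)) : frob G = \tr (G^T *m G).
Proof.
rewrite /frob /mxtrace; under [RHS]eq_bigr do rewrite mxE.
rewrite exchange_big /=; apply: eq_bigr => i _; apply: eq_bigr => j _.
by rewrite !mxE expr2.
Qed.

Lemma frob_orth n d (Q : 'M[R]_n) (G : 'M[R]_(n, d)) : Q *m Q^T = 1%:M ->
  frob (Q *m G) = frob G.
Proof.
by move=> /mulmx1C QQ; rewrite !frobE trmx_mul mulmxA -(mulmxA G^T) QQ mulmx1.
Qed.

Lemma measurable_frob disp (T : measurableType disp) n d (f : T -> 'M[R]_(n, d)) :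
  measurable_fun setT f -> measurable_fun setT (fun x => frob (f x)).
Proof. by move=> mf; apply: measurable_sum => i; meas. Qed.

(** Homogeneous coordinates: for [c] constant equal to 1 the determinant is d! times the signed
    volume of the simplex. A general first column is needed because dividing the rows by [rho]
    relates the column of ones to the column [rho]. *)
Definition aug d (c : 'rV[R]_d.+1) (X : 'M[R]_(d.+1, d)) : 'M[R]_d.+1 :=
  (row_mx c^T X : 'M[R]_(d.+1, 1 + d)).

Lemma measurable_aug disp (T : measurableType disp) d (c : T -> 'rV[R]_d.+1)
    (f : T -> 'M[R]_(d.+1, d)) :
  measurable_fun setT c -> measurable_fun setT f ->
  measurable_fun setT (fun x => aug (c x) (f x)).
Proof.
move=> mc mf.
exact: (@measurable_row_mx _ T R d.+1 1 d _ f (measurable_trmx mc) mf).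
Qed.

Lemma aug_mul d (B : 'M[R]_d.+1) c (X : 'M[R]_(d.+1, d)) :
  aug (c *m B^T) (B *m X) = B *m aug c X.
Proof. by rewrite /aug trmx_mul trmxK; exact: (esym (mul_mx_row B c^T X)). Qed.

Lemma det_augZ d a c (X : 'M[R]_(d.+1, d)) : \det (aug (a *: c) X) = a * \det (aug c X).
Proof.
have -> : aug (a *: c) X = (aug c X : 'M[R]_(1 + d)) *m block_mx a%:M 0 0 1%:M.
  have E := mul_row_block c^T X (a%:M : 'M[R]_1) 0 0 (1%:M : 'M[R]_d).
  apply: (eq_trans _ (esym E)).
  by rewrite !mulmx0 addr0 add0r mulmx1 /aug linearZ/= mul_mx_scalar.
have E : \det (block_mx (a%:M : 'M[R]_1) 0 0 (1%:M : 'M[R]_d)) = a.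
  by rewrite det_ublock det_scalar1 det1 mulr1.
rewrite det_mulmx mulrC; congr (_ * _); exact: E.
Qed.

Lemma det_orth n (Q : 'M[R]_n) : Q *m Q^T = 1%:M -> `|\det Q| = 1.
Proof.
move=> QQ; have : `|\det Q| ^+ 2 = 1.
  by rewrite real_normK ?num_real// expr2 -{2}det_tr -det_mulmx QQ det1.
move/eqP; rewrite sqrf_eq1 => /orP[/eqP//|/eqP E].
by have := normr_ge0 (\det Q); rewrite E oppr_ge0 ler10.
Qed.

End Rotations.

Ltac meas3 :=
  lazymatch goal with
  | |- measurable_fun _ (fun x => @frob _ _ _ (@?f x)) => apply: measurable_frob
  | |- measurable_fun _ (fun x => @aug _ _ (@?c x) (@?f x)) => apply: measurable_aug
  | |- _ => meas2
  end.
Ltac meas ::= repeat meas3.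

(** * The Gaussian integral at fixed scales *)

Section GaussDet.
Variable R : realType.
Variable e : nat.
Let d := e.+1.

(** The inner integral once [rho] is the unit vector of axis 0 and the other vector lies on axis 1,
    with length [m]. It remains an unevaluated profile. *)
Definition Psi (m : R) : \bar R := intM (fun G : 'M[R]_(d.+1, d) =>
  (`|\det (aug (delta_mx 0 0) G)| * (m ^+ 2 * sqnorm (row 1 G) < 1)%R%:R *
   expR (- frob G))%:E).

Lemma intM_gauss_det (rho m : 'rV[R]_d.+1) : rho != 0 -> m *m rho^T = 0 ->
  intM (fun G : 'M[R]_(d.+1, d) =>
    (`|\det (aug rho G)| * (sqnorm (m *m G) < 1)%R%:R * expR (- frob G))%:E) =
  ((Num.sqrt (sqnorm rho))%:E * Psi (Num.sqrt (sqnorm m)))%E.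
Proof.
move=> rho0 mrho; have [Q [QQ rQ mQ]] := orth_two_axes rho0 mrho.
have QQ' := mulmx1C QQ.
have uQ : Q \in unitmx by have [] := mulmx1_unit QQ.
rewrite (intM_lmul uQ); last 2 first.
- by meas.
- by move=> G; rewrite lee_fin !mulr_ge0 ?expR_ge0.
rewrite (det_lin_mulmx_orth d QQ) mul1e /Psi /intM -ge0_integralZl; last 4 first.
- exact: measurableT.
- by meas.
- by move=> G _; rewrite lee_fin !mulr_ge0 ?expR_ge0.
- by rewrite lee_fin sqrtr_ge0.
apply: eq_integral => u _; move: (vec_mx u) => G; rewrite -EFinM; congr EFin.
have -> : aug rho (Q *m G) = Q *m aug (rho *m Q) G.
  by rewrite -aug_mul -mulmxA QQ mulmx1.
rewrite rQ det_mulmx det_augZ normrM (det_orth QQ) mul1r normrM.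
rewrite (ger0_norm (sqrtr_ge0 _)) frob_orth// mulmxA mQ -!mulrA.
by rewrite -scalemxAl -rowE sqnormZ expr2 -mulrA.
Qed.

(** Weights of total 0 on all vertices: [zext l *m X] combines the edges at the first vertex with
    coefficients [l], yet it is symmetric in the rows of [X], as the scaling by [rho] requires. *)
Definition zext n (l : 'rV[R]_n) : 'rV[R]_n.+1 :=
  rcons0 (- \sum_i l 0 i : measurableTypeR R, l).

Definition wnorm n (rho : 'rV[R]_n.+1) (l : 'rV[R]_n) : R :=
  Num.sqrt (\sum_i (zext l 0 i / rho 0 i) ^+ 2).

Lemma zext0 n (l : 'rV[R]_n) : zext l 0 0 = - \sum_i l 0 i.
Proof. exact: rcons0_0. Qed.

Lemma zextS n (l : 'rV[R]_n) i : zext l 0 (lift ord0 i) = l 0 i.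
Proof. exact: rcons0_S. Qed.

Lemma zext_sum0 n (l : 'rV[R]_n) : \sum_i zext l 0 i = 0.
Proof.
rewrite big_ord_recl zext0 addrC; under eq_bigr do rewrite zextS.
by rewrite subrr.
Qed.

(** With [p] the product of the [rho 0 i], the Jacobian is p^(-d) and the determinant gives p^(-1),
    which cancels the factor p^(d + 1). In the exponent [rho] splits off as exp (- |rho|^2). *)
Lemma intM_gauss_mix (rho : 'rV[R]_d.+1) (l : 'rV[R]_d) :
  (forall i, 0 < rho 0 i) ->
  intM (fun X : 'M[R]_(d.+1, d) =>
    (`|\det (aug (const_mx 1) X)| * (sqnorm (zext l *m X) < 1)%R%:R *
     \prod_i (rho 0 i ^+ d.+1 *
       expR (- (rho 0 i ^+ 2 * (1 + sqnorm (row i X))))))%:E) =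
  ((Num.sqrt (sqnorm rho) * expR (- sqnorm rho))%:E * Psi (wnorm rho l))%E.
Proof.
move=> rho0.
pose r : 'rV[R]_d.+1 := \row_i (rho 0 i)^-1; pose B := diag_mx r.
pose p := \prod_i rho 0 i.
have p0 : 0 < p by apply: prodr_gt0.
have rho_neq0 : rho != 0.
  by apply/eqP => E; have := rho0 0; rewrite E mxE ltxx.
have rE : \prod_i r 0 i = p^-1.
  by rewrite /p -prodfV; apply: eq_bigr => i _; rewrite mxE.
have uB : B \in unitmx.
  by rewrite unitmxE unitfE det_diag rE invr_eq0 gt_eqF.
have X0 (X : 'M[R]_(d.+1, d)) : 0 <= `|\det (aug (const_mx 1) X)| *
    (sqnorm (zext l *m X) < 1)%R%:R * \prod_i (rho 0 i ^+ d.+1 *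
       expR (- (rho 0 i ^+ 2 * (1 + sqnorm (row i X))))).
  rewrite !mulr_ge0// prodr_ge0// => i _.
  by rewrite mulr_ge0 ?expR_ge0 ?exprn_ge0// ltW.
rewrite (intM_lmul uB); last 2 first.
- by meas.
- by move=> X; rewrite lee_fin.
rewrite det_lin_mulmx_diag rE.
have -> : ((Num.sqrt (sqnorm rho) * expR (- sqnorm rho))%:E * Psi (wnorm rho l))%E =
    ((expR (- sqnorm rho))%:E * ((Num.sqrt (sqnorm rho))%:E *
      Psi (Num.sqrt (sqnorm (zext l *m B)))))%E.
  rewrite [RHS]muleA -EFinM mulrC; congr (_ * Psi (Num.sqrt _))%E.
  by apply: eq_bigr => i _; rewrite mul_mx_diag !mxE.
rewrite -intM_gauss_det; last 2 first.
- exact: rho_neq0.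
- rewrite -mulmxA mul_diag_mx; apply/rowP => i; rewrite !ord1 mxE [RHS]mxE.
  rewrite -[RHS](zext_sum0 l); apply: eq_bigr => j _; rewrite !mxE.
  by rewrite mulVf ?mulr1// gt_eqF.
rewrite /intM -!ge0_integralZl; last 8 first.
- exact: measurableT.
- by meas.
- by move=> G _; rewrite lee_fin !mulr_ge0 ?expR_ge0.
- by rewrite lee_fin expR_ge0.
- exact: measurableT.
- by meas.
- by move=> G _; rewrite lee_fin.
- by rewrite lee_fin.
apply: eq_integral => u _; move: (vec_mx u) => G; rewrite -!EFinM; congr EFin.
have -> : aug (const_mx 1) (B *m G) = B *m aug rho G.
  rewrite -aug_mul; congr (aug _ _); apply/rowP => i.
  by rewrite tr_diag_mx mul_mx_diag !mxE mulfV ?gt_eqF.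
rewrite det_mulmx det_diag rE mulmxA.
rewrite big_split /= prodrXl -/p -expR_sum.
have -> : \sum_i - (rho 0 i ^+ 2 * (1 + sqnorm (row i (B *m G)))) =
    - sqnorm rho - frob G.
  rewrite [sqnorm rho]/sqnorm /frob -!sumrN -big_split /=; apply: eq_bigr => i _.
  have -> : row i (B *m G) = (rho 0 i)^-1 *: row i G.
    by rewrite mul_diag_mx; apply/rowP => j; rewrite !mxE.
  by rewrite sqnormZ; field; rewrite gt_eqF.
rewrite expRD !normrM normrV ?unitfE ?gt_eqF// normrX normrV ?unitfE ?gt_eqF//.
rewrite (gtr0_norm p0) exprVn exprS; field.
by rewrite gt_eqF// expf_neq0 ?gt_eqF.
Qed.

End GaussDet.

(** * Polar coordinates *)

Section Polar.
Variable R : realType.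
Local Notation mu := (@lebesgue_measure R).

(* The integral of [r ^ (p - 1) * h r] over [r > 0], written in [s = 1 / r]. *)
Definition polarI (p : nat) (h : R -> \bar R) : \bar R :=
  (\int[mu]_s (((0 < s)%R%:R * s^-1 ^+ p.+1)%:E * h (s^-1)%R))%E.

(** This stands for the integral of [F] over the unit sphere of [nm]. When p is the dimension plus
    the degree of [F], the radial part of [F x] and the volume give r^(p - 1); the factor r^(1 - p)
    compensates it, and the shell has radial length 1. *)
Definition polarc N (p : nat) (F : 'rV[R]_N -> \bar R) (nm : 'rV[R]_N -> R) : \bar R :=
  (\int[lebrv R N]_x (F x * ((1 <= nm x)%R%:R * (nm x <= 2)%R%:R * nm x *
     (nm x)^-1 ^+ p)%:E))%E.

(** The [s] with [b s] in [1, 2] form an interval of length 1 / b. *)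
Lemma integral_shell (b : R) : 0 < b ->
  (\int[mu]_s ((0 < s)%R%:R * (b * (1 <= b * s)%R%:R * (b * s <= 2)%R%:R))%:E = 1)%E.
Proof.
move=> b0; pose g (y : R) := ((1 <= y)%R%:R * (y <= 2)%R%:R)%:E : \bar R.
have mg : measurable_fun setT g by rewrite /g; meas.
have g0 y : (0 <= g y)%E by rewrite lee_fin.
have -> : (1 = \int[mu]_y g y)%E.
  have -> : (1 = mu `[1%R, 2%R])%E.
    by rewrite lebesgue_measure_itv /= lte_fin ltr1n -EFinB; congr EFin; lra.
  rewrite -[X in mu X]setIT -integral_indic//; apply: eq_integral => y _.
  rewrite /g indicE; congr EFin; case: (boolP (y \in _)) => [|] yI.
    by move: yI; rewrite inE /= in_itv /= => /andP[-> ->]; rewrite mulr1.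
  move/negP: yI; rewrite inE /= in_itv /= => /negP; rewrite negb_and.
  by case/orP => /negbTE ->; rewrite ?mul0r ?mulr0.
rewrite (integral_affine 0 (lt0r_neq0 b0) mg g0) -ge0_integralZl; last 4 first.
- exact: measurableT.
- by rewrite /g; meas.
- by move=> x _; rewrite lee_fin.
- by rewrite lee_fin.
apply: eq_integral => s _; rewrite /g -EFinM addr0 (gtr0_norm b0); congr EFin.
case: (ltP 0 s) => s0; first by rewrite mul1r mulrA.
rewrite mul0r lt_geF ?mul0r ?mulr0//.
by rewrite (le_lt_trans _ ltr01)// pmulr_rle0.
Qed.

Lemma polarI_scale p (h : R -> \bar R) (b : R) : 0 < b ->
  measurable_fun setT h -> (forall x, (0 <= h x)%E) ->
  (\int[mu]_s (((0 < s)%R%:R * s^-1 ^+ p.+1)%:E * h (b / s)%R) =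
   (b^-1 ^+ p)%:E * polarI p h)%E.
Proof.
move=> b0 mh h0; pose g (s : R) := (((0 < s)%R%:R * s^-1 ^+ p.+1)%:E * h (b / s)%R)%E.
have mhb (c : R) : measurable_fun setT (fun s : measurableTypeR R => h (c / s)).
  by apply: (measurableT_comp mh); meas.
have mg : measurable_fun setT g.
  apply: emeasurable_funM; [by meas|exact: mhb].
have g0 y : (0 <= g y)%E.
  by rewrite mule_ge0// lee_fin; case: ltP => // y0; rewrite ?mul0r// mul1r exprn_ge0 ?invr_ge0 ?ltW.
rewrite (integral_affine 0 (lt0r_neq0 b0) mg g0).
rewrite /polarI -!ge0_integralZl; last 8 first.
- exact: measurableT.
- apply: emeasurable_funM; first by meas.
  by have := mhb 1; under eq_fun do rewrite div1r.
- move=> s _; rewrite mule_ge0// lee_fin.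
  by case: ltP => // y0; rewrite ?mul0r// mul1r exprn_ge0 ?invr_ge0 ?ltW.
- by rewrite lee_fin exprn_ge0 ?invr_ge0 ?ltW.
- exact: measurableT.
- by apply: (measurableT_comp mg); meas.
- by move=> s _; exact: g0.
- by rewrite lee_fin.
apply: eq_integral => s _; rewrite /g addr0 (gtr0_norm b0) !muleA -!EFinM.
have [s0|s0] := ltP 0 s; last first.
  by rewrite le_gtF ?pmulr_rle0// !(mul0r, mulr0) !mul0e.
rewrite pmulr_rgt0// s0 !mul1r; congr (_%:E * h _)%E.
  by rewrite invfM exprMn exprS (exprS s^-1); field; rewrite !gt_eqF.
by field; rewrite !gt_eqF.
Qed.

(* Averaging over the dilations [x -> s *: x] with weight [integral_shell]
   replaces the unit sphere of [nm] by the shell [1 <= nm x <= 2]. *)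
Lemma polar N (a : nat) (F : 'rV[R]_N -> \bar R) (nm : 'rV[R]_N -> R) (h : R -> \bar R) :
  measurable_fun setT F -> (forall x, (0 <= F x)%E) ->
  measurable_fun setT nm -> (forall x, 0 <= nm x) ->
  (forall r x, 0 < r -> F (r *: x) = ((r ^+ a)%:E * F x)%E) ->
  (forall r x, 0 < r -> nm (r *: x) = r * nm x) ->
  (forall x, nm x = 0 -> F x = 0%E) ->
  measurable_fun setT h -> (forall x, (0 <= h x)%E) ->
  (\int[lebrv R N]_x (F x * h (nm x)) =
   polarc (N + a) F nm * polarI (N + a) h)%E.
Proof.
move=> mF F0 mnm nm0 Fhom nmhom Fz mh h0; set p := (N + a)%N.
pose k (x : 'rV[R]_N) (s : R) :=
  (0 < s)%R%:R * (nm x * (1 <= nm x * s)%R%:R * (nm x * s <= 2)%R%:R).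
have k0 x s : 0 <= k x s by rewrite !mulr_ge0.
pose q (x : 'rV[R]_N) := (1 <= nm x)%R%:R * (nm x <= 2)%R%:R * nm x.
have q0 x : 0 <= q x by rewrite !mulr_ge0.
have mhn : measurable_fun setT (fun x => h (nm x)) by exact: (measurableT_comp mh mnm).
have mk : measurable_fun setT (fun z : 'rV[R]_N * measurableTypeR R => (k z.1 z.2)%:E).
  have mn1 : measurable_fun setT (fun z : 'rV[R]_N * measurableTypeR R => nm z.1).
    by apply: (measurableT_comp mnm); meas.
  by rewrite /k; meas.
have mFh1 : measurable_fun setT (fun z : 'rV[R]_N * measurableTypeR R => F z.1 * h (nm z.1))%E.
  apply: emeasurable_funM; first by apply: (measurableT_comp mF); meas.
  by apply: (measurableT_comp mhn); meas.
pose Phi x (s : measurableTypeR R) := ((k x s)%:E * (F x * h (nm x)))%E.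
have Phi0 x s : (0 <= Phi x s)%E by rewrite !mule_ge0// lee_fin.
have mPhi : measurable_fun setT (fun z : 'rV[R]_N * measurableTypeR R => Phi z.1 z.2).
  by rewrite /Phi; apply: emeasurable_funM.
have -> : (\int[lebrv R N]_x (F x * h (nm x)) =
    \int[lebrv R N]_x \int[mu]_s Phi x s)%E.
  apply: eq_integral => x _.
  rewrite ge0_integralZr; last 4 first.
  - exact: measurableT.
  - by rewrite /k; meas.
  - by move=> s _; rewrite lee_fin.
  - by rewrite mule_ge0.
  (* No dilation brings a zero of [nm] into the shell; such points contribute nothing because [F]
     vanishes there. *)
  have [nx0|nx0] := eqVneq (nm x) 0; first by rewrite (Fz x nx0) mul0e mule0.
  by rewrite integral_shell ?mul1e// lt_def nx0 nm0.
rewrite tonelli; [|exact: mPhi|exact: Phi0].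
(* The integrand in [y = s x]: the volume contributes N powers of 1 / s, the homogeneity of [F]
   contributes [a], and the factor [nm x] one more, hence the exponent [p.+1]. *)
pose Th (s : measurableTypeR R) (y : 'rV[R]_N) :=
  ((q y * ((0 < s)%R%:R * s^-1 ^+ p.+1))%:E * (F y * h (nm y / s)%R))%E.
have mTh : measurable_fun setT (fun z : measurableTypeR R * 'rV[R]_N => Th z.1 z.2).
  have mn2 : measurable_fun setT (fun z : measurableTypeR R * 'rV[R]_N => nm z.2).
    by apply: (measurableT_comp mnm); meas.
  have mF2 : measurable_fun setT (fun z : measurableTypeR R * 'rV[R]_N => F z.2).
    by apply: (measurableT_comp mF); meas.
  have mh2 : measurable_fun setT (fun z : measurableTypeR R * 'rV[R]_N => h (nm z.2 / z.1)).
    by apply: (measurableT_comp mh); meas.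
  by rewrite /Th /q; meas.
have sp0 (s : R) : 0 <= (0 < s)%R%:R * s^-1 ^+ p.+1.
  by case: ltP => // y0; rewrite ?mul0r// mul1r exprn_ge0 ?invr_ge0 ?ltW.
have Th0 s y : (0 <= Th s y)%E.
  by rewrite /Th !mule_ge0// lee_fin mulr_ge0.
have -> : (\int[mu]_s \int[lebrv R N]_x Phi x s = \int[mu]_s \int[lebrv R N]_y Th s y)%E.
  apply: eq_integral => s _.
  have [s0|s0] := ltP 0 s; last first.
    transitivity (\int[lebrv R N]_x (0 : \bar R))%E; last first.
      by apply: eq_integral => y _; rewrite /Th le_gtF// mul0r mulr0 mul0e.
    by apply: eq_integral => y _; rewrite /Phi /k le_gtF// mul0r mul0e.
  have us : ((s^-1)%:M : 'M[R]_N) \in unitmx.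
    by rewrite unitmxE det_scalar unitfE expf_neq0// invr_eq0 gt_eqF.
  rewrite (@integral_lebrv_affine _ _ _ 0 (Phi ^~ s) us); last 2 first.
  - exact: (measurable_section2 s mPhi).
  - by move=> y; exact: Phi0.
  rewrite det_scalar -ge0_integralZl; last 4 first.
  - exact: measurableT.
  - by apply: (measurableT_comp (measurable_section2 s mPhi)); meas.
  - by move=> y _; exact: Phi0.
  - by rewrite lee_fin.
  apply: eq_integral => y _; rewrite addr0 mul_mx_scalar /Phi /Th.
  have si0 : 0 < s^-1 by rewrite invr_gt0.
  rewrite Fhom// nmhom// /k /q nmhom// s0 !mul1r.
  have -> : s^-1 * nm y * s = nm y by field; rewrite gt_eqF.
  rewrite (mulrC s^-1 (nm y)) (ger0_norm (exprn_ge0 N (ltW si0))).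
  rewrite !muleA -!EFinM; congr (_%:E * _ * _)%E.
  by rewrite exprS /p exprD; ring.
rewrite (tonelli (f := Th)); [|exact: mTh|exact: Th0]; rewrite /polarc.
have mb : measurable_fun setT (fun y => (F y * ((1 <= nm y)%R%:R * (nm y <= 2)%R%:R * nm y *
     (nm y)^-1 ^+ p)%:E))%E.
  by apply: emeasurable_funM => //; meas.
rewrite -ge0_integralZr; last 4 first.
- exact: measurableT.
- exact: mb.
- by move=> y _; rewrite mule_ge0// lee_fin !mulr_ge0 ?exprn_ge0 ?invr_ge0.
- by apply: integral_ge0 => s _; rewrite mule_ge0// lee_fin.
apply: eq_integral => y _; rewrite -/(q y).
have [q0'|q0'] := eqVneq (q y) 0.
  rewrite q0' mul0r mule0 mul0e.
  by under eq_integral do rewrite /Th q0' mul0r mul0e; rewrite integral0.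
have n0 : 0 < nm y.
  by rewrite lt_def nm0 andbT; apply: contra_neq q0' => ny; rewrite /q ny mulr0.
transitivity (F y * (q y)%:E * ((nm y)^-1 ^+ p)%:E * polarI p h)%E; last first.
  by rewrite [in RHS]EFinM !muleA.
rewrite -[RHS]muleA -(polarI_scale p n0 mh h0).
rewrite -ge0_integralZl; last 4 first.
- exact: measurableT.
- apply: emeasurable_funM; first by meas.
  by apply: (measurableT_comp mh); meas.
- by move=> s _; rewrite mule_ge0// lee_fin.
- by rewrite mule_ge0// lee_fin.
apply: eq_integral => s _; rewrite /Th EFinM !muleA; congr (_ * _)%E.
by rewrite muleAC (muleC (F y)).
Qed.

End Polar.

(** * Gaussian moments on the half-line *)

Section GaussMoments.
Variable R : realType.
Local Notation mu := (@lebesgue_measure R).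

(** Half of Gamma ((m + 1) / 2), in the variable in which the mixture is written. *)
Definition gam (m : nat) : \bar R :=
  (\int[mu]_r ((0 < r)%R%:R * (r ^+ m * expR (- r ^+ 2)))%:E)%E.

Definition expsq (x : R) : \bar R := (expR (- x ^+ 2))%:E.

Lemma measurable_expsq : measurable_fun setT expsq.
Proof. by rewrite /expsq; meas. Qed.

Lemma expsq_ge0 x : (0 <= expsq x)%E. Proof. by rewrite lee_fin expR_ge0. Qed.

Lemma pos_pow_ge0 (r : R) m : 0 <= (0 < r)%R%:R * r ^+ m.
Proof. by case: ltP => r0; rewrite ?mul0r// mul1r exprn_ge0// ltW. Qed.

Lemma integral_lebrv1 (f : R -> \bar R) :
  measurable_fun setT f -> (forall x, (0 <= f x)%E) ->
  (\int[lebrv R 1]_u f (u 0%R 0%R) = \int[mu]_x f x)%E.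
Proof.
move=> mf f0; rewrite integral_lebrvS; last 2 first.
- by apply: (measurableT_comp mf); meas.
- by move=> u; exact: f0.
apply: eq_integral => x _; under eq_integral do rewrite rcons0_0.
by rewrite /= integral_dirac// diracE in_setT mul1e.
Qed.

Lemma ge0_integral_eq_off (f g : R -> \bar R) (x0 : R) :
  measurable_fun setT f -> measurable_fun setT g ->
  (forall x, (0 <= f x)%E) -> (forall x, (0 <= g x)%E) ->
  (forall x, x != x0 -> f x = g x) ->
  (\int[mu]_x f x = \int[mu]_x g x)%E.
Proof.
move=> mf mg f0 g0 fg; apply: ge0_ae_eq_integral => //.
exists [set x0]; split => //; first exact: lebesgue_measure_set1.
move=> x /= /not_implyP[_ xfg]; apply: contrapT => xx0; apply: xfg.
by apply: fg; apply/eqP.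
Qed.

(** Discarding this null hyperplane makes the integrand vanish at the origin, as [polar] demands
    where the norm is 0. *)
Lemma lebrv_neq0 N (f : 'rV[R]_N.+1 -> \bar R) :
  measurable_fun setT f -> (forall x, (0 <= f x)%E) ->
  (\int[lebrv R N.+1]_u (((u 0%R 0%R != 0)%R%:R)%:E * f u) = \int[lebrv R N.+1]_u f u)%E.
Proof.
move=> mf f0; rewrite !integral_lebrvS; last 4 first.
- exact: mf.
- by move=> u; exact: f0.
- by apply: emeasurable_funM => //; meas.
- by move=> u; rewrite mule_ge0.
have mg : measurable_fun setT (fun x : measurableTypeR R => \int[lebrv R N]_u f (rcons0 (x, u)))%E.
  apply: (measurable_integralr (f := fun x u => f (rcons0 (x, u)))) => //.
  by apply: (measurableT_comp mf); meas.
have E (x : measurableTypeR R) : (\int[lebrv R N]_u (((rcons0 (x, u) 0 0 != 0)%R%:R)%:E * f (rcons0 (x, u)))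
    = ((x != 0)%R%:R)%:E * \int[lebrv R N]_u f (rcons0 (x, u)))%E.
  under eq_integral do rewrite rcons0_0.
  rewrite ge0_integralZl//.
  by apply: (measurableT_comp mf); meas.
under eq_integral do rewrite E.
apply: (@ge0_integral_eq_off _ _ 0).
- by apply: emeasurable_funM; [meas|exact: mg].
- exact: mg.
- by move=> x; rewrite mule_ge0// integral_ge0.
- by move=> x; apply: integral_ge0.
- by move=> x -> /=; rewrite mul1e.
Qed.

Lemma integralT_expsq : (\int[mu]_x expsq x = (Num.sqrt pi)%:E)%E.
Proof. exact: integralT_gauss. Qed.

Lemma expsq_sqnorm N (u : 'rV[R]_N) :
  expsq (Num.sqrt (sqnorm u)) = (\prod_i expR (- u 0 i ^+ 2))%:E.
Proof. by rewrite /expsq sqr_sqrtr ?sqnorm_ge0// -expR_sum -sumrN. Qed.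

Lemma polarI_ge0 p (h : R -> \bar R) : (forall x, (0 <= h x)%E) -> (0 <= polarI p h)%E.
Proof.
move=> h0; apply: integral_ge0 => s _; rewrite mule_ge0// lee_fin.
by case: ltP => y0; rewrite ?mul0r// mul1r exprn_ge0 ?invr_ge0 ?ltW.
Qed.

Lemma polarc_ge0 N p (F : 'rV[R]_N -> \bar R) nm : (forall x, (0 <= F x)%E) ->
  (forall x, 0 <= nm x) -> (0 <= polarc p F nm)%E.
Proof.
move=> F0 n0; apply: integral_ge0 => x _; rewrite mule_ge0// lee_fin.
by rewrite !mulr_ge0 ?exprn_ge0 ?invr_ge0.
Qed.

Lemma mule_pos_fin (x y : \bar R) (r : R) : (0 <= x)%E -> (0 <= y)%E ->
  (x * y = r%:E)%E -> r != 0 -> (0 < y < +oo)%E.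
Proof.
move=> x0 y0 xy r0; apply/andP; split.
  rewrite lt_def y0 andbT; apply: contra_neq r0 => y00.
  by move: xy; rewrite y00 mule0 => -[].
rewrite ltey; apply: contra_neq r0 => yoo; move: xy; rewrite yoo.
move: x0; rewrite le_eqVlt => /predU1P[<-|x0]; first by rewrite mul0e => -[].
by rewrite gt0_muley.
Qed.

(** In polar coordinates the Gaussian integral over R^(p + 1) is a product having
    [polarI p.+1 expsq] as a factor. Its value is a positive real, so neither factor can be 0 or
    infinite. *)
Lemma polarI_expsq p : (0 < polarI p.+1 expsq < +oo)%E.
Proof.
pose F (u : 'rV[R]_p.+1) : \bar R := ((u 0%R 0%R != 0)%R%:R)%:E.
pose nm (u : 'rV[R]_p.+1) : R := Num.sqrt (sqnorm u).
have mF : measurable_fun setT F by rewrite /F; meas.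
have mnm : measurable_fun setT nm by rewrite /nm; meas.
have F0 x : (0 <= F x)%E by rewrite lee_fin.
have nm0 x : 0 <= nm x by exact: sqrtr_ge0.
have Fh r x : 0 < r -> F (r *: x) = ((r ^+ 0)%:E * F x)%E.
  by move=> r0; rewrite expr0 mul1e /F mxE mulf_eq0 (gt_eqF r0).
have nh r x : 0 < r -> nm (r *: x) = r * nm x.
  by move=> r0; rewrite /nm sqnormZ sqrtrM ?sqr_ge0// sqrtr_sqr gtr0_norm.
have Fz x : nm x = 0 -> F x = 0%E.
  move=> /eqP; rewrite /nm sqrtr_eq0 => s0.
  have : sqnorm x == 0 by rewrite eq_le s0 sqnorm_ge0.
  by rewrite sqnorm_eq0 /F => /eqP ->; rewrite mxE eqxx.
have := polar mF F0 mnm nm0 Fh nh Fz measurable_expsq expsq_ge0.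
rewrite addn0 lebrv_neq0; last 2 first.
- exact: (measurableT_comp measurable_expsq mnm).
- by move=> x; exact: expsq_ge0.
under eq_integral do rewrite expsq_sqnorm.
rewrite (@lebrv_prod _ _ (fun _ x => expR (- x ^+ 2))); last 2 first.
- by move=> _; meas.
- by move=> _ x; exact: expR_ge0.
under eq_bigr do rewrite -/(expsq _) integralT_expsq.
rewrite prodEFin => /esym E; apply: (mule_pos_fin _ _ E).
- exact: polarc_ge0.
- exact/polarI_ge0/expsq_ge0.
- by rewrite prodr_const expf_neq0// sqrtr_eq0 -ltNge pi_gt0.
Qed.

(** The inversion r = 1 / s is [polar] in dimension 1, with [F] supported on the positive half-line,
    where the shell has mass 1. *)
Lemma integral_pos_polarI m (h : R -> \bar R) :
  measurable_fun setT h -> (forall x, (0 <= h x)%E) ->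
  (\int[mu]_r (((0 < r)%R%:R * r ^+ m)%:E * h r) = polarI m.+1 h)%E.
Proof.
move=> mh h0.
pose F (u : 'rV[R]_1) : \bar R := ((0 < u 0%R 0%R)%R%:R * (u 0%R 0%R) ^+ m)%:E.
pose nm (u : 'rV[R]_1) : R := `|u 0%R 0%R|.
have mF : measurable_fun setT F by rewrite /F; meas.
have mnm : measurable_fun setT nm by rewrite /nm; meas.
have F0 x : (0 <= F x)%E by rewrite lee_fin pos_pow_ge0.
have nm0 x : 0 <= nm x by exact: normr_ge0.
have Fh r x : 0 < r -> F (r *: x) = ((r ^+ m)%:E * F x)%E.
  by move=> r0; rewrite /F mxE pmulr_rgt0// exprMn -EFinM mulrCA.
have nh r x : 0 < r -> nm (r *: x) = r * nm x.
  by move=> r0; rewrite /nm mxE normrM gtr0_norm.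
have Fz x : nm x = 0 -> F x = 0%E.
  by rewrite /nm /F => /normr0_eq0 ->; rewrite ltxx mul0r.
have := polar mF F0 mnm nm0 Fh nh Fz mh h0.
have -> : polarc (1 + m) F nm = 1%E.
  pose f (x : R) : \bar R := ((0 < x)%R%:R * (1 * (1 <= 1 * x)%R%:R * (1 * x <= 2)%R%:R))%:E.
  rewrite -(@integral_shell R 1)// -(@integral_lebrv1 f); last 2 first.
  - by rewrite /f; meas.
  - by move=> x; rewrite lee_fin !mulr_ge0.
  apply: eq_integral => u _; rewrite /F /nm /f -EFinM; congr EFin.
  have [x0|x0] := ltP 0 (u 0 0); last by rewrite !mul0r.
  rewrite (gtr0_norm x0) !mul1r add1n exprVn exprS; field.
  by rewrite expf_neq0 gt_eqF.
rewrite mul1e add1n => <-.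
rewrite -(@integral_lebrv1 (fun r => (((0 < r)%R%:R * r ^+ m)%:E * h r)%E)); last 2 first.
- by apply: emeasurable_funM => //; meas.
- by move=> x; rewrite mule_ge0// lee_fin pos_pow_ge0.
apply: eq_integral => u _; rewrite /F /nm.
by have [x0|x0] := ltP 0 (u 0 0); [rewrite gtr0_norm|rewrite !mul0r !mul0e].
Qed.

Lemma integral_pos_inversion (b : R) (h : R -> \bar R) : 0 < b ->
  measurable_fun setT h -> (forall x, (0 <= h x)%E) ->
  (\int[mu]_r (((0 < r)%R%:R)%:E * h r) =
   b%:E * \int[mu]_s (((0 < s)%R%:R * s^-1 ^+ 2)%:E * h (b / s)%R))%E.
Proof.
move=> b0 mh h0; rewrite polarI_scale// expr1 muleA -EFinM mulfV ?gt_eqF// mul1e.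
by rewrite -integral_pos_polarI//; apply: eq_integral => r _; rewrite mulr1.
Qed.

Lemma gam_polarI m : gam m = polarI m.+1 expsq.
Proof.
rewrite -(integral_pos_polarI m measurable_expsq expsq_ge0).
by apply: eq_integral => r _; rewrite -EFinM mulrA.
Qed.

Lemma gam_pos_fin m : (0 < gam m < +oo)%E.
Proof. by rewrite gam_polarI; exact: polarI_expsq. Qed.

(* The substitution [r -> sqrt s * r] in the integral defining [gam m]. *)
Lemma gam_mix m (s : R) : 0 < s ->
  ((s `^ (- ((m%:R + 1) / 2)))%:E * gam m =
   \int[mu]_r ((0 < r)%R%:R * (r ^+ m * expR (- (r ^+ 2 * s))))%:E)%E.
Proof.
move=> s0; set a := Num.sqrt s; have a0 : 0 < a by rewrite sqrtr_gt0.
pose f (r : R) : \bar R := ((0 < r)%R%:R * (r ^+ m * expR (- r ^+ 2)))%:E.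
have f0 r : (0 <= f r)%E by rewrite lee_fin mulrA mulr_ge0 ?expR_ge0// pos_pow_ge0.
have mf : measurable_fun setT f by rewrite /f; meas.
have -> : s `^ (- ((m%:R + 1) / 2)) = a^-1 ^+ m.+1.
  rewrite powRN mulrC powRrM powR12_sqrt ?ltW// -/a.
  by rewrite natr1 powR_mulrn ?exprVn// ltW.
rewrite /gam (integral_affine 0 (lt0r_neq0 a0) mf f0) muleA -EFinM.
rewrite -ge0_integralZl; last 4 first.
- exact: measurableT.
- by apply: (measurableT_comp mf); meas.
- by move=> x _; exact: f0.
- by rewrite lee_fin mulr_ge0// exprn_ge0// invr_ge0 ltW.
apply: eq_integral => r _; rewrite /f addr0 -EFinM; congr EFin.
rewrite pmulr_rgt0// (gtr0_norm a0) exprMn [(a * r) ^+ 2]exprMn sqr_sqrtr ?ltW//.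
rewrite (mulrC s) exprVn exprS; field.
by rewrite ?expf_neq0 gt_eqF.
Qed.

End GaussMoments.

(** * Removing the radial profiles *)

Section Proportionality.
Variable R : realType.
Variable e : nat.
Local Notation mu := (@lebesgue_measure R).
Let d := e.+1.

(** The entry [l 0 i] belongs to vertex i + 1, so the sign is imposed exactly at the vertices
    outside the face on 0, ..., k - 1. Vertex 0 carries no condition, being in the face as soon as k
    is positive. *)
Definition cone (k n : nat) (l : 'rV[R]_n) : R :=
  \prod_(i < n) (if (k <= i.+1)%N then (0 <= l 0 i)%R%:R else 1).

Lemma cone_ge0 k n (l : 'rV[R]_n) : 0 <= cone k l.
Proof. by apply: prodr_ge0 => i _; case: ifP. Qed.

Lemma coneZ k n (r : R) (l : 'rV[R]_n) : 0 < r -> cone k (r *: l) = cone k l.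
Proof.
by move=> r0; apply: eq_bigr => i _; rewrite mxE pmulr_rge0.
Qed.

Lemma measurable_cone disp (T : measurableType disp) k n (f : T -> 'rV[R]_n) :
  measurable_fun setT f -> measurable_fun setT (fun x => cone k (f x)).
Proof.
move=> mf; apply: measurable_prod => i _; case: (k <= i.+1)%N; by meas.
Qed.

Lemma measurable_zext disp (T : measurableType disp) n (f : T -> 'rV[R]_n) :
  measurable_fun setT f -> measurable_fun setT (fun x => zext (f x)).
Proof. by move=> mf; rewrite /zext; meas. Qed.

Definition posv n (rho : 'rV[R]_n) : R := \prod_i (0 < rho 0 i)%R%:R.

Lemma posv_ge0 n (rho : 'rV[R]_n) : 0 <= posv rho.
Proof. by apply: prodr_ge0. Qed.

Lemma posvP n (rho : 'rV[R]_n) :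
  (forall i, 0 < rho 0 i) /\ posv rho = 1 \/ posv rho = 0.
Proof.
have [/forallP p|] := boolP [forall i, 0 < rho 0 i].
  by left; split => //; rewrite /posv big1// => i _; rewrite p.
rewrite negb_forall => /existsP[i /negbTE ni]; right.
by rewrite /posv (bigD1 i)//= ni mul0r.
Qed.

Lemma measurable_posv disp (T : measurableType disp) n (f : T -> 'rV[R]_n) :
  measurable_fun setT f -> measurable_fun setT (fun x => posv (f x)).
Proof. by move=> mf; rewrite /posv; meas. Qed.

Lemma measurable_wnorm disp (T : measurableType disp) n (f : T -> 'rV[R]_n.+1)
    (g : T -> 'rV[R]_n) :
  measurable_fun setT f -> measurable_fun setT g ->
  measurable_fun setT (fun x => wnorm (f x) (g x)).
Proof.
move=> mf mg; rewrite /wnorm.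
have me := measurable_zext mg.
by meas.
Qed.

Definition mixw (X : 'M[R]_(d.+1, d)) (rho : 'rV[R]_d.+1) : R :=
  \prod_i ((0 < rho 0 i)%R%:R * (rho 0 i ^+ d.+1 *
     expR (- (rho 0 i ^+ 2 * (1 + sqnorm (row i X)))))).

Lemma mixw_ge0 X rho : 0 <= mixw X rho.
Proof.
by apply: prodr_ge0 => i _; rewrite mulrA mulr_ge0 ?expR_ge0// pos_pow_ge0.
Qed.

Lemma measurable_mixw disp (T : measurableType disp) (f : T -> 'M[R]_(d.+1, d))
    (g : T -> 'rV[R]_d.+1) :
  measurable_fun setT f -> measurable_fun setT g ->
  measurable_fun setT (fun x => mixw (f x) (g x)).
Proof. by move=> mf mg; rewrite /mixw; meas. Qed.

End Proportionality.

Ltac meas4 :=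
  lazymatch goal with
  | |- measurable_fun _ (fun x => @cone _ _ _ (@?f x)) => apply: measurable_cone
  | |- measurable_fun _ (fun x => @zext _ _ (@?f x)) => apply: measurable_zext
  | |- measurable_fun _ (fun x => @posv _ _ (@?f x)) => apply: measurable_posv
  | |- measurable_fun _ (fun x => @wnorm _ _ (@?f x) (@?g x)) => apply: measurable_wnorm
  | |- measurable_fun _ (fun x => @mixw _ _ (@?f x) (@?g x)) => apply: measurable_mixw
  | |- _ => meas3
  end.
Ltac meas ::= repeat meas4.

Section Proportionality2.
Variable R : realType.
Variable e : nat.
Local Notation mu := (@lebesgue_measure R).
Let d := e.+1.

Definition bprod (X : 'M[R]_(d.+1, d)) : R :=
  \prod_i (1 + sqnorm (row i X)) `^ (- ((d.+1%:R + 1) / 2)).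

Lemma bprod_ge0 X : 0 <= bprod X.
Proof. by apply: prodr_ge0 => i _; exact: powR_ge0. Qed.

Definition Pk (k : nat) : \bar R := intM (fun X : 'M[R]_(d.+1, d) =>
  (`|\det (aug (const_mx 1) X)| * bprod X)%:E *
  \int[lebrv R d]_l ((sqnorm (zext l *m X) < 1)%R%:R * cone k l)%:E)%E.

(** The Gaussian mixture, row by row: [gam_mix] with s = 1 + |x_i|^2 and the power [d.+1], whose
    exponent (d + 2) / 2 is the beta of the theorem for n = d + 1. *)
Lemma bprod_mix (X : 'M[R]_(d.+1, d)) :
  ((bprod X)%:E * \prod_(i < d.+1) gam R d.+1 =
   \int[lebrv R d.+1]_rho (mixw X rho)%:E)%E.
Proof.
pose h (i : 'I_d.+1) (r : R) := (0 < r)%R%:R * (r ^+ d.+1 *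
     expR (- (r ^+ 2 * (1 + sqnorm (row i X))))).
rewrite (@lebrv_prod R d.+1 h); last 2 first.
- by move=> i; rewrite /h; meas.
- by move=> i r; rewrite /h mulrA mulr_ge0 ?expR_ge0// pos_pow_ge0.
rewrite /bprod -prodEFin -big_split /=; apply: eq_bigr => i _.
by rewrite gam_mix// ltr_pwDl// sqnorm_ge0.
Qed.

Lemma prod_gam_ge0 : (0 <= \prod_(i < d.+1) gam R d.+1)%E.
Proof.
apply: (big_ind (fun x => 0 <= x)%E) => // [x y|i _]; first exact: mule_ge0.
by have /andP[/ltW] := gam_pos_fin R d.+1.
Qed.

Definition kern k (X : 'M[R]_(d.+1, d)) (rho : 'rV[R]_d.+1) (l : 'rV[R]_d) : R :=
  `|\det (aug (const_mx 1) X)| * mixw X rho *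
  ((sqnorm (zext l *m X) < 1)%R%:R * cone k l).

Lemma kern_ge0 k X rho l : 0 <= kern k X rho l.
Proof. by rewrite /kern !mulr_ge0// ?mixw_ge0// cone_ge0. Qed.

Lemma Pk_mix k : (Pk k * \prod_(i < d.+1) gam R d.+1 =
  \int[lebrv R d.+1]_rho \int[lebrv R d]_l intM (fun X => (kern k X rho l)%:E))%E.
Proof.
have mI (T : measurableType default_measure_display) (f : T -> 'M[R]_(d.+1, d)) :
    measurable_fun setT f -> measurable_fun setT (fun x =>
      \int[lebrv R d]_l ((sqnorm (zext l *m f x) < 1)%R%:R * cone k l)%:E)%E.
  move=> mf; apply: measurable_integralr => [|x l]; last first.
    by rewrite lee_fin mulr_ge0// cone_ge0.
  have mf1 : measurable_fun setT (fun p : T * 'rV[R]_d => f p.1).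
    by apply: (measurableT_comp mf); meas.
  by meas.
have I0 X : (0 <= \int[lebrv R d]_l ((sqnorm (zext l *m X) < 1)%R%:R * cone k l)%:E)%E.
  by apply: integral_ge0 => l _; rewrite lee_fin mulr_ge0// cone_ge0.
have mb : measurable_fun setT bprod by rewrite /bprod; meas.
rewrite /Pk /intM -ge0_integralZr; last 4 first.
- exact: measurableT.
- apply: emeasurable_funM; last by apply: mI; meas.
  apply: measurable_EFinr; apply: measurable_funM; first by meas.
  by apply: (measurableT_comp mb); meas.
- by move=> u _; rewrite mule_ge0// lee_fin mulr_ge0// bprod_ge0.
- exact: prod_gam_ge0.
have E X : ((`|\det (aug (const_mx 1) X)| * bprod X)%:E *
    \int[lebrv R d]_l ((sqnorm (zext l *m X) < 1)%R%:R * cone k l)%:E *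
    \prod_(i < d.+1) gam R d.+1 =
    \int[lebrv R d.+1]_rho \int[lebrv R d]_l (kern k X rho l)%:E)%E.
  under [RHS]eq_integral => rho _.
    under eq_integral do rewrite /kern EFinM.
    rewrite ge0_integralZl; last 4 first.
    - exact: measurableT.
    - by meas.
    - by move=> l _; rewrite lee_fin mulr_ge0// cone_ge0.
    - by rewrite lee_fin mulr_ge0// mixw_ge0.
    over.
  rewrite ge0_integralZr; last 4 first.
  - exact: measurableT.
  - by meas.
  - by move=> rho _; rewrite lee_fin mulr_ge0// mixw_ge0.
  - exact: I0.
  under [in RHS]eq_integral do rewrite EFinM.
  rewrite ge0_integralZl; last 4 first.
  - exact: measurableT.
  - by meas.
  - by move=> rho _; rewrite lee_fin mixw_ge0.
  - by rewrite lee_fin.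
  by rewrite -bprod_mix EFinM -!muleA; congr (_ * (_ * _))%E; rewrite muleC.
under eq_integral do rewrite E.
rewrite tonelli; last 2 first.
- apply: (measurable_integralr (f := fun (p : 'rV[R]_(d.+1 * d) * 'rV[R]_d.+1) l =>
    (kern k (vec_mx p.1) p.2 l)%:E)) => [|p l]; last by rewrite lee_fin kern_ge0.
  by rewrite /kern; meas.
- by move=> u rho; apply: integral_ge0 => l _; rewrite lee_fin kern_ge0.
apply: eq_integral => rho _; rewrite tonelli//.
- by rewrite /kern; meas.
- by move=> u l; rewrite lee_fin kern_ge0.
Qed.

End Proportionality2.

Section Proportionality3.
Variable R : realType.
Variable e : nat.
Local Notation mu := (@lebesgue_measure R).
Let d := e.+1.

Lemma Psi_ge0 m : (0 <= Psi e m :> \bar R)%E.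
Proof. by apply: integral_ge0 => u _; rewrite lee_fin !mulr_ge0 ?expR_ge0. Qed.

Lemma measurable_Psi : measurable_fun setT (@Psi R e).
Proof.
change (measurable_fun setT (fun m : R => @Psi R e m)); rewrite /Psi /intM.
apply: measurable_integralr => [|m u]; first by meas.
by rewrite lee_fin !mulr_ge0 ?expR_ge0.
Qed.

(** The profile in |rho| left by [intM_gauss_mix]; the absolute value makes it nonnegative on the
    whole line. *)
Definition hnorm (r : R) : \bar R := (`|r| * expR (- r ^+ 2))%:E.

Lemma hnorm_ge0 r : (0 <= hnorm r)%E.
Proof. by rewrite lee_fin mulr_ge0 ?expR_ge0. Qed.

Lemma kern_int k (rho : 'rV[R]_d.+1) (l : 'rV[R]_d) : intM (fun X : 'M[R]_(d.+1, d) => (@kern R e k X rho l)%:E) =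
  ((posv rho * cone k l)%:E *
   (hnorm (Num.sqrt (sqnorm rho)) * Psi e (wnorm rho l)))%E.
Proof.
have [[rho0 pE]|pE] := posvP rho; last first.
  rewrite pE mul0r mul0e /intM; under eq_integral => u _.
    have -> : @kern R e k (vec_mx u) rho l = 0.
      by rewrite /kern /mixw big_split /= -/(posv rho) pE mul0r mulr0 mul0r.
    over.
  exact: integral0.
rewrite pE mul1r /hnorm sqr_sqrtr ?sqnorm_ge0// (ger0_norm (sqrtr_ge0 _)).
rewrite -intM_gauss_mix// /intM -ge0_integralZl; last 4 first.
- exact: measurableT.
- by meas.
- move=> u _; rewrite lee_fin !mulr_ge0// prodr_ge0// => i _.
  by rewrite mulr_ge0 ?expR_ge0// exprn_ge0// ltW.
- by rewrite lee_fin cone_ge0.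
apply: eq_integral => u _; rewrite -EFinM; congr EFin; rewrite /kern /mixw.
under eq_bigr do rewrite rho0 mul1r.
by ring.
Qed.

Definition ck k (rho : 'rV[R]_d.+1) : \bar R :=
  polarc d (fun l : 'rV[R]_d => ((l 0 0 != 0)%R%:R * cone k l)%:E) (wnorm rho).

Lemma wnormZr r (rho : 'rV[R]_d.+1) l : 0 < r -> wnorm rho (r *: l) = r * wnorm rho l.
Proof.
move=> r0; rewrite /wnorm -{2}(gtr0_norm r0) -sqrtr_sqr -sqrtrM ?sqr_ge0// mulr_sumr.
congr Num.sqrt; apply: eq_bigr => i _.
suff -> : zext (r *: l) 0 i = r * zext l 0 i by rewrite -mulrA exprMn.
case: (unliftP ord0 i) => [j|] ->; rewrite ?zextS ?zext0 ?mxE// mulrN mulr_sumr.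
by congr (- _); apply: eq_bigr => j _; rewrite mxE.
Qed.

Lemma wnorm0_entry (rho : 'rV[R]_d.+1) (l : 'rV[R]_d) : (forall i, 0 < rho 0 i) ->
  wnorm rho l = 0 -> l 0 0 = 0.
Proof.
move=> rho0 /eqP; rewrite /wnorm sqrtr_eq0 => s0.
have h i : 0 <= (zext l 0 i / rho 0 i) ^+ 2 by exact: sqr_ge0.
have /eqP : \sum_i (zext l 0 i / rho 0 i) ^+ 2 = 0.
  by apply/eqP; rewrite eq_le s0 sumr_ge0.
rewrite psumr_eq0// => /allP/(_ (lift ord0 0))/(_ (mem_index_enum _)).
rewrite sqrf_eq0 mulf_eq0 invr_eq0 (gt_eqF (rho0 _)) orbF zextS.
by move/eqP.
Qed.

(** [polar] in [l] at fixed [rho], in degree 0. The factor [ck k rho] is the same for all profiles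
    [h], which is what allows one profile to replace another. *)
Lemma wnorm_polar k (rho : 'rV[R]_d.+1) (h : R -> \bar R) :
  (forall i, 0 < rho 0 i) -> measurable_fun setT h -> (forall x, (0 <= h x)%E) ->
  (\int[lebrv R d]_l ((cone k l)%:E * h (wnorm rho l)) = ck k rho * polarI d h)%E.
Proof.
move=> rho0 mh h0.
have mw : measurable_fun setT (fun l : 'rV[R]_d => wnorm rho l) by meas.
have mhw : measurable_fun setT (fun l : 'rV[R]_d => h (wnorm rho l)).
  exact: (measurableT_comp mh mw).
rewrite -lebrv_neq0; last 2 first.
- by apply: emeasurable_funM => //; meas.
- by move=> l; rewrite mule_ge0// lee_fin cone_ge0.
under eq_integral do rewrite muleA -EFinM.
pose F (l : 'rV[R]_d) : \bar R := ((l 0%R 0%R != 0)%R%:R * cone k l)%:E.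
have mF : measurable_fun setT F by rewrite /F; meas.
have F0 l : (0 <= F l)%E by rewrite lee_fin mulr_ge0// cone_ge0.
have Fh r l : 0 < r -> F (r *: l) = ((r ^+ 0)%:E * F l)%E.
  by move=> r0; rewrite expr0 mul1e /F mxE mulf_eq0 (gt_eqF r0) coneZ.
have nh r l : 0 < r -> wnorm rho (r *: l) = r * wnorm rho l by exact: wnormZr.
have Fz l : wnorm rho l = 0 -> F l = 0%E.
  by move=> /(wnorm0_entry rho0); rewrite /F => ->; rewrite eqxx mul0r.
have := polar mF F0 mw (fun l => sqrtr_ge0 _) Fh nh Fz mh h0.
by rewrite addn0.
Qed.

Definition Qk k (rho : 'rV[R]_d.+1) : \bar R :=
  (\int[lebrv R d]_l ((posv rho * cone k l)%:E * expsq (wnorm rho l)))%E.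

Lemma Qk_ge0 k rho : (0 <= Qk k rho)%E.
Proof.
apply: integral_ge0 => l _; rewrite mule_ge0 ?expsq_ge0// lee_fin.
by rewrite mulr_ge0 ?posv_ge0// cone_ge0.
Qed.

Lemma measurable_Qk k : measurable_fun setT (Qk k).
Proof.
apply: (measurable_integralr (f := fun rho l =>
  ((posv rho * cone k l)%:E * expsq (wnorm rho l))%E)) => [|rho l].
  by rewrite /expsq; meas.
rewrite mule_ge0 ?expsq_ge0// lee_fin.
by rewrite mulr_ge0 ?posv_ge0// cone_ge0.
Qed.

Lemma posvZ r (rho : 'rV[R]_d.+1) : 0 < r -> posv (r *: rho) = posv rho.
Proof. by move=> r0; apply: eq_bigr => i _; rewrite mxE pmulr_rgt0. Qed.

Lemma wnormZl r (rho : 'rV[R]_d.+1) l : 0 < r -> wnorm (r *: rho) (r *: l) = wnorm rho l.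
Proof.
move=> r0; rewrite wnormZr// /wnorm -{1}(gtr0_norm r0) -sqrtr_sqr -sqrtrM ?sqr_ge0//.
congr Num.sqrt; rewrite mulr_sumr; apply: eq_bigr => i _.
have -> : (r *: rho) 0 i = r * rho 0 i by rewrite mxE.
by rewrite -exprMn invfM; congr (_ ^+ 2); rewrite mulrCA mulVKf// gt_eqF.
Qed.

(** Dilating [l] along with [rho] leaves [wnorm] unchanged and costs the Jacobian r^d. This
    homogeneity makes the outer integral polar as well. *)
Lemma QkZ k r rho : 0 < r -> Qk k (r *: rho) = ((r ^+ d)%:E * Qk k rho)%E.
Proof.
move=> r0; rewrite /Qk.
have ur : (r%:M : 'M[R]_d) \in unitmx.
  by rewrite unitmxE det_scalar unitfE expf_neq0// gt_eqF.
rewrite (@integral_lebrv_affine _ _ _ 0 (fun l =>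
  (posv (r *: rho) * cone k l)%:E * expsq (wnorm (r *: rho) l))%E ur); last 2 first.
- by rewrite /expsq; meas.
- move=> l; rewrite mule_ge0 ?expsq_ge0// lee_fin.
  by rewrite mulr_ge0 ?posv_ge0// cone_ge0.
rewrite det_scalar (ger0_norm (exprn_ge0 _ (ltW r0))).
apply: (congr1 (mule _)).
apply: eq_integral => l _.
by rewrite addr0 mul_mx_scalar posvZ// coneZ// wnormZl.
Qed.

Definition Dk k : \bar R :=
  (\int[lebrv R d.+1]_rho (Qk k rho * expsq (Num.sqrt (sqnorm rho))))%E.

Lemma Qk_polar k (h : R -> \bar R) :
  measurable_fun setT h -> (forall x, (0 <= h x)%E) ->
  (\int[lebrv R d.+1]_rho (Qk k rho * h (Num.sqrt (sqnorm rho))) =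
   polarc (d.+1 + d) (Qk k) (fun rho => Num.sqrt (sqnorm rho)) * polarI (d.+1 + d) h)%E.
Proof.
move=> mh h0; apply: polar => //.
- exact: measurable_Qk.
- exact: Qk_ge0.
- by meas.
- by move=> r rho r0; exact: QkZ.
- by move=> r x r0; rewrite sqnormZ sqrtrM ?sqr_ge0// sqrtr_sqr gtr0_norm.
- move=> rho /eqP; rewrite sqrtr_eq0 => s0.
  have : sqnorm rho == 0 by rewrite eq_le s0 sqnorm_ge0.
  rewrite sqnorm_eq0 => /eqP ->; rewrite /Qk.
  have -> : posv (0 : 'rV[R]_d.+1) = 0.
    by rewrite /posv (bigD1 0)//= mxE ltxx mul0r.
  by under eq_integral do rewrite mul0r mul0e; exact: integral0.
Qed.

(** Two exchanges of profiles: [Psi] for [expsq] in the norm of [l / rho] at fixed [rho], then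
    [hnorm] for [expsq] in the norm of [rho]. The equation is multiplied out because [polarI d Psi]
    is not yet known to be finite. *)
Lemma Pk_Dk k : (@Pk R e k * (\prod_(i < d.+1) gam R d.+1 *
    polarI d (@expsq R) * polarI (d.+1 + d) (@expsq R)) =
  polarI d (@Psi R e) * polarI (d.+1 + d) hnorm * Dk k)%E.
Proof.
have Ie0 : (0 <= polarI d (@expsq R))%E by exact/polarI_ge0/expsq_ge0.
rewrite !muleA Pk_mix.
under eq_integral => rho _ do under eq_integral => l _ do rewrite kern_int.
have mh : measurable_fun setT hnorm by rewrite /hnorm; meas.
rewrite -ge0_integralZr; last 4 first.
- exact: measurableT.
- apply: (measurable_integralr (f := fun rho l => ((posv rho * cone k l)%:E *
   (hnorm (Num.sqrt (sqnorm rho)) * Psi e (wnorm rho l)))%E)) => [|rho l].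
    apply: emeasurable_funM; first by meas.
    rewrite /hnorm; apply: emeasurable_funM; first by meas.
    by apply: (measurableT_comp measurable_Psi); meas.
  rewrite mule_ge0// ?lee_fin ?mulr_ge0 ?posv_ge0 ?cone_ge0//.
  by rewrite mule_ge0 ?hnorm_ge0 ?Psi_ge0.
- move=> rho _; apply: integral_ge0 => l _.
  rewrite mule_ge0// ?lee_fin ?mulr_ge0 ?posv_ge0 ?cone_ge0//.
  by rewrite mule_ge0 ?hnorm_ge0 ?Psi_ge0.
- exact: Ie0.
have E (rho : 'rV[R]_d.+1) : (\int[lebrv R d]_l ((posv rho * cone k l)%:E *
   (hnorm (Num.sqrt (sqnorm rho)) * Psi e (wnorm rho l))) * polarI d (@expsq R) =
   polarI d (@Psi R e) * (Qk k rho * hnorm (Num.sqrt (sqnorm rho))))%E.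
  have [[rho0 pE]|pE] := posvP rho; last first.
    rewrite /Qk pE; under eq_integral do rewrite mul0r mul0e.
    under [in RHS]eq_integral do rewrite mul0r mul0e.
    by rewrite integral0 !mul0e mule0.
  rewrite /Qk pE; under [in RHS]eq_integral do rewrite mul1r.
  rewrite (wnorm_polar k rho0 (@measurable_expsq R) (@expsq_ge0 R)).
  under eq_integral do rewrite mul1r muleCA.
  rewrite ge0_integralZl; last 4 first.
  - exact: measurableT.
  - apply: emeasurable_funM; first by meas.
    by apply: (measurableT_comp measurable_Psi); meas.
  - by move=> l _; rewrite mule_ge0 ?Psi_ge0// lee_fin cone_ge0.
  - exact: hnorm_ge0.
  rewrite (wnorm_polar k rho0 measurable_Psi Psi_ge0).
  set H := hnorm _; set C := ck _ _; set P := polarI _ _; set I := polarI _ _.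
  by rewrite -!muleA muleC -!muleA muleCA; congr (_ * _)%E; rewrite muleCA muleC -!muleA; congr (_ * _)%E; rewrite muleC.
under eq_integral do rewrite E.
rewrite ge0_integralZl; last 4 first.
- exact: measurableT.
- apply: emeasurable_funM; first exact: measurable_Qk.
  by apply: (measurableT_comp mh); meas.
- by move=> rho _; rewrite mule_ge0 ?Qk_ge0 ?hnorm_ge0.
- exact/polarI_ge0/Psi_ge0.
rewrite (Qk_polar k mh hnorm_ge0) /Dk (Qk_polar k (@measurable_expsq R) (@expsq_ge0 R)).
by rewrite -!muleA; congr (_ * _)%E; rewrite muleCA.
Qed.

End Proportionality3.

(** * Laplace variables and the cone integral *)

Section LaplaceMixture.
Variable R : realType.
Local Notation mu := (@lebesgue_measure R).

Definition wlap (a : R) : \bar R :=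
  (\int[mu]_r ((0 < r)%R%:R * expR (- (r ^+ 2 + a ^+ 2 / r ^+ 2)))%:E)%E.

Lemma integral_pos_gauss :
  (\int[mu]_(r in `[0%R, +oo[) (expR (- r ^+ 2))%:E = (Num.sqrt pi / 2)%:E)%E.
Proof.
have := @integralT_gauss R; rewrite ge0_symfun_integralT//=; last 3 first.
- by move=> x; exact: gauss_fun_ge0.
- exact: continuous_gauss_fun.
- by move=> x/=; rewrite /gauss_fun sqrrN.
rewrite (_ : [set x | _] = `[0, +oo[%classic); last first.
  by apply/seteqP; split => x/=; rewrite in_itv/= andbT.
set I := (\int[mu]_(x in _) _)%E => E; rewrite -/I.
have I0 : (0 <= I)%E by apply: integral_ge0 => x _; rewrite lee_fin expR_ge0.
move: E I0; case: I => [r| |].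
- by rewrite -EFinM => -[<-] _; congr EFin; field.
- by rewrite gt0_muley ?lte_fin.
- by [].
Qed.

(* The substitution [u = r - a / r]. *)
Lemma integral_glasser (a : R) : 0 < a ->
  (\int[mu]_(r in `[Num.sqrt a, +oo[) (expR (- (r - a / r) ^+ 2) * (1 + a / r ^+ 2))%:E
   = (Num.sqrt pi / 2)%:E)%E.
Proof.
move=> a0; set b := Num.sqrt a; have b0 : 0 < b by rewrite sqrtr_gt0.
have ab : a = b ^+ 2 by rewrite sqr_sqrtr// ltW.
pose F (r : R) := r - a / r; pose G (u : R) := expR (- u ^+ 2).
(* The lower limit is the positive root of [F], so that [F] increases from 0 to infinity on the
   half-line. *)
have Fb : F b = 0 by rewrite /F ab expr2 mulfK ?subrr// gt_eqF.
have dF (r : R) : r != 0 -> is_derive r 1 F (1 + a / r ^+ 2).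
  move=> r0; rewrite /F.
  have dV : is_derive r 1 (fun x : R => x^-1) (- r ^- 2).
    have := @is_deriveV R id r 1 1 r0 (is_derive_id _ _).
    by rewrite /GRing.scale /= mulr1.
  have -> : 1 + a / r ^+ 2 = 1 - (a *: (- r ^- 2) : R).
    by rewrite /GRing.scale /= mulrN opprK.
  have dZ : is_derive r 1 (fun x : R => a / x) (a *: (- r ^- 2) : R).
    exact: (is_deriveZ a dV).
  exact: is_deriveB.
have F1 (r : R) : r != 0 -> derive1 F r = 1 + a / r ^+ 2.
  by move=> r0; rewrite derive1E; have [_ ->] := dF r r0.
have cH (r : R) : r != 0 -> {for r, continuous (fun x : R => 1 + a / x ^+ 2)}.
  move=> r0; apply: cvgD; first exact: cvg_cst.
  apply: cvgM; first exact: cvg_cst.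
  apply: cvgV; first by rewrite sqrf_eq0.
  exact: exprn_continuous.
have cF1 (r : R) : 0 < r -> {for r, continuous (derive1 F)}.
  move=> r0; have nr : \forall x \near r, (1 + a / x ^+ 2) = derive1 F x.
    near=> x; apply/esym/F1/lt0r_neq0; near: x; exact: lt_nbhsr.
  change (derive1 F x @[x --> r] --> derive1 F r); rewrite (F1 r (lt0r_neq0 r0)).
  by apply: cvg_trans (cH r _); [apply: near_eq_cvg|rewrite gt_eqF].
have := @increasing_ge0_integration_by_substitutiony R F G b.
rewrite Fb => E.
rewrite -integral_pos_gauss E.
- apply: eq_integral => r; rewrite inE /= in_itv /= andbT => br.
  congr EFin; transitivity (G (F r) * derive1 F r); last by [].
  by rewrite F1// gt_eqF//; exact: lt_le_trans br.
- move=> x y; rewrite !in_itv /= !andbT => bx by_ xy; rewrite /F.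
  have x0 : 0 < x by exact: lt_le_trans bx.
  have y0 : 0 < y by exact: lt_le_trans by_.
  by rewrite ltrD// ltrN2 ltr_pM2l// ltf_pV2.
- move=> x; rewrite in_itv /= andbT => bx; apply: cF1; exact: lt_trans bx.
- apply/cvg_ex; exists (derive1 F b); apply: cvg_at_right_filter; exact: cF1.
- apply/cvg_ex; exists 1; apply/cvgrPdist_le => eps eps0; near=> x.
  have x1 : 1 <= x by near: x; apply: nbhs_pinfty_ge; exact: num_real.
  have xe : a / eps <= x by near: x; apply: nbhs_pinfty_ge; exact: num_real.
  have x0 : 0 < x by exact: lt_le_trans x1.
  rewrite F1 ?gt_eqF// opprD addrA subrr add0r normrN ger0_norm; last first.
    by rewrite divr_ge0 ?sqr_ge0// ltW.
  rewrite ler_pdivrMr ?exprn_gt0//; rewrite ler_pdivrMr// in xe.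
  rewrite (le_trans xe)// mulrC ler_pM2l// expr2 ler_peMl// ltW.
- split.
    move=> x; rewrite in_itv /= andbT => bx.
    have [] // := dF x; rewrite gt_eqF//; exact: lt_trans bx.
  apply: cvg_at_right_filter.
  have [db _] : is_derive b 1 F (1 + a / b ^+ 2) by apply: dF; rewrite gt_eqF.
  exact/differentiable_continuous/derivable1_diffP.
- apply/cvgryPge => A; near=> x.
  have xb : b <= x by near: x; apply: nbhs_pinfty_ge; exact: num_real.
  have xA : A + b <= x by near: x; apply: nbhs_pinfty_ge; exact: num_real.
  have x0 : 0 < x by exact: lt_le_trans xb.
  rewrite /F lerBrDr (le_trans _ xA)// lerD2l ler_pdivrMr// ab expr2 ler_pM2l//.
- apply: continuous_subspaceT => x; rewrite /G.
  exact: (@continuous_gauss_fun R).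
- by move=> x _; exact: expR_ge0.
Unshelve. all: by end_near. Qed.

Lemma integral_ind (D : set R) (b : R -> bool) (h : R -> \bar R) : measurable D ->
  (forall x, D x <-> b x) ->
  (\int[mu]_x (((b x)%:R)%:E * h x) = \int[mu]_(x in D) h x)%E.
Proof.
move=> mD Db; rewrite [RHS]integral_mkcond; apply: eq_integral => x _.
rewrite patchE; case: ifPn; rewrite ?inE ?notin_setE => /Db.
  by move=> ->; rewrite mul1e.
by move/negP/negbTE => ->; rewrite mul0e.
Qed.

(** With c = |a|, the exponent is r^2 + c^2 / r^2 = (r - c / r)^2 + 2 c. The inversion r -> c / r
    preserves the square and folds the part below sqrt c onto the part above it with weight c / r^2;
    the total weight 1 + c / r^2 is the derivative of r - c / r. For [a = 0] the integral is a half
    Gaussian. *)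
Lemma wlapE (a : R) : wlap a = (Num.sqrt pi / 2 * expR (- (2 * `|a|)))%:E.
Proof.
have [->|a0] := eqVneq a 0.
  rewrite normr0 mulr0 oppr0 expR0 mulr1 -integral_pos_gauss.
  rewrite -integral_itv_obnd_cbnd; last by apply: measurable_funTS; meas.
  rewrite -(@integral_ind `]0, +oo[ (fun r => 0 < r)) //; last first.
    by move=> x /=; rewrite in_itv /= andbT.
  by apply: eq_integral => r _; rewrite expr0n /= mul0r addr0 -EFinM.
set c := `|a|; have c0 : 0 < c by rewrite normr_gt0.
pose s := Num.sqrt c; have s0 : 0 < s by rewrite sqrtr_gt0.
have cs : c = s * s by rewrite -expr2 sqr_sqrtr// ltW.
pose g (r : R) : \bar R := (expR (- (r - c / r) ^+ 2))%:E.
have mg : measurable_fun setT g by rewrite /g; meas.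
have g0 r : (0 <= g r)%E by rewrite lee_fin expR_ge0.
pose I (b : R -> bool) (h : R -> \bar R) := (\int[mu]_r (((b r)%:R)%:E * h r))%E.
have -> : wlap a = ((expR (- (2 * c)))%:E * I (fun r => (0 < r)%R) g)%E.
  rewrite /I -ge0_integralZl; last 4 first.
  - exact: measurableT.
  - by apply: emeasurable_funM => //; meas.
  - by move=> r _; rewrite mule_ge0// lee_fin.
  - by rewrite lee_fin expR_ge0.
  apply: eq_integral => r _; have [r0|r0] := ltP 0 r; last by rewrite !mul0r mul0e mule0.
  rewrite mul1r mul1e /g -EFinM -expRD; congr (expR _)%:E.
  have -> : a ^+ 2 = c ^+ 2 by rewrite /c real_normK ?num_real.
  by field; rewrite gt_eqF.
pose h1 (r : R) : \bar R := (((r < s)%R%:R)%:E * g r)%E.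
pose h2 (r : R) : \bar R := (((s <= r)%R%:R)%:E * g r)%E.
have mh1 : measurable_fun setT h1 by apply: emeasurable_funM => //; meas.
have mh2 : measurable_fun setT h2 by apply: emeasurable_funM => //; meas.
have h10 r : (0 <= h1 r)%E by rewrite mule_ge0// lee_fin.
have h20 r : (0 <= h2 r)%E by rewrite mule_ge0// lee_fin.
have -> : I (fun r => (0 < r)%R) g = (I (fun r => (0 < r)%R) h1 + I (fun r => (0 < r)%R) h2)%E.
  rewrite /I -ge0_integralD; last 5 first.
  - exact: measurableT.
  - by move=> r _; rewrite mule_ge0// lee_fin.
  - by apply: emeasurable_funM => //; meas.
  - by move=> r _; rewrite mule_ge0// lee_fin.
  - by apply: emeasurable_funM => //; meas.
  apply: eq_integral => r _; rewrite /h1 /h2.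
  by case: (ltP 0 r) => _; rewrite ?mul0e ?adde0// !mul1e;
    case: ltP => _; rewrite ?mul1e ?mul0e ?adde0 ?add0e.
rewrite /I (integral_pos_inversion c0 mh1 h10) -ge0_integralZl; last 4 first.
- exact: measurableT.
- apply: emeasurable_funM; first by meas.
  by apply: (measurableT_comp mh1); meas.
- move=> r _; rewrite mule_ge0// lee_fin.
  by case: ltP => r0; rewrite ?mul0r// mul1r exprn_ge0 ?invr_ge0 ?ltW.
- by rewrite lee_fin ltW.
have -> : (\int[mu]_r (c%:E * (((0 < r)%R%:R * r^-1 ^+ 2)%:E * h1 (c / r)%R)) =
   \int[mu]_(r in `[s, +oo[) (expR (- (r - c / r) ^+ 2) * (c / r ^+ 2))%:E)%E.
  rewrite -integral_itv_obnd_cbnd; last by apply: measurable_funTS; meas.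
  rewrite -(@integral_ind `]s, +oo[ (fun r => s < r)) //; last first.
    by move=> x /=; rewrite in_itv /= andbT.
  apply: eq_integral => r _; rewrite /h1 /g.
  have [r0|r0] := ltP 0 r; last first.
    by rewrite mul0r mul0e mule0 le_gtF ?mul0e// (le_trans r0)// ltW.
  have -> : (c / r < s) = (s < r) by rewrite ltr_pdivrMr// cs ltr_pM2l.
  have -> : (c / r - c / (c / r)) ^+ 2 = (r - c / r) ^+ 2.
    by field; rewrite !gt_eqF.
  by rewrite mul1r -!EFinM; congr EFin; rewrite exprVn; ring.
have -> : (\int[mu]_r (((0 < r)%R%:R)%:E * h2 r) =
   \int[mu]_(r in `[s, +oo[) (expR (- (r - c / r) ^+ 2))%:E)%E.
  rewrite -(@integral_ind `[s, +oo[ (fun r => s <= r)) //; last first.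
    by move=> x /=; rewrite in_itv /= andbT.
  apply: eq_integral => r _; rewrite /h2.
  have [r0|r0] := ltP 0 r; first by rewrite mul1e.
  by rewrite mul0e lt_geF ?mul0e// (le_lt_trans r0).
rewrite -ge0_integralD; last 5 first.
- exact: measurable_itv.
- by move=> r _; rewrite lee_fin mulr_ge0 ?expR_ge0// divr_ge0 ?sqr_ge0// ltW.
- by apply: measurable_funTS; meas.
- by move=> r _; rewrite lee_fin expR_ge0.
- by apply: measurable_funTS; meas.
rewrite [RHS](_ : _ = (expR (- (2 * c)))%:E * (Num.sqrt pi / 2)%:E)%E; last first.
  by rewrite -EFinM mulrC.
rewrite -(integral_glasser c0); congr (_ * _)%E; apply: eq_integral => r _.
by rewrite -EFinD; congr EFin; ring.
Qed.

End LaplaceMixture.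

(** * Convolution with the Laplace density and its halves *)

Section LaplaceOperators.
Variable R : realType.
Local Notation mu := (@lebesgue_measure R).

Definition mpos (f : R -> \bar R) := measurable_fun setT f /\ forall x, (0 <= f x)%E.

Definition convop (w : R -> R) (f : R -> \bar R) (s : R) : \bar R :=
  (\int[mu]_x ((w x)%:E * f (s + x)%R))%E.

Definition wL (x : R) : R := expR (- (2 * `|x|)).
(** The halves [wE] and [wF] both include 0, so their sum is [wL] off one point only. Each is then
    the mirror image of the other. *)
Definition wE (x : R) : R := (0 <= x)%R%:R * wL x.
Definition wF (x : R) : R := (x <= 0)%R%:R * wL x.

Definition wmpos (w : R -> R) := measurable_fun setT w /\ forall x, 0 <= w x.

Lemma wL_wmpos : wmpos wL.
Proof. by split=> [|x]; [rewrite /wL; meas|exact: expR_ge0]. Qed.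
Lemma wE_wmpos : wmpos wE.
Proof. by split=> [|x]; [rewrite /wE /wL; meas|rewrite mulr_ge0 ?expR_ge0]. Qed.
Lemma wF_wmpos : wmpos wF.
Proof. by split=> [|x]; [rewrite /wF /wL; meas|rewrite mulr_ge0 ?expR_ge0]. Qed.

Lemma measurable_convop_kernel w f : wmpos w -> mpos f ->
  measurable_fun setT (fun p : measurableTypeR R * measurableTypeR R =>
    (w p.2)%:E * f (p.1 + p.2)%R)%E.
Proof.
move=> [mw w0] [mf f0]; apply: emeasurable_funM.
  apply: measurable_EFinr; apply: (measurableT_comp mw); meas.
apply: (measurableT_comp mf); meas.
Qed.

Lemma convop_mpos w f : wmpos w -> mpos f -> mpos (convop w f).
Proof.
move=> wp fp; have [mw w0] := wp; have [mf f0] := fp; split => [|s]; last first.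
  by apply: integral_ge0 => x _; rewrite mule_ge0// lee_fin.
apply: (measurable_integralr (f := fun s x : measurableTypeR R => ((w x)%:E * f (s + x)%R)%E)).
  exact: measurable_convop_kernel.
by move=> s x; rewrite mule_ge0// lee_fin.
Qed.

Lemma iter_convop_mpos w f n : wmpos w -> mpos f -> mpos (iter n (convop w) f).
Proof. by move=> wp fp; elim: n => //= n IH; exact: convop_mpos. Qed.

Lemma convop_comm w v f : wmpos w -> wmpos v -> mpos f ->
  convop w (convop v f) = convop v (convop w f).
Proof.
move=> wp vp fp; have [mw w0] := wp; have [mv v0] := vp; have [mf f0] := fp.
have E w' v' : wmpos w' -> wmpos v' -> forall s, convop w' (convop v' f) s =
    (\int[mu]_x \int[mu]_y ((w' x * v' y)%:E * f (s + x + y)%R))%E.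
  move=> [mw' w0'] [mv' v0'] s; apply: eq_integral => x _.
  rewrite /convop -ge0_integralZl; last 4 first.
  - exact: measurableT.
  - apply: emeasurable_funM; first exact: measurable_EFinr.
    by apply: (measurableT_comp mf); meas.
  - by move=> y _; rewrite mule_ge0// lee_fin.
  - by rewrite lee_fin.
  by apply: eq_integral => y _; rewrite muleA -EFinM.
apply/funext => s; rewrite (E w v wp vp) (E v w vp wp) tonelli; last 2 first.
- apply: emeasurable_funM.
    apply: measurable_EFinr; apply: measurable_funM.
      by apply: (measurableT_comp mw); meas.
    by apply: (measurableT_comp mv); meas.
  by apply: (measurableT_comp mf); meas.
- by move=> x y; rewrite mule_ge0// lee_fin mulr_ge0.
apply: eq_integral => y _; apply: eq_integral => x _.
by rewrite mulrC addrAC.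
Qed.

Lemma convopZ w (c : R) f : 0 <= c -> wmpos w -> mpos f ->
  convop w (fun x => c%:E * f x)%E = (fun s => c%:E * convop w f s)%E.
Proof.
move=> c0 [mw w0] [mf f0]; apply/funext => s.
rewrite /convop -ge0_integralZl; last 4 first.
- exact: measurableT.
- apply: emeasurable_funM; first exact: measurable_EFinr.
  by apply: (measurableT_comp mf); meas.
- by move=> y _; rewrite mule_ge0// lee_fin.
- by rewrite lee_fin.
by apply: eq_integral => x _; rewrite muleCA.
Qed.

Definition kap : \bar R := (\int[mu]_x ((0 <= x)%R%:R * expR (- (4 * x)))%:E)%E.

Lemma kap_shift (a : R) :
  (\int[mu]_x ((a <= x)%R%:R * expR (- (4 * x)))%:E = (expR (- (4 * a)))%:E * kap)%E.
Proof.
rewrite (@integral_affine R _ 1 a (oner_neq0 _)); last 2 first.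
- by meas.
- by move=> x; rewrite lee_fin mulr_ge0 ?expR_ge0.
rewrite normr1 mul1e /kap -ge0_integralZl; last 4 first.
- exact: measurableT.
- by meas.
- by move=> x _; rewrite lee_fin mulr_ge0 ?expR_ge0.
- by rewrite lee_fin expR_ge0.
apply: eq_integral => x _; rewrite mul1r lerDr -EFinM; congr EFin.
by rewrite mulrDr opprD expRD; ring.
Qed.

Lemma kapE : kap = (4^-1)%:E.
Proof.
rewrite /kap; transitivity (\int[mu]_(x in `[0%R, +oo[) (expR (- (4 * x)))%:E)%E.
  rewrite -(@integral_ind _ `[0, +oo[ (fun r => 0 <= r)) //; last first.
    by move=> x /=; rewrite in_itv /= andbT.
have := @integral_exponential_pdf R 4; rewrite ltr0n => /(_ isT) E.
rewrite -[RHS]mule1 -E -ge0_integralZl; last 4 first.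
- exact: measurableT.
- by apply: measurable_EFinr; exact: measurable_exponential_pdf.
- by move=> x _; rewrite lee_fin exponential_pdf_ge0.
- by rewrite lee_fin invr_ge0.
rewrite [LHS]integral_mkcond; apply: eq_integral => x _.
rewrite /exponential_pdf !patchE; case: ifP => _; last by rewrite mule0.
by rewrite -EFinM; congr EFin; rewrite mulNr mulKf.
Qed.

(* With [y] the sum of the two increments, both one-sided exponentials overlap
   in [exp (- 2 |y|)] times [kap]. *)
Lemma convop_EF f : mpos f ->
  convop wE (convop wF f) = (fun s => kap * convop wL f s)%E.
Proof.
move=> fp; have [mf f0] := fp; have [mE E0] := wE_wmpos; have [mF F0] := wF_wmpos.
have [mL L0] := wL_wmpos.
rewrite convop_comm; [|exact: wE_wmpos|exact: wF_wmpos|exact: fp].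
apply/funext => s.
transitivity (\int[mu]_z \int[mu]_w ((wF z * wE (w - z))%:E * f (s + w)%R))%E.
  apply: eq_integral => z _; rewrite /convop.
  rewrite (@integral_affine R (fun y => (wE y)%:E * f (s + z + y)%R)%E 1 (- z) (oner_neq0 _)); last 2 first.
  - apply: emeasurable_funM; first exact: measurable_EFinr.
    by apply: (measurableT_comp mf); meas.
  - by move=> y; rewrite mule_ge0// lee_fin.
  rewrite normr1 mul1e -ge0_integralZl; last 4 first.
  - exact: measurableT.
  - apply: emeasurable_funM.
      by apply: measurable_EFinr; apply: (measurableT_comp mE); meas.
    by apply: (measurableT_comp mf); meas.
  - by move=> y _; rewrite mule_ge0// lee_fin.
  - by rewrite lee_fin.
  apply: eq_integral => w _; rewrite muleA -EFinM mul1r.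
  by congr (_ * f _)%E; ring.
rewrite tonelli; last 2 first.
- apply: emeasurable_funM.
    apply: measurable_EFinr; apply: measurable_funM.
      by apply: (measurableT_comp mF); meas.
    by apply: (measurableT_comp mE); meas.
  by apply: (measurableT_comp mf); meas.
- by move=> x y; rewrite mule_ge0// lee_fin mulr_ge0.
rewrite /convop -ge0_integralZl; last 4 first.
- exact: measurableT.
- apply: emeasurable_funM; first exact: measurable_EFinr.
  by apply: (measurableT_comp mf); meas.
- by move=> y _; rewrite mule_ge0// lee_fin.
- by apply: integral_ge0 => x _; rewrite lee_fin mulr_ge0 ?expR_ge0.
apply: eq_integral => w _.
rewrite ge0_integralZr; last 4 first.
- exact: measurableT.
- apply: measurable_EFinr; apply: measurable_funM; first exact: mF.
  by apply: (measurableT_comp mE); meas.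
- by move=> z _; rewrite lee_fin mulr_ge0.
- exact: f0.
rewrite muleA; congr (_ * _)%E.
(* After z -> -z both signs hold exactly for z >= max (0, -w), where the product of the weights is
   exp (- 2 w - 4 z). Integration gives the exponent - 2 w - 4 max (0, -w) = - 2 |w|. *)
transitivity (\int[mu]_z ((expR (- (2 * w)))%:E * ((Num.max 0 (- w) <= z)%R%:R * expR (- (4 * z)))%:E))%E.
  rewrite (@integral_affine R (fun z => (wF z * wE (w - z))%:E) (-1) 0); last 3 first.
  - by rewrite oppr_eq0 oner_neq0.
  - apply: measurable_EFinr; apply: measurable_funM; first exact: mF.
    by apply: (measurableT_comp mE); meas.
  - by move=> z; rewrite lee_fin mulr_ge0.
  rewrite normrN1 mul1e; apply: eq_integral => z _.
  rewrite addr0 mulN1r opprK -EFinM; congr EFin; rewrite /wF /wE oppr_le0 ge_max.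
  have [z0|z0] /= := leP 0 z; last by rewrite !(mul0r, mulr0).
  rewrite -lerBlDl sub0r; have [wz|wz] := leP (- w) z; last by rewrite !(mul0r, mulr0).
  rewrite !mul1r /wL normrN (ger0_norm z0) ger0_norm -?expRD; last by rewrite -lerBlDl sub0r.
  by congr expR; ring.
rewrite ge0_integralZl; last 4 first.
- exact: measurableT.
- by meas.
- by move=> z _; rewrite lee_fin mulr_ge0 ?expR_ge0.
- by rewrite lee_fin expR_ge0.
rewrite kap_shift muleA -EFinM -expRD muleC; congr (_ * (expR _)%:E)%E.
have [w0|w0] := leP 0 w.
  rewrite max_l ?oppr_le0// ger0_norm//; ring.
by rewrite max_r ?oppr_ge0 1?ltW// ltr0_norm//; ring.
Qed.

Lemma convop_LEF f : mpos f ->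
  convop wL f = (fun s => convop wE f s + convop wF f s)%E.
Proof.
move=> [mf f0]; have [mE E0] := wE_wmpos; have [mF F0] := wF_wmpos.
have [mL L0] := wL_wmpos.
apply/funext => s; rewrite /convop -ge0_integralD; last 5 first.
- exact: measurableT.
- by move=> y _; rewrite mule_ge0// lee_fin.
- apply: emeasurable_funM; first exact: measurable_EFinr.
  by apply: (measurableT_comp mf); meas.
- by move=> y _; rewrite mule_ge0// lee_fin.
- apply: emeasurable_funM; first exact: measurable_EFinr.
  by apply: (measurableT_comp mf); meas.
have mfs : measurable_fun setT (fun x : measurableTypeR R => f (s + x)).
  by apply: (measurableT_comp mf); meas.
apply: (@ge0_integral_eq_off _ _ _ 0).
- by apply: emeasurable_funM => //; exact: measurable_EFinr.
- apply: emeasurable_funD; apply: emeasurable_funM => //; exact: measurable_EFinr.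
- by move=> y; rewrite mule_ge0// lee_fin.
- by move=> y; rewrite adde_ge0// mule_ge0// lee_fin.
move=> x x0; rewrite -ge0_muleDl ?lee_fin// -EFinD; congr (_%:E * _)%E.
rewrite /wE /wF; case: (ltgtP 0 x) => h; rewrite ?mul1r ?mul0r ?addr0 ?add0r//.
by rewrite h eqxx in x0.
Qed.

End LaplaceOperators.

Arguments wL {R} x.
Arguments wE {R} x.
Arguments wF {R} x.

Section LaplaceValues.
Variable R : realType.
Local Notation mu := (@lebesgue_measure R).
Let opE := @convop R wE.
Let opF := @convop R wF.
Let opL := @convop R wL.

(** The function phi of the overview: the weight of the coordinate [- sum l], as a function of the
    sum. *)
Definition lap (s : R) : \bar R := (wL s)%:E.

Lemma lap_mpos : mpos lap.
Proof.
have [mL L0] := wL_wmpos R; split=> [|x]; first exact: measurable_EFinr.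
by rewrite lee_fin.
Qed.

Lemma iter_convop_comm w v f n : wmpos w -> wmpos v -> mpos f ->
  convop w (iter n (@convop R v) f) = iter n (@convop R v) (convop w f).
Proof.
move=> wp vp fp; elim: n => //= n IH.
by rewrite convop_comm ?IH//; exact: iter_convop_mpos.
Qed.

(** On the half-line s >= 0, which [opE] never leaves, exp (- 2 s) is an eigenfunction with
    eigenvalue [kap]. *)
Lemma iter_opE_lap p (s : R) : 0 <= s ->
  iter p opE lap s = ((4^-1) ^+ p * expR (- (2 * s)))%:E.
Proof.
elim: p s => [|p IH] s s0; first by rewrite /= mul1r /lap /wL ger0_norm.
rewrite iterS [LHS](_ : _ = \int[mu]_x (((4^-1) ^+ p * expR (- (2 * s)))%:E *
    ((0 <= x)%R%:R * expR (- (4 * x)))%:E))%E; last first.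
  apply: eq_integral => x _; rewrite /wE; case: leP => x0; last by rewrite !mul0r mul0e mule0.
  rewrite IH ?addr_ge0// -!EFinM !mul1r /wL (ger0_norm x0); congr EFin.
  rewrite mulrCA -mulrA -!expRD; congr (_ * expR _); ring.
rewrite ge0_integralZl; last 4 first.
- exact: measurableT.
- by meas.
- by move=> z _; rewrite lee_fin mulr_ge0 ?expR_ge0.
- by rewrite lee_fin mulr_ge0 ?expR_ge0// exprn_ge0.
by rewrite -/(kap R) kapE -EFinM exprS; congr EFin; ring.
Qed.

Lemma iter_opF_lap q : iter q opF lap 0 = ((4^-1) ^+ q)%:E.
Proof.
suff H (s : R) : iter q opF lap (- s) = iter q opE lap s.
  by rewrite -{1}oppr0 H iter_opE_lap// mulr0 oppr0 expR0 mulr1.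
elim: q s => [|q IH] s; first by rewrite /= /lap /wL normrN.
have [mE E0] := wE_wmpos R; have [mF F0] := wF_wmpos R.
have [mf f0] := iter_convop_mpos q (wF_wmpos R) lap_mpos.
rewrite !iterS [LHS](@integral_affine R _ (-1) 0); last 3 first.
- by rewrite oppr_eq0 oner_neq0.
- apply: emeasurable_funM; first exact: measurable_EFinr.
  by apply: (measurableT_comp mf); meas.
- by move=> x; rewrite mule_ge0// lee_fin.
rewrite normrN1 mul1e; apply: eq_integral => x _.
rewrite addr0 mulN1r -opprD IH; congr ((_)%:E * _)%E.
by rewrite /wF /wE /wL normrN oppr_le0.
Qed.

(** One pair [opE opF] is replaced by [kap] times the sum of [opE] and [opF], which lowers p + q by
    one. This is Pascal's rule, started from the pure powers. *)
Lemma iter_opEF_lap p q :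
  iter p opE (iter q opF lap) 0 = ((4^-1) ^+ (p + q) * 'C(p + q, p)%:R)%:E.
Proof.
have pE := wE_wmpos R; have pF := wF_wmpos R.
have [n] := ubnP (p + q); elim: n p q => // n IH [|p] [|q] // pqn.
- by rewrite bin0 mulr1 -iter_opF_lap.
- by rewrite bin0 mulr1 -iter_opF_lap.
- by rewrite addn0 binn -[LHS]/(iter p.+1 opE lap 0) iter_opE_lap// mulr0 oppr0 expR0.
have fp := iter_convop_mpos q pF lap_mpos.
have gp := iter_convop_mpos p pE fp.
rewrite !iterS -(iter_convop_comm p pF pE fp) /opE /opF convop_EF//.
rewrite convop_LEF// (iter_convop_comm p pF pE fp).
have := IH p.+1 q; rewrite iterS /opE /opF => ->; last by lia.
have := IH p q.+1; rewrite iterS /opE /opF => ->; last by lia.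
rewrite kapE -EFinD -EFinM addSn !addnS ?addSn [in RHS]binS natrD !exprS; congr EFin.
by ring.
Qed.

Lemma iter_opEF l f : mpos f ->
  iter l opE (iter l opF f) = (fun s => ((4^-1) ^+ l)%:E * iter l opL f s)%E.
Proof.
have pE := wE_wmpos R; have pF := wF_wmpos R; have pL := wL_wmpos R.
move=> fp; elim: l => [|l IH]; first by apply/funext => s /=; rewrite expr0 mul1e.
have gp := iter_convop_mpos l pF fp.
rewrite !iterS -(iter_convop_comm l pF pE gp) /opE /opF convop_EF; last first.
  exact: iter_convop_mpos.
have c0 : 0 <= (4^-1 : R) ^+ l by rewrite exprn_ge0.
rewrite IH convopZ//; last exact: iter_convop_mpos.
by apply/funext => s; rewrite kapE muleA -EFinM exprS.
Qed.

(** Up to 4^(-l), the power [opL^l] is [opE^l opF^l]. Commuting the operators gives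
    [opE^(m + l) opF^l], whose value at 0 is known. *)
Lemma iter_opLE_lap l m :
  iter l opL (iter m opE lap) 0 = ((4^-1) ^+ (m + l) * 'C(m + l + l, m + l)%:R)%:E.
Proof.
have pE := wE_wmpos R; have pF := wF_wmpos R; have pL := wL_wmpos R.
have mp := iter_convop_mpos m pE lap_mpos.
have h : (((4^-1) ^+ l)%:E * iter l opL (iter m opE lap) 0%R =
   ((4^-1) ^+ (m + l + l) * 'C(m + l + l, m + l)%:R)%:E)%E.
  have := iter_opEF l mp => /(congr1 (fun f => f (0 : R))) <-.
  have -> : iter l opF (iter m opE lap) = iter m opE (iter l opF lap).
    elim: l => //= l ->.
    exact: (iter_convop_comm _ pF pE (iter_convop_mpos _ pF lap_mpos)).
  by rewrite -iterD addnC iter_opEF_lap.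
have c0 : (4^-1 : R) ^+ l != 0 by rewrite expf_neq0// invr_eq0 pnatr_eq0.
move: h => /(congr1 (mule ((4^-1) ^- l)%:E)); rewrite muleA -EFinM mulVf// mul1e => ->.
by rewrite -EFinM; congr EFin; rewrite (exprD _ (m + l) l); field.
Qed.

(** Integrating one coordinate at a time adds one increment to the argument of [f]. The weights are
    indexed by [nat] so that dropping the first one is a shift. *)
Lemma integral_chain N (w : nat -> R -> R) (f : R -> \bar R) s :
  (forall i, wmpos (w i)) -> mpos f ->
  (\int[lebrv R N]_u ((\prod_(i < N) w i (u 0 i))%:E * f (s + \sum_i u 0 i)%R) =
   foldr (fun i => @convop R (w i)) f (iota 0 N) s)%E.
Proof.
move=> wp fp; have [mf f0] := fp; elim: N w wp s => [|N IH] w wp s.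
  under eq_integral do rewrite !big_ord0 mul1e addr0.
  by rewrite /= integral_dirac// diracE in_setT mul1e.
have mw i : measurable_fun setT (w i) by have [] := wp i.
have w0 i x : 0 <= w i x by have [] := wp i.
have mK M (v : nat -> R -> R) (t : R) : (forall i, wmpos (v i)) ->
   measurable_fun setT (fun u : 'rV[R]_M =>
   ((\prod_(i < M) v i (u 0 i))%:E * f (t + \sum_i u 0 i)%R)%E).
  move=> vp; apply: emeasurable_funM; last by apply: (measurableT_comp mf); meas.
  apply: measurable_EFinr; apply: measurable_prod => i _.
  by apply: measurableT_comp; [case: (vp i)|meas].
have K0 M (v : nat -> R -> R) (t : R) (u : 'rV[R]_M) : (forall i, wmpos (v i)) ->
   (0 <= (\prod_(i < M) v i (u 0 i))%:E * f (t + \sum_i u 0 i)%R)%E.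
  by move=> vp; rewrite mule_ge0// lee_fin prodr_ge0// => i _; case: (vp i).
rewrite integral_lebrvS; [|exact: mK|by move=> u; exact: K0].
have -> : iota 0 N.+1 = 0%N :: map S (iota 0 N) by rewrite -(iotaDl 1).
rewrite /= foldr_map; apply: eq_integral => x _.
rewrite -(IH (fun i => w i.+1)) // -ge0_integralZl; last 4 first.
- exact: measurableT.
- exact: (mK N (fun i => w i.+1) (s + x) (fun i => wp i.+1)).
- by move=> u _; exact: (K0 N (fun i => w i.+1)).
- by rewrite lee_fin.
apply: eq_integral => u _; rewrite !big_ord_recl rcons0_0 muleA -EFinM addrA.
under eq_bigr do rewrite rcons0_S.
by under [in X in f X]eq_bigr do rewrite rcons0_S.
Qed.

(** Since [wL] is even, the coordinate [- sum l] contributes [lap] at the sum. The first k - 1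
    increments are two-sided, the other d - (k - 1) nonnegative. *)
Lemma cone_laplace d k : (1 <= k <= d.+1)%N ->
  (\int[lebrv R d]_l (cone k l * \prod_i wL (zext l 0 i))%:E =
   ((4^-1) ^+ d * 'C(d + k.-1, d)%:R)%:E)%E.
Proof.
move=> /andP[k0 kd].
have pE := wE_wmpos R; have pL := wL_wmpos R.
pose w (i : nat) : R -> R := if (k <= i.+1)%N then wE else wL.
have wp i : wmpos (w i) by rewrite /w; case: ifP.
transitivity (\int[lebrv R d]_u ((\prod_(i < d) w i (u 0 i))%:E * lap (0 + \sum_i u 0 i)%R))%E.
  apply: eq_integral => l _; rewrite -EFinM; congr EFin.
  have wN (x : R) : wL (- x) = wL x by rewrite /wL normrN.
  rewrite big_ord_recl zext0 wN add0r /cone mulrCA mulrC; congr (_ * _).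
  rewrite -big_split; apply: eq_bigr => i _ /=; rewrite zextS /w.
  by case: ifP => _; rewrite ?mul1r.
rewrite integral_chain//; last exact: lap_mpos.
have -> : iota 0 d = iota 0 k.-1 ++ iota k.-1 (d - k.-1) by rewrite -iotaD; congr iota; lia.
rewrite foldr_cat.
have H (v : R -> R) (f : R -> \bar R) a n : (forall i, (a <= i < a + n)%N -> w i = v) ->
    foldr (fun i => @convop R (w i)) f (iota a n) = iter n (@convop R v) f.
  elim: n a => //= n IH a h; rewrite (IH a.+1); last by move=> i hi; apply: h; lia.
  by rewrite h//; lia.
rewrite (H wL); last by move=> i hi; rewrite /w ifN// -ltnNge; lia.
rewrite (H wE); last by move=> i hi; rewrite /w ifT//; lia.
rewrite iter_opLE_lap; congr (_%:E).
by have -> : (d - k.-1 + k.-1)%N = d by lia.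
Qed.

End LaplaceValues.

Section ConeValue.
Variable R : realType.
Variable e : nat.
Let d := e.+1.

Lemma DkE k : (1 <= k <= d.+1)%N ->
  @Dk R e k = ((Num.sqrt pi / 2) ^+ d.+1 * ((4^-1) ^+ d * 'C(d + k.-1, d)%:R))%:E.
Proof.
move=> hk; rewrite /Dk.
pose h (a r : R) := (0 < r)%R%:R * expR (- (r ^+ 2 + a ^+ 2 / r ^+ 2)).
have mh a : measurable_fun setT (h a) by rewrite /h; meas.
have h0 a r : 0 <= h a r by rewrite mulr_ge0 ?expR_ge0.
(* Both [posv] and the exponential split over the coordinates. Once the integrals are exchanged,
   each [rho 0 i] gives one [wlap], at [zext l 0 i]. *)
transitivity (\int[lebrv R d.+1]_rho \int[lebrv R d]_l
    (cone k l * \prod_i h (zext l 0 i) (rho 0 i))%:E)%E.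
  apply: eq_integral => rho _; rewrite /Qk -ge0_integralZr; last 4 first.
  - exact: measurableT.
  - by rewrite /expsq; meas.
  - move=> l _; rewrite mule_ge0 ?expsq_ge0// lee_fin.
    by rewrite mulr_ge0 ?posv_ge0// cone_ge0.
  - exact: expsq_ge0.
  apply: eq_integral => l _; rewrite /expsq -!EFinM; congr EFin.
  rewrite /wnorm !sqr_sqrtr ?sqnorm_ge0 ?sumr_ge0 //; last by move=> i _; exact: sqr_ge0.
  rewrite -!mulrA mulrCA; congr (_ * _); rewrite -expRD -opprD addrC /sqnorm -big_split.
  rewrite -sumrN expR_sum -big_split /=; apply: eq_bigr => i _.
  by rewrite /h addrC expr_div_n addrC.
rewrite tonelli; last 2 first.
- by rewrite /h; meas.
- by move=> rho l; rewrite lee_fin mulr_ge0 ?cone_ge0 ?prodr_ge0.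
have wL0 l : 0 <= \prod_i wL (zext l 0 i) :> R by rewrite prodr_ge0// => i _; exact: expR_ge0.
rewrite [in RHS]EFinM -cone_laplace// -ge0_integralZl; last 4 first.
- exact: measurableT.
- by rewrite /wL; meas.
- by move=> l _; rewrite lee_fin mulr_ge0// cone_ge0.
- by rewrite lee_fin exprn_ge0// divr_ge0// sqrtr_ge0.
apply: eq_integral => l _.
under eq_integral do rewrite EFinM.
rewrite ge0_integralZl; last 4 first.
- exact: measurableT.
- by rewrite /h; meas.
- by move=> rho _; rewrite lee_fin prodr_ge0.
- by rewrite lee_fin cone_ge0.
rewrite (lebrv_prod (fun i => mh (zext l 0 i)) (fun i => h0 (zext l 0 i))).
rewrite (eq_bigr _ (fun i _ => wlapE (zext l 0 i))).
rewrite prodEFin -EFinM; congr EFin.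
by rewrite big_split /= prodr_const card_ord mulrCA.
Qed.

End ConeValue.

(** * The binomial identity *)

Section BinomialIdentity.
Variable R : realType.

Lemma gbin_nat (a b : nat) : gbin R a%:Z b = 'C(a, b)%:R.
Proof.
rewrite /gbin; have b0 : (b`!)%:R != 0 :> R by rewrite pnatr_eq0 -lt0n fact_gt0.
apply: (mulIf b0); rewrite mulfVK// -natrM bin_ffact.
elim: b {b0} => [|b IH]; first by rewrite big_ord0 ffactn0.
rewrite big_ord_recr /= IH ffactnSr natrM.
have [ba|ab] := leqP b a; first by rewrite natrB// -pmulrn.
by rewrite ffact_small// !mul0r.
Qed.

Lemma bin_row_fact (m n : nat) :
  'C(m + n, m)%:R = (m + n)`!%:R / (m`!%:R * n`!%:R) :> R.
Proof.
have f0 j : (j`!)%:R != 0 :> R by rewrite pnatr_eq0 -lt0n fact_gt0.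
have := bin_fact (leq_addr n m); rewrite addKn => <-.
by rewrite !natrM mulfK// mulf_neq0.
Qed.

(** Writing k = p + 1 and n - k = q + 1 removes truncated subtractions. Once all binomials are
    written with a few common factorials, a rational identity in [p] and [q] remains. *)
Lemma bin_identity (p q : nat) (n := (p + q).+2) (k := p.+1) :
  'C(2 * n, n)%:R * ('C(n, k)%:R * ('C(n.-1 + k.-1, n.-1)%:R / 'C(n.-1 + n.-1, n.-1)%:R)) =
  'C(n, k)%:R * 'C(n + k, k)%:R - 'C(p + q, k)%:R * 'C(p + q + k, k)%:R :> R.
Proof.
have f0 j : (j`!)%:R != 0 :> R by rewrite pnatr_eq0 -lt0n fact_gt0.
have nz m : 1 + m%:R != 0 :> R by rewrite nat1r pnatr_eq0.
have nz2 m : 2 + m%:R != 0 :> R by rewrite -natrD pnatr_eq0.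
(* The factorial of q - 1 is avoided: the factor [q] in the numerator keeps the formula valid for q
   = 0, where the binomial vanishes. *)
have E1 : 'C(p + q, k)%:R = (p + q)`!%:R * q.+1%:R * q%:R / (k`!%:R * (q.+1)`!%:R) :> R.
  rewrite {}/n {}/k; case: q => [|q]; first by rewrite addn0 bin_small// mulr0 mul0r.
  rewrite -addSnnS bin_row_fact !factS !natrM.
  by field; rewrite !f0 !nz nz2.
pose a := (p + q).+1 + p.
pose c := (p + q).+1 + (p + q).+1.
have E2 : 'C(n, k)%:R = n`!%:R / (k`!%:R * (q.+1)`!%:R) :> R.
  have -> : n = (k + q.+1)%N by rewrite /n /k; lia.
  by rewrite bin_row_fact.
have E3 : 'C(n + k, k)%:R = (a.+2)`!%:R / (k`!%:R * n`!%:R) :> R.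
  have -> : a.+2 = (k + n)%N by rewrite /a /n /k; lia.
  by rewrite -bin_row_fact addnC.
have E4 : 'C(p + q + k, k)%:R = a`!%:R / (k`!%:R * (p + q)`!%:R) :> R.
  have -> : a = (k + (p + q))%N by rewrite /a /k; lia.
  by rewrite -bin_row_fact addnC.
have E5 : 'C(2 * n, n)%:R = (c.+2)`!%:R / (n`!%:R * n`!%:R) :> R.
  have -> : c.+2 = (n + n)%N by rewrite /c /n; lia.
  by rewrite -bin_row_fact mul2n addnn.
have E6 : 'C(n.-1 + k.-1, n.-1)%:R = a`!%:R / ((p + q).+1`!%:R * p`!%:R) :> R.
  exact: bin_row_fact.
have E7 : 'C(n.-1 + n.-1, n.-1)%:R =
   c`!%:R / ((p + q).+1`!%:R * (p + q).+1`!%:R) :> R by exact: bin_row_fact.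
have f2S m : (m.+2)`!%:R = m.+2%:R * m.+1%:R * m`!%:R :> R by rewrite !factS !natrM mulrA.
rewrite E1 E2 E3 E4 E5 E6 E7 (f2S a) (f2S c).
have [-> -> -> ->] : [/\ (a.+2)%:R = (2 * p%:R + q%:R + 3) :> R,
    (a.+1)%:R = (2 * p%:R + q%:R + 2) :> R,
    (c.+2)%:R = (2 * p%:R + 2 * q%:R + 4) :> R &
    (c.+1)%:R = (2 * p%:R + 2 * q%:R + 3) :> R].
  by rewrite /a /c -!natr1 !natrD -!natr1 !natrD; split; ring.
move: (f0 c); set A := a`!%:R; set C := c`!%:R => C0.
rewrite /k /n !factS !natrM.
have f1 : 1 + (p%:R + q%:R) != 0 :> R by rewrite -natrD.
have f2 : 2 + (p%:R + q%:R) != 0 :> R by rewrite -natrD.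
by field; rewrite !f0 !nz f1 f2.
Qed.

Lemma gbin_identity (n k : nat) : (1 <= k < n)%N ->
  'C(2 * n, n)%:R * ('C(n, k)%:R * ('C(n.-1 + k.-1, n.-1)%:R / 'C(n.-1 + n.-1, n.-1)%:R)) =
  ('C(n, k) * 'C(n + k, k))%:R
    - gbin R (n%:Z - 2) k * gbin R (n%:Z - 2 + k%:Z) k.
Proof.
case: k => // p pn; have [q ->] : exists q, n = (p + q).+2.
  by exists (n - p.+2)%N; lia.
have -> : ((p + q).+2%:Z - 2 = (p + q)%:Z)%R by lia.
by rewrite bin_identity natrM -PoszD !gbin_nat.
Qed.

Lemma gbin_identity_diag (n : nat) : (0 < n)%N ->
  'C(2 * n, n)%:R = ('C(n, n) * 'C(n + n, n))%:R
    - gbin R (n%:Z - 2) n * gbin R (n%:Z - 2 + n%:Z) n.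
Proof.
case: n => // -[|n] _.
  (* For n = 1 the factor binom(-1, 1) is not 0; the product vanishes through binom(0, 1). *)
  by rewrite (_ : 1%:Z - 2 + 1%:Z = 0) // (gbin_nat 0) mulr0 subr0 binn mul1n.
have -> : (n.+2%:Z - 2 = n%:Z)%R by lia.
by rewrite gbin_nat (@bin_small n n.+2)// mul0r subr0 binn mul1n mul2n -addnn.
Qed.

End BinomialIdentity.

(** * The internal angle *)

Section NullSets.
Variable R : realType.
Local Notation mu := (@lebesgue_measure R).

(** The integral of a nonnegative function is a supremum over the simple functions below it, hence
    monotone for arbitrary functions. *)
Lemma ge0_le_integralT disp (T : measurableType disp) (m : {measure set T -> \bar R})
    (f g : T -> \bar R) : (forall x, (0 <= f x)%E) -> (forall x, (f x <= g x)%E) ->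
  (\int[m]_x f x <= \int[m]_x g x)%E.
Proof.
move=> f0 fg; have g0 x : (0 <= g x)%E by exact: le_trans (fg x).
rewrite !ge0_integralTE//; apply: le_ereal_sup => _ [h /= hf <-].
by exists h => //= x; exact: le_trans (fg x).
Qed.

Lemma iter_int_ge0 N (f : (nat -> R) -> \bar R) :
  (forall v, (0 <= f v)%E) -> (0 <= iter_int N f)%E.
Proof.
elim: N f => [|N IH] f f0 /=; first exact: f0.
by apply: integral_ge0 => x _; apply: IH.
Qed.

(* No measurability is required: the simplex of a degenerate configuration is
   only known to lie in a hyperplane. *)
Lemma le_iter_int N (f g : (nat -> R) -> \bar R) :
  (forall v, (0 <= f v)%E) -> (forall v, (f v <= g v)%E) ->
  (iter_int N f <= iter_int N g)%E.
Proof.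
elim: N f g => [|N IH] f g f0 fg /=; first exact: fg.
apply: ge0_le_integralT => x; first exact: iter_int_ge0.
exact: IH.
Qed.

Lemma integral_unit_interval (c : \bar R) : (0 <= c)%E ->
  (\int[mu]_s (((0 <= s)%R%:R * (s <= 1)%R%:R)%:E * c) = c)%E.
Proof.
move=> c0; under eq_integral do rewrite -natrM mulnb.
rewrite (@integral_ind R `[0, 1] (fun s => 0 <= s <= 1))//.
rewrite integral_cst//= lebesgue_measure_itv/= lte01 oppr0 adde0 mule1//.
Qed.

(** By translation invariance the integral equals its average over the shifts by [s *: v] with s in
    [0, 1]. After Tonelli the inner integral runs along a line parallel to [v] and is 0. *)
Lemma integral_translate_null N (v : 'rV[R]_N) (f : 'rV[R]_N -> \bar R) :
  measurable_fun setT f -> (forall u, (0 <= f u)%E) ->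
  (forall u, (\int[mu]_s f (u + s *: v)%R = 0)%E) ->
  (\int[lebrv R N]_u f u = 0)%E.
Proof.
move=> mf f0 fv.
have m2 : measurable_fun setT (fun p : measurableTypeR R * 'rV[R]_N => f (p.2 + p.1 *: v)).
  by apply: (measurableT_comp mf); meas.
have I0 : (0 <= \int[lebrv R N]_u f u)%E by apply: integral_ge0 => u _; exact: f0.
rewrite -(integral_unit_interval I0).
transitivity (\int[mu]_s \int[lebrv R N]_u (((0 <= s)%R%:R * (s <= 1)%R%:R)%:E * f (u + s *: v)%R))%E.
  apply: eq_integral => s _; rewrite ge0_integralZl; last 4 first.
  - exact: measurableT.
  - by apply: (measurableT_comp mf); meas.
  - by move=> u _; exact: f0.
  - by rewrite lee_fin.
  apply: (congr1 (mule _)).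
  rewrite (integral_lebrv_affine (s *: v) (unitmx1 _ _) mf f0) det1 normr1 mul1e.
  by apply: eq_integral => u _; rewrite mulmx1.
rewrite tonelli; last 2 first.
- by apply: emeasurable_funM => //; meas.
- by move=> s u; rewrite mule_ge0// lee_fin.
apply: integral0_eq => u _.
apply/eqP; rewrite eq_le integral_ge0 ?andbT; last by move=> s _; rewrite mule_ge0.
rewrite -[leRHS](fv u); apply: ge0_le_integralT => s; first by rewrite mule_ge0.
by rewrite -[leRHS]mul1e lee_wpmul2r// lee_fin -natrM mulnb lern1 leq_b1.
Qed.

Lemma integral_point0 (b : R -> bool) (x0 : R) :
  measurable_fun setT (fun s : measurableTypeR R => (b s)%:R%:E : \bar R) ->
  (forall s, b s -> s = x0) -> (\int[mu]_s ((b s)%:R)%:E = 0)%E.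
Proof.
move=> mb bx; rewrite (@ge0_integral_eq_off _ _ (cst 0%E) x0).
- exact: integral0.
- exact: mb.
- exact: measurable_cst.
- by move=> x; rewrite lee_fin.
- by [].
- by move=> s sx; case bs : (b s) => //; rewrite (bx _ bs) eqxx in sx.
Qed.

Lemma hyperplane_null N (w t : 'rV[R]_N) : w != 0 ->
  (\int[lebrv R N]_y ((((y - t) *m w^T) 0 0 == 0)%R%:R)%:E = 0)%E.
Proof.
move=> w0; apply: (@integral_translate_null _ w).
- by meas.
- by move=> u; rewrite lee_fin.
move=> u; apply: (@integral_point0 _ (- ((u - t) *m w^T) 0 0 / sqnorm w)).
  by meas.
move=> s; have -> : ((u + s *: w - t) *m w^T) 0 0 = ((u - t) *m w^T) 0 0 + s * sqnorm w.
  by rewrite addrAC mulmxDl -scalemxAl sqnormE mxE; congr (_ + _); rewrite mxE.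
by rewrite addr_eq0 => /eqP ->; rewrite opprK mulfK// sqnorm_eq0.
Qed.

End NullSets.

Section SimplexAngle.
Variable R : realType.
Variable d : nat.
Implicit Types X : 'M[R]_(d.+1, d).

Definition edges X : 'M[R]_d := \matrix_(i, j) (X (lift ord0 i) j - X ord0 j).

Lemma affine_comb X (l : 'I_d.+1 -> R) : \sum_i l i = 1 ->
  \sum_i l i *: row i X = row ord0 X + (\row_i l (lift ord0 i)) *m edges X.
Proof.
move=> l1; have l0 : l ord0 = 1 - \sum_i l (lift ord0 i).
  by rewrite -l1 big_ord_recl addrK.
apply/rowP => j; rewrite summxE big_ord_recl !mxE l0 mulrBl mul1r -addrA; congr (_ + _).
rewrite mulr_suml -sumrN -big_split /=; apply: eq_bigr => i _.
by rewrite !mxE; ring.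
Qed.

Lemma zext_mul X (l : 'rV[R]_d) : zext l *m X = l *m edges X.
Proof.
apply/rowP => j; rewrite !mxE big_ord_recl zext0 mulNr mulr_suml -sumrN -big_split /=.
by apply: eq_bigr => i _; rewrite zextS !mxE; ring.
Qed.

(** Eliminating the column of ones subtracts the first row from the others, so the Schur complement
    is the edge matrix. *)
Lemma det_aug1 X : \det (aug (const_mx 1) X) = \det (edges X).
Proof.
pose A : 'M[R]_(1 + d) := aug (const_mx 1) X; rewrite -[LHS]/(\det A).
have AL i : A i 0 = 1.
  by rewrite /A /aug mxE; case: splitP => // j _; rewrite !mxE.
have AR i (j : 'I_d) : A i (rshift 1 j) = X i j by rewrite /A /aug row_mxEr.
have AL' i (j : 'I_1) : A i (lshift d j) = 1 by rewrite /A /aug row_mxEl !mxE.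
move: A AL AL' AR => A AL AL' AR.
rewrite det_schur AL ?oner_neq0// mul1r /schur AL invr1 scale1r.
congr (\det _); apply/matrixP => i j.
rewrite !mxE big_ord1 !mxE !AR AL' mul1r; congr (X _ _ - X _ _); exact/val_inj.
Qed.

Lemma hullP X (y : 'rV[R]_d) : hull (fun i => row i X) predT y <->
  exists l : 'rV[R]_d, [/\ forall i, 0 <= l 0 i, \sum_i l 0 i <= 1 &
    y = row ord0 X + l *m edges X].
Proof.
split=> [[l [l0 _ l1 ->]]|[l [l0 l1 ->]]].
  exists (\row_i l (lift ord0 i)); split.
  - by move=> i; rewrite mxE.
  - rewrite -l1 big_ord_recl; under eq_bigr do rewrite mxE.
    by rewrite lerDr.
  - exact: affine_comb.
pose l' (i : 'I_d.+1) := oapp (fun j => l 0 j) (1 - \sum_i l 0 i) (unlift ord0 i).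
have l'0 : l' ord0 = 1 - \sum_i l 0 i by rewrite /l' unlift_none.
have l'S i : l' (lift ord0 i) = l 0 i by rewrite /l' liftK.
have sl : \sum_i l' i = 1.
  by rewrite big_ord_recl (eq_bigr _ (fun i _ => l'S i)) l'0 subrK.
exists l'; split => //.
- by move=> i; rewrite /l'; case: unlift => [j|] /=; rewrite ?subr_ge0.
- rewrite affine_comb//; congr (_ + _ *m _); apply/rowP => i.
  by rewrite mxE l'S.
Qed.

(** Coordinates along the edges: index [i] stands for vertex i + 1, whence the shift. The remaining
    weight 1 / k sits on vertex 0. *)
Definition bary k : 'rV[R]_d := \row_i ((i.+1 < k)%N%:R / k%:R).

Lemma barycenterE X k : (0 < k <= d.+1)%N ->
  k%:R^-1 *: \sum_(i < d.+1 | (i < k)%N) row i X = row ord0 X + bary k *m edges X.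
Proof.
move=> /andP[k0 kd]; have kn : k%:R != 0 :> R by rewrite pnatr_eq0 -lt0n.
pose c (i : 'I_d.+1) : R := (i < k)%N%:R / k%:R.
have -> : bary k = \row_i c (lift ord0 i) by apply/rowP => i; rewrite !mxE.
rewrite -affine_comb /c.
  rewrite big_mkcond scaler_sumr; apply: eq_bigr => i _.
  by case: ltnP => _; rewrite ?mul1r// mul0r scale0r scaler0.
rewrite -mulr_suml -natr_sum.
suff -> : (\sum_(i < d.+1) (i < k) = k)%N by rewrite divff.
transitivity (\sum_(i < d.+1 | (i < k)%N) 1)%N.
  by rewrite [RHS]big_mkcond; apply: eq_bigr => i _; case: ltnP.
by rewrite -(big_ord_widen _ (fun=> 1%N) kd) sum1_card card_ord.
Qed.

End SimplexAngle.

Section Angle.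
Variable R : realType.
Variable e : nat.
Local Notation mu := (@lebesgue_measure R).
Let d := e.+1.
Implicit Types X : 'M[R]_(d.+1, d).

Definition ballv : \bar R := (\int[lebrv R d]_u ((sqnorm u < 1)%R%:R)%:E)%E.

Definition coneball k X : \bar R :=
  (\int[lebrv R d]_l ((sqnorm (zext l *m X) < 1)%R%:R * cone k l)%:E)%E.

Lemma integral_gauss_sqnorm N :
  (\int[lebrv R N]_u (expR (- sqnorm u))%:E = (Num.sqrt pi ^+ N)%:E)%E.
Proof.
have E (u : 'rV[R]_N) : (expR (- sqnorm u))%:E = (\prod_i expR (- u 0 i ^+ 2))%:E.
  by rewrite -expsq_sqnorm /expsq sqr_sqrtr// sqnorm_ge0.
under eq_integral do rewrite E.
rewrite (@lebrv_prod _ _ (fun _ x => expR (- x ^+ 2))); last 2 first.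
- by move=> _; meas.
- by move=> _ x; exact: expR_ge0.
under eq_bigr do rewrite -/(expsq _) integralT_expsq.
by rewrite prodEFin prodr_const card_ord.
Qed.

Lemma volE (A : set 'rV[R]_d) (g : 'rV[R]_d -> R) :
  measurable_fun setT g -> (forall y, (\1_A y : R) = g y) ->
  vol A = (\int[lebrv R d]_y (g y)%:E)%E.
Proof.
move=> mg gE; rewrite -iter_int_lebrv.
- by rewrite /vol; congr iter_int; apply/funext => v; rewrite gE.
- exact: measurable_EFinr.
- by move=> y; rewrite lee_fin -gE indicE.
Qed.

Lemma integral_ball_scale (E : 'M[R]_d) (f : 'rV[R]_d -> \bar R) (z : 'rV[R]_d) r :
  E \in unitmx -> 0 < r -> measurable_fun setT f -> (forall u, (0 <= f u)%E) ->
  (\int[lebrv R d]_y f y =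
   (r ^+ d)%:E * (`|\det E|%:E * \int[lebrv R d]_l f (r *: (l *m E) + z)%R))%E.
Proof.
move=> uE r0 mf f0.
have urE : r *: E \in unitmx.
  by rewrite unitmxE detZ unitrM -unitmxE uE andbT unitrX// unitfE gt_eqF.
rewrite (integral_lebrv_affine z urE mf f0) detZ normrM EFinM -muleA.
rewrite (ger0_norm (exprn_ge0 _ (ltW r0))).
by under eq_integral do rewrite -scalemxAr.
Qed.

Lemma vol_eball (z : 'rV[R]_d) r : 0 < r ->
  vol (eball z r) = ((r ^+ d)%:E * ballv)%E.
Proof.
move=> r0; rewrite (@volE _ (fun y => (sqnorm (y - z) < r ^+ 2)%R%:R)); last 2 first.
- by meas.
- by move=> y; rewrite indicE /eball mem_setE.
rewrite (integral_ball_scale z (unitmx1 _ _) r0); last 2 first.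
- by meas.
- by move=> y; rewrite lee_fin.
rewrite det1 normr1 mul1e; apply: (congr1 (mule _)).
apply: eq_integral => u _; rewrite mulmx1 addrK sqnormZ.
by rewrite gtr_pMr ?exprn_gt0.
Qed.

(** The ball contains the cube [0, 1/d)^d, where the squares are bounded by the coordinates
    themselves. Its indicator is at most exp (1 - |u|^2), which has a finite integral. *)
Lemma ballv_pos_fin : (0 < ballv < +oo)%E.
Proof.
apply/andP; split.
  pose h (i : 'I_d) (x : R) : R := (0 <= x)%R%:R * (x < d%:R^-1)%R%:R.
  have d0 : 0 < (d%:R^-1 : R) by rewrite invr_gt0.
  have hI i : (\int[mu]_x (h i x)%:E = (d%:R^-1)%:E)%E.
    transitivity (\int[mu]_x (((x \in `[0%R, d%:R^-1[)%R%:R)%:E * (cst 1%E x)))%E.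
      by apply: eq_integral => x _; rewrite mule1 in_itv /= -mulnb natrM.
    rewrite (@integral_ind R `[0, d%:R^-1[)// integral_cst//= mul1e.
    by rewrite lebesgue_measure_itv /= lte_fin d0 oppr0 adde0.
  have h0 i x : 0 <= h i x by rewrite mulr_ge0.
  have mh i : measurable_fun setT (h i) by rewrite /h; meas.
  apply: (@lt_le_trans _ _ (\int[lebrv R d]_u (\prod_i h i (u 0%R i))%:E)%E).
    rewrite (@lebrv_prod _ _ h mh h0); under eq_bigr do rewrite hI.
    by rewrite prodEFin lte_fin prodr_gt0.
  apply: ge0_le_integralT => u; first by rewrite lee_fin prodr_ge0.
  rewrite lee_fin; have [/forallP hu|] := boolP [forall i, (0 <= u 0 i) && (u 0 i < d%:R^-1)].
    rewrite big1 => [|i _]; last by have /andP[a b] := hu i; rewrite /h a b mulr1.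
    suff -> : sqnorm u < 1 by [].
    apply: (@lt_le_trans _ _ (\sum_(j < d) d%:R^-1)); last first.
      by rewrite sumr_const card_ord -(mulr_natl d%:R^-1) divff ?pnatr_eq0.
    rewrite /sqnorm !big_ord_recl ltr_leD//; last first.
      apply: ler_sum => i _; have /andP[a b] := hu (lift ord0 i).
      rewrite (le_trans _ (ltW b))// expr2 ler_piMl// (le_trans (ltW b))//.
      by rewrite invf_le1// ler1n.
    have /andP[a b] := hu ord0; apply: (le_lt_trans _ b).
    by rewrite expr2 ler_piMl// (le_trans (ltW b))// invf_le1// ler1n.
  rewrite negb_forall => /existsP[i /negbTE hi].
  suff -> : \prod_i h i (u 0 i) = 0 by [].
  by rewrite (bigD1 i)//= {1}/h -natrM mulnb hi mul0r.
apply: (@le_lt_trans _ _ (\int[lebrv R d]_u ((expR 1)%:E * (expR (- sqnorm u))%:E)))%E.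
  apply: ge0_le_integralT => u; first by rewrite lee_fin.
  rewrite -EFinM lee_fin -expRD; case: ltP => u1; last exact: expR_ge0.
  by rewrite -[leLHS]expR0 ler_expR subr_ge0 ltW.
rewrite ge0_integralZl; last 4 first.
- exact: measurableT.
- by meas.
- by move=> u _; rewrite lee_fin expR_ge0.
- by rewrite lee_fin expR_ge0.
by rewrite integral_gauss_sqnorm -EFinM ltry.
Qed.

Lemma coneball_ge0 k X : (0 <= coneball k X)%E.
Proof. by apply: integral_ge0 => l _; rewrite lee_fin mulr_ge0// cone_ge0. Qed.

Lemma ballv_edges X : edges X \in unitmx ->
  (`|\det (edges X)|%:E * \int[lebrv R d]_l ((sqnorm (zext l *m X) < 1)%R%:R)%:E = ballv)%E.
Proof.
move=> uE; rewrite /ballv.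
rewrite (@integral_lebrv_affine _ _ (edges X) 0 (fun u => ((sqnorm u < 1)%R%:R)%:E) uE); last 2 first.
- by meas.
- by move=> u; rewrite lee_fin.
apply: (congr1 (mule _)); apply: eq_integral => l _.
by rewrite addr0 zext_mul.
Qed.

Lemma coneball_le k X : edges X \in unitmx ->
  (`|\det (edges X)|%:E * coneball k X <= ballv)%E.
Proof.
move=> uE; rewrite -(ballv_edges uE) lee_pmul2l// ?lte_fin ?normr_gt0 -?unitfE -?unitmxE//.
apply: ge0_le_integralT => l; first by rewrite lee_fin mulr_ge0// cone_ge0.
rewrite lee_fin ler_piMr// prodr_ile1// => i _.
by case: ifP => _; rewrite ?ler0n ?lern1 ?leq_b1//= ler01 lexx.
Qed.

Lemma prod_ind n (P : 'I_n -> bool) : \prod_i (P i)%:R = [forall i, P i]%:R :> R.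
Proof.
have [/forallP p|] := boolP [forall i, P i]; first by rewrite big1// => i _; rewrite p.
by rewrite negb_forall => /existsP[i /negbTE ni]; rewrite (bigD1 i)//= ni mul0r.
Qed.

(** The entries of [l *m E] are at most 1 in absolute value, so those of [l] are controlled by the
    column sums of the inverse; the leading 1 makes [C] positive. *)
Lemma row_bound (E : 'M[R]_d) : E \in unitmx -> exists2 C : R, 0 < C &
  forall l : 'rV[R]_d, sqnorm (l *m E) < 1 ->
    (forall i, `|l 0 i| <= C) /\ `|\sum_i l 0 i| <= C.
Proof.
move=> uE; pose C := 1 + \sum_i \sum_j `|invmx E j i|.
have S0 i : 0 <= \sum_j `|invmx E j i| by rewrite sumr_ge0.
exists C => [|l l1]; first by rewrite ltr_pwDl// sumr_ge0.
have h i : `|l 0 i| <= \sum_j `|invmx E j i|.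
  rewrite -[l](mulmxK uE) mxE (le_trans (ler_norm_sum _ _ _))// ler_sum// => j _.
  rewrite normrM ler_piMl// -(@ler_pXn2r _ 2) ?nnegrE// expr1n real_normK ?num_real//.
  rewrite (le_trans _ (ltW l1))// /sqnorm (bigD1 j)//= lerDl sumr_ge0// => a _.
  exact: sqr_ge0.
split=> [i|].
  rewrite (le_trans (h i))// /C [X in _ <= 1 + X](bigD1 i)//= addrCA lerDl addr_ge0// sumr_ge0//.
refine (le_trans (ler_norm_sum _ _ _) _).
by refine (le_trans (ler_sum _ (fun i _ => h i)) _); rewrite /C lerDr.
Qed.

Lemma sum_bary k : (0 < k <= d.+1)%N -> \sum_i bary R d k 0 i = 1 - k%:R^-1.
Proof.
move=> /andP[k0 kd]; have kn : k%:R != 0 :> R by rewrite pnatr_eq0 -lt0n.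
under eq_bigr do rewrite mxE.
rewrite -mulr_suml -natr_sum.
suff -> : (\sum_(i < d) (i.+1 < k) = k.-1)%N.
  have kE : k%:R = k.-1%:R + 1 :> R by rewrite natr1 prednK.
  by apply: (mulIf kn); rewrite mulfVK// mulrBl mul1r mulVf// kE addrK.
have kd' : (k.-1 <= d)%N by rewrite -ltnS prednK.
transitivity (\sum_(i < d | (i < k.-1)%N) 1)%N.
  rewrite [RHS]big_mkcond; apply: eq_bigr => i _.
  by rewrite -{1}(prednK k0) ltnS; case: ltnP.
by rewrite -(big_ord_widen _ (fun=> 1%N) kd') sum1_card card_ord.
Qed.

(** Near the barycenter the simplex is a cone. At a vertex outside the face the condition is a sign
    of [l]. At a vertex of the face, including vertex 0 whose condition reads [sum <= 1], the
    barycentric coordinate starts at 1 / k and moves by at most r C, so its condition holds for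
    small [r]. If the edge matrix is singular, the simplex lies in a hyperplane and both sides are
    0. *)
Lemma vol_corner k X : (0 < k <= d.+1)%N -> exists2 r0 : R, 0 < r0 &
  forall r, 0 < r -> r < r0 ->
  vol (eball (row ord0 X + bary R d k *m edges X) r `&` hull (fun i => row i X) predT) =
  ((r ^+ d)%:E * (`|\det (edges X)|%:E * coneball k X))%E.
Proof.
move=> hk; have /andP[k0 kd] := hk; set z := _ + _.
have k0R : 0 < k%:R^-1 :> R by rewrite invr_gt0 ltr0n.
have [uE|] := boolP (edges X \in unitmx); last first.
  rewrite unitmxE unitfE negbK => det0; exists 1 => // r r0 _.
  rewrite (eqP det0) normr0 mul0e mule0.
  move: det0; rewrite -det_tr => /det0P[w w0 wE].
  apply/eqP; rewrite eq_le; apply/andP; split; last first.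
    by apply: iter_int_ge0 => v; rewrite lee_fin indicE.
  rewrite -(hyperplane_null (row ord0 X) w0) -iter_int_lebrv; last 2 first.
  - by meas.
  - by move=> u; rewrite lee_fin.
  apply: le_iter_int => v; first by rewrite lee_fin indicE.
  rewrite lee_fin indicE; case: (boolP (_ \in _)) => //; rewrite inE => -[_].
  move=> /hullP[l [_ _ ->]]; rewrite addrAC subrr add0r -mulmxA.
  have -> : edges X *m w^T = 0 by rewrite -[LHS]trmxK trmx_mul trmxK wE trmx0.
  by rewrite mulmx0 mxE eqxx.
have [C C0 hC] := row_bound uE.
exists (k%:R^-1 / C) => [|r r0 rC]; first by rewrite divr_gt0.
have {}rC : r * C <= k%:R^-1 by rewrite ltr_pdivlMr// in rC; exact: ltW.
pose lam (y : 'rV[R]_d) := (y - row ord0 X) *m invmx (edges X).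
pose g (y : 'rV[R]_d) : R := (sqnorm (y - z) < r ^+ 2)%R%:R *
  \prod_i (0 <= lam y 0 i)%R%:R * (\sum_i lam y 0 i <= 1)%R%:R.
have mg : measurable_fun setT g by rewrite /g /lam; meas.
rewrite (volE mg); last first.
  move=> y; rewrite indicE /g prod_ind -!natrM !mulnb; congr (_%:R); congr nat_of_bool.
  apply/idP/idP; rewrite inE.
    move=> [yz /hullP[l [l0 l1 yE]]].
    have lE : lam y = l by rewrite /lam yE addrAC subrr add0r mulmxK.
    by rewrite lE l1 andbT; apply/andP; split => //; apply/forallP.
  move=> /andP[/andP[yz /forallP l0] l1]; split=> //; apply/hullP.
  by exists (lam y); split => //; rewrite /lam mulmxKV// addrC subrK.
have g0 y : (0 <= (g y)%:E)%E by rewrite lee_fin !mulr_ge0// prodr_ge0.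
have mg' : measurable_fun setT (fun y => (g y)%:E) by exact: measurable_EFinr.
rewrite (integral_ball_scale z uE r0 mg' g0).
apply: (congr1 (mule _)); apply: (congr1 (mule _)); apply: eq_integral => l _.
congr EFin; rewrite /g addrK sqnormZ zext_mul gtr_pMr ?exprn_gt0//.
have [l1|] := ltP (sqnorm (l *m edges X)) 1; last by rewrite !mul0r.
have [hl hs] := hC l l1; rewrite !mul1r.
have lamE : lam (r *: (l *m edges X) + z) = r *: l + bary R d k.
  by rewrite /lam /z (addrC (row _ _)) addrA addrK scalemxAl -mulmxDl mulmxK.
have -> : (\sum_i lam (r *: (l *m edges X) + z) 0 i <= 1) = true.
  rewrite lamE; under eq_bigr do rewrite mxE [(r *: l) _ _]mxE.
  rewrite big_split /= -mulr_sumr sum_bary// addrCA gerDl subr_le0.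
  rewrite (le_trans _ rC)// ler_pM2l// (le_trans (ler_norm _))//.
rewrite mulr1; apply: eq_bigr => i _; rewrite lamE mxE [(r *: l) _ _]mxE mxE.
case: leqP => ki.
  by rewrite mul0r addr0 pmulr_rge0.
rewrite mul1r; suff -> : 0 <= r * l 0 i + k%:R^-1 by [].
rewrite -lerBlDr sub0r (le_trans _ (_ : - (r * C) <= _)) ?lerN2// -mulrN ler_pM2l//.
by have := hl i; rewrite ler_norml => /andP[].
Qed.

Lemma coneball_fin k X : (`|\det (edges X)|%:E * coneball k X)%E \is a fin_num.
Proof.
have := coneball_ge0 k X; have [uE|] := boolP (edges X \in unitmx); last first.
  by rewrite unitmxE unitfE negbK => /eqP ->; rewrite normr0 mul0e.
move=> c0; rewrite ge0_fin_numE ?mule_ge0 ?lee_fin//.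
by rewrite (le_lt_trans (coneball_le k uE))//; have /andP[] := ballv_pos_fin.
Qed.

(** Both volumes scale as r^d for small [r], so the ratio is eventually constant and the limit is
    its value. *)
Lemma int_angleE k X : (0 < k <= d.+1)%N ->
  ((int_angle k (fun i => row i X))%:E * ballv =
   `|\det (edges X)|%:E * coneball k X)%E.
Proof.
move=> hk; have [r0 r00 hr] := vol_corner X hk.
have /andP[b0 boo] := ballv_pos_fin.
have bfin : ballv \is a fin_num by rewrite ge0_fin_numE// ltW.
have fb0 : fine ballv != 0 by rewrite gt_eqF// fine_gt0// b0.
have -> : int_angle k (fun i => row i X) =
    fine (`|\det (edges X)|%:E * coneball k X) / fine ballv.
  rewrite /int_angle barycenterE//; apply: norm_lim_near_cst.
  near=> r.
  have r_gt0 : 0 < r by near: r; exact: nbhs_right_gt.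
  have r_lt : r < r0 by near: r; exact: nbhs_right_lt.
  rewrite hr// vol_eball// fineM ?coneball_fin// (fineM (_ : _%:E \is a fin_num) bfin)//=.
  by rewrite -mulf_div divff ?mul1r// gt_eqF// exprn_gt0.
by rewrite -{2}(fineK bfin) -EFinM divfK// fineK// coneball_fin.
Unshelve. all: by end_near. Qed.

End Angle.

(** * Normalisation *)

Section Degenerate.
Variable R : realType.
Local Notation mu := (@lebesgue_measure R).

Lemma roots_in_seq (p : {poly R}) : p != 0 -> exists s : seq R, forall x, root p x -> x \in s.
Proof.
have [n] := ubnP (size p); elim: n p => // n IH p pn p0.
have [[x px]|nr] := pselect (exists x, root p x); last first.
  by exists [::] => x px; case: nr; exists x.
have /factor_theorem[q pE] := px.
have q0 : q != 0 by apply: contra_neq p0 => q0; rewrite pE q0 mul0r.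
have [|s hs] := IH q _ q0.
  by move: pn; rewrite pE size_Mmonic ?monicXsubC// size_XsubC addn2.
exists (x :: s) => y; rewrite pE rootM root_XsubC inE => /orP[/hs ->|->//].
by rewrite orbT.
Qed.

(** [f] may be infinite on the finite set, so it is compared with +oo times the indicator of a null
    set. *)
Lemma integral_null_off_seq (s : seq R) (f : R -> \bar R) :
  (forall x, (0 <= f x)%E) -> (forall x, x \notin s -> f x = 0%E) ->
  (\int[mu]_x f x = 0)%E.
Proof.
move=> f0 fs; apply/eqP; rewrite eq_le integral_ge0 ?andbT; last by move=> x _; exact: f0.
have cs : countable [set` s] by exact/finite_set_countable.
have mS : measurable [set` s] by apply: countable_measurable => // x; exact: measurable_set1.
apply: (@le_trans _ _ (\int[mu]_x ((\1_[set` s] x)%:E * +oo))%E).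
  apply: ge0_le_integralT => // x; rewrite indicE; case: (boolP (_ \in _)).
    by rewrite mul1e leey.
  by rewrite notin_setE /= mul0e => /negP/fs ->.
rewrite ge0_integralZr; last 4 first.
- exact: measurableT.
- by apply: measurable_EFinr; exact: measurable_indic.
- by move=> x _; rewrite lee_fin.
- exact: leey.
have mu0 : mu [set` s] = 0%E by exact: countable_lebesgue_measure0.
by rewrite integral_indic// setIT [X in (X * _)%E]mu0 mul0e.
Qed.

Variable d : nat.

(* Adding [s] times the identity to the edge matrix makes the determinant a
   nonzero polynomial in [s]. *)
Lemma intM_degenerate (f : 'M[R]_(d.+1, d) -> \bar R) :
  measurable_fun setT f -> (forall X, (0 <= f X)%E) ->
  (forall X, \det (edges X) != 0 -> f X = 0%E) -> intM f = 0%E.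
Proof.
move=> mf f0 fE; rewrite /intM.
pose V : 'M[R]_(d.+1, d) := \matrix_(i, j) (i == lift ord0 j)%:R.
apply: (@integral_translate_null _ _ (mxvec V)).
- by apply: (measurableT_comp mf); meas.
- by move=> u; exact: f0.
move=> u; set X := vec_mx u.
have EE s : edges (vec_mx (u + s *: mxvec V)) = edges X + s%:M.
  rewrite linearD linearZ /= mxvecK; apply/matrixP => i j; rewrite !mxE.
  rewrite (inj_eq (@lift_inj _ _)) (_ : (ord0 == _) = false) ?mulr0; last exact/negbTE/neq_lift.
  by case: eqP => _; rewrite ?mulr1 ?mulr0 ?mulr1n ?mulr0n; ring.
(* The matrix [edges X + s%:M] is singular exactly when [- s] is an eigenvalue of [edges X]. *)
have [xs hxs] := roots_in_seq (monic_neq0 (char_poly_monic (edges X))).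
apply: (@integral_null_off_seq [seq - x | x <- xs]) => [s|s sxs]; first exact: f0.
apply: fE; rewrite EE; apply: contra sxs => /det0P[v v0 vE].
rewrite -[s]opprK; apply: map_f; apply: hxs; rewrite -eigenvalue_root_char.
apply/eigenvalueP; exists v => //; move/eqP: vE.
by rewrite mulmxDr mul_mx_scalar addr_eq0 scaleNr => /eqP.
Qed.

End Degenerate.

Section Normalisation.
Variable R : realType.
Variable e : nat.
Let d := e.+1.
Local Notation mu := (@lebesgue_measure R).

Definition bmass : \bar R := intM (fun X : 'M[R]_(d.+1, d) => (bprod X)%:E).

Lemma measurable_bprod disp (T : measurableType disp) (f : T -> 'M[R]_(d.+1, d)) :
  measurable_fun setT f -> measurable_fun setT (fun x => @bprod R e (f x)).
Proof. by move=> mf; rewrite /bprod; meas. Qed.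

Lemma measurable_coneball disp (T : measurableType disp) k (f : T -> 'M[R]_(d.+1, d)) :
  measurable_fun setT f -> measurable_fun setT (fun x => @coneball R e k (f x)).
Proof.
move=> mf; apply: measurable_integralr => [|x l]; last first.
  by rewrite lee_fin mulr_ge0// cone_ge0.
have mf1 : measurable_fun setT (fun p : T * 'rV[R]_d => f p.1).
  by apply: (measurableT_comp mf); meas.
by meas.
Qed.

(** For k = n the cone imposes nothing, and for a nondegenerate simplex the determinant times
    [coneball] is the volume of the whole ball. *)
Lemma Pk_full : @Pk R e d.+1 = (bmass * ballv R e)%E.
Proof.
have /andP[/ltW b0 _] := ballv_pos_fin R e.
pose F (X : 'M[R]_(d.+1, d)) := ((`|\det (edges X)| * bprod X)%:E * @coneball R e d.+1 X)%E.
pose G (X : 'M[R]_(d.+1, d)) := ((bprod X)%:E * ballv R e)%E.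
have F0 X : (0 <= F X)%E.
  by rewrite mule_ge0 ?coneball_ge0// lee_fin mulr_ge0// bprod_ge0.
have G0 X : (0 <= G X)%E by rewrite mule_ge0// lee_fin bprod_ge0.
have mG : measurable_fun setT G.
  by apply: emeasurable_funM => //; apply: measurable_EFinr; apply: measurable_bprod; meas.
have PF : @Pk R e d.+1 = intM F.
  by rewrite /Pk /intM; apply: eq_integral => u _; rewrite det_aug1.
have GI : intM G = (bmass * ballv R e)%E.
  rewrite /intM /G ge0_integralZr; last 4 first.
  - exact: measurableT.
  - by apply: measurable_EFinr; apply: measurable_bprod; meas.
  - by move=> u _; rewrite lee_fin bprod_ge0.
  - exact: b0.
  by [].
have FG X : \det (edges X) != 0 -> F X = G X.
  rewrite -unitfE -unitmxE => uX; rewrite /F /G mulrC EFinM -muleA; congr (_ * _)%E.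
  rewrite -(ballv_edges uX); congr (_ * _)%E; apply: eq_integral => l _.
  congr EFin; rewrite /cone big1 ?mulr1// => i _; rewrite ltnS ifN// -ltnNge.
  exact: ltn_ord.
have FG0 X : \det (edges X) = 0 -> F X = 0%E by rewrite /F => ->; rewrite normr0 mul0r mul0e.
(* [H] is the part of [G] on the null set of degenerate configurations, so that [F + H = G]
   everywhere. *)
pose H (X : 'M[R]_(d.+1, d)) := (((\det (edges X) == 0)%R%:R)%:E * G X)%E.
have H0 X : (0 <= H X)%E by rewrite mule_ge0// lee_fin.
have mdet : measurable_fun setT (fun X : 'M[R]_(d.+1, d) => \det (edges X)).
  rewrite (_ : (fun _ => _) = fun X => \det (aug (const_mx 1) X)); first by meas.
  by apply/funext => X; rewrite det_aug1.
have mH : measurable_fun setT H.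
  apply: emeasurable_funM => //; apply: measurable_EFinr; exact: measurable_eqr_ind.
have HI : intM H = 0%E.
  by apply: intM_degenerate => // X XE; rewrite /H (negbTE XE) mul0e.
have mF : measurable_fun setT F.
  apply: emeasurable_funM; last by apply: measurable_coneball; meas.
  apply: measurable_EFinr; apply: measurable_funM; last by apply: measurable_bprod; meas.
  exact: measurable_normrr.
rewrite PF -GI -[LHS]adde0 -HI /intM -ge0_integralD; last 5 first.
- exact: measurableT.
- by move=> u _; exact: F0.
- by apply: (measurableT_comp mF); meas.
- by move=> u _; exact: H0.
- by apply: (measurableT_comp mH); meas.
apply: eq_integral => u _; rewrite /H; case: eqVneq => [E|E].
  by rewrite FG0// add0e mul1e.
by rewrite FG// mul0e adde0.
Qed.

Lemma frob_vec_mx n m (u : 'rV[R]_(n * m)) : frob (vec_mx u) = sqnorm u.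
Proof.
rewrite /frob /sqnorm [RHS](reindex _ (@curry_mxvec_bij n m)) /=.
transitivity (\sum_(p : 'I_n * 'I_m) u 0 (mxvec_index p.1 p.2) ^+ 2); last first.
  by apply: eq_bigr => -[].
rewrite -(pair_bigA _ (fun i j => u 0 (mxvec_index i j) ^+ 2)) /=.
by apply: eq_bigr => i _; apply: eq_bigr => j _; rewrite !mxE.
Qed.

Lemma intM_gauss n m (c : 'rV[R]_n) : (forall i, 0 < c 0 i) ->
  (intM (fun X : 'M[R]_(n, m) => (\prod_i expR (- (c 0 i ^+ 2 * sqnorm (row i X))))%:E) =
   (\prod_i (c 0 i)^-1 ^+ m * Num.sqrt pi ^+ (n * m))%:E)%E.
Proof.
move=> c0; pose b : 'rV[R]_n := \row_i (c 0 i)^-1.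
have ub : diag_mx b \in unitmx.
  rewrite unitmxE det_diag unitfE prodf_seq_neq0; apply/allP => i _ /=.
  by rewrite mxE invr_eq0 gt_eqF.
have rb i X : sqnorm (row i (diag_mx b *m X)) = (c 0 i)^-1 ^+ 2 * sqnorm (row i X).
  by rewrite -sqnormZ; congr sqnorm; apply/rowP => j; rewrite mul_diag_mx !mxE.
rewrite (intM_lmul ub); last 2 first.
- by meas.
- by move=> X; rewrite lee_fin prodr_ge0// => i _; exact: expR_ge0.
rewrite det_lin_mulmx_diag EFinM -integral_gauss_sqnorm.
have -> : `|(\prod_i b 0 i) ^+ m| = \prod_i (c 0 i)^-1 ^+ m.
  rewrite ger0_norm; last by rewrite exprn_ge0// prodr_ge0// => i _; rewrite mxE invr_ge0 ltW.
  by rewrite -prodrXl; apply: eq_bigr => i _; rewrite mxE.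
apply: (congr1 (mule _)); apply: eq_integral => u _; congr EFin.
rewrite -frob_vec_mx /frob -sumrN expR_sum; apply: eq_bigr => i _; congr (expR (- _)).
by rewrite rb mulrA -exprMn divff ?expr1n ?mul1r// gt_eqF.
Qed.

(** The mixture again, without the determinant: integrating a Gaussian row costs rho^(-d), and of
    rho^(d + 1) a single power remains, whence [gam R 1]. *)
Lemma bmass_gam : (bmass * \prod_(i < d.+1) gam R d.+1 =
  \prod_(i < d.+1) gam R 1 * (Num.sqrt pi ^+ (d.+1 * d))%:E)%E.
Proof.
rewrite /bmass /intM -ge0_integralZr; last 4 first.
- exact: measurableT.
- by apply: measurable_EFinr; apply: measurable_bprod; meas.
- by move=> u _; rewrite lee_fin bprod_ge0.
- exact: prod_gam_ge0.
under eq_integral do rewrite bprod_mix.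
rewrite tonelli; last 2 first.
- by meas.
- by move=> u rho; rewrite lee_fin mixw_ge0.
pose h (i : 'I_d.+1) (r : R) := (0 < r)%R%:R * (r ^+ 1 * expR (- r ^+ 2)).
have mh i : measurable_fun setT (h i) by rewrite /h; meas.
have h0 i r : 0 <= h i r by rewrite /h mulrA mulr_ge0 ?expR_ge0// pos_pow_ge0.
rewrite -(@lebrv_prod R d.+1 h mh h0) -ge0_integralZr; last 4 first.
- exact: measurableT.
- by apply: measurable_EFinr; rewrite /h; meas.
- by move=> u _; rewrite lee_fin prodr_ge0.
- by rewrite lee_fin exprn_ge0// sqrtr_ge0.
apply: eq_integral => rho _.
have [[rho0 _]|pE] := posvP rho; last first.
  rewrite /h big_split /= -/(posv rho) pE mul0r mul0e.
  under eq_integral do rewrite /mixw big_split /= -/(posv rho) pE mul0r.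
  exact: integral0.
transitivity ((\prod_i (rho 0 i ^+ d.+1 * expR (- rho 0 i ^+ 2)))%:E *
  intM (fun X : 'M[R]_(d.+1, d) => (\prod_i expR (- (rho 0 i ^+ 2 * sqnorm (row i X))))%:E))%E.
  rewrite /intM -ge0_integralZl; last 4 first.
  - exact: measurableT.
  - by meas.
  - by move=> u _; rewrite lee_fin prodr_ge0// => i _; exact: expR_ge0.
  - by rewrite lee_fin prodr_ge0// => i _; rewrite mulr_ge0 ?expR_ge0// exprn_ge0// ltW.
  apply: eq_integral => u _; rewrite -EFinM -big_split; congr EFin; apply: eq_bigr => i _ /=.
  by rewrite rho0 mul1r mulrDr mulr1 opprD expRD mulrA.
rewrite intM_gauss// -!EFinM mulrA -big_split; congr (_ * _)%:E; apply: eq_bigr => i _ /=.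
rewrite /h rho0 mul1r expr1 exprVn mulrAC (exprS _ d) -(mulrA (rho 0 i)) divff ?mulr1//.
by rewrite expf_neq0// gt_eqF.
Qed.

End Normalisation.

(** * The Gamma function at integers and half-integers *)

Section GammaValue.
Variable R : realType.
Local Notation mu := (@lebesgue_measure R).

Lemma integral_split1 (f : R -> \bar R) :
  measurable_fun setT f -> (forall x, (0 <= f x)%E) ->
  (\int[mu]_(x in `[0%R, +oo[) f x =
   \int[mu]_(x in `[0%R, 1%R]) f x + \int[mu]_(x in `[1%R, +oo[) f x)%E.
Proof.
move=> mf f0; rewrite (_ : `[0, +oo[%classic = `[0, 1]%classic `|` `]1, +oo[%classic); last first.
  apply/seteqP; split=> x /=; rewrite !in_itv /= !andbT.
    move=> x0; by have [x1|x1] := leP x 1; [left; apply/andP|right].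
  by move=> [/andP[x0 _]|x1]; [exact: x0|rewrite (le_trans _ (ltW x1))].
rewrite ge0_integral_setU//=; last 2 first.
- exact: measurable_funTS.
- apply/disj_setPS => x /= []; rewrite !in_itv /= andbT => /andP[_ x1].
  by rewrite ltNge x1.
by rewrite integral_itv_obnd_cbnd//; exact: measurable_funTS.
Qed.

(** Near 0 the substitution is made by the square, whose derivative is bounded there, unlike that of
    the root. *)
Lemma integral_square01 (G : R -> R) : continuous G ->
  (\int[mu]_(t in `[0%R, 1%R]) (G t)%:E =
   \int[mu]_(r in `[0%R, 1%R]) (G (r ^+ 2) * (2 * r))%:E)%E.
Proof.
move=> cG; pose F (r : R) := r ^+ 2.
have F0 : F 0 = 0 by rewrite /F expr0n.
have F1 : F 1 = 1 by rewrite /F expr1n.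
have dF (r : R) : derivable F r 1 by exact: exprn_derivable.
have DF : derive1 F = ( *%R 2) by apply/funext => r; exact: exp_derive1.
have cDF (r : R) : {for r, continuous (derive1 F)}.
  by rewrite DF; exact: mulrl_continuous.
have cF (r : R) : {for r, continuous F} by exact: exprn_continuous.
have := @integration_by_substitution_increasing R F G 0 1 ler01.
rewrite F0 F1 => ->.
- by apply: eq_integral => r _; rewrite -[in RHS]/(F r) -(congr1 (fun f => f r) DF).
- move=> x y; rewrite !in_itv /= => /andP[x0 _] /andP[y0 _] xy.
  by rewrite /F ltrXn2r.
- by move=> x _; exact: cDF.
- by apply/cvg_ex; exists (derive1 F 0); apply: cvg_at_right_filter; exact: cDF.
- by apply/cvg_ex; exists (derive1 F 1); apply: cvg_at_left_filter; exact: cDF.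
- split; first by move=> x _; exact: dF.
  + by apply: cvg_at_right_filter; exact: cF.
  + by apply: cvg_at_left_filter; exact: cF.
- exact: continuous_subspaceT.
Qed.

(** Near infinity the root is used instead: its derivative tends to 0, while that of the square is
    unbounded. *)
Lemma integral_sqrt1y (H : R -> R) : continuous H -> (forall x, 0 <= x -> 0 <= H x) ->
  (\int[mu]_(r in `[1%R, +oo[) (H r)%:E =
   \int[mu]_(t in `[1%R, +oo[) (H (Num.sqrt t) * (2 * Num.sqrt t)^-1)%:E)%E.
Proof.
move=> cH H0; pose F (t : R) := Num.sqrt t.
have F1 : F 1 = 1 by rewrite /F sqrtr1.
have dF (t : R) : 0 < t -> is_derive t 1 F (2 * Num.sqrt t)^-1.
  by move=> t0; exact: is_derive1_sqrt.
have DF (t : R) : 0 < t -> derive1 F t = (2 * Num.sqrt t)^-1.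
  by move=> t0; rewrite derive1E; have [_ ->] := dF t t0.
have cDF (t : R) : 0 < t -> {for t, continuous (derive1 F)}.
  move=> t0; have nt : \forall x \near t, (2 * Num.sqrt x)^-1 = derive1 F x.
    near=> x; apply/esym/DF; near: x; exact: lt_nbhsr.
  change (derive1 F x @[x --> t] --> derive1 F t); rewrite DF//.
  apply: cvg_trans; first by apply: near_eq_cvg; exact: nt.
  apply: cvgV; first by rewrite mulf_neq0// gt_eqF// sqrtr_gt0.
  apply: cvgM; first exact: cvg_cst.
  exact: sqrt_continuous.
have := @increasing_ge0_integration_by_substitutiony R F H 1.
rewrite F1 => ->.
- apply: eq_integral => t; rewrite inE /= in_itv /= andbT => t1.
  by rewrite -DF//; exact: lt_le_trans t1.
- move=> x y; rewrite !in_itv /= !andbT => x1 y1 xy.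
  by rewrite /F ltr_sqrt// (lt_le_trans _ y1).
- by move=> x; rewrite in_itv /= andbT => x1; apply: cDF; exact: lt_trans x1.
- by apply/cvg_ex; exists (derive1 F 1); apply: cvg_at_right_filter; exact: cDF.
- apply/cvg_ex; exists 0; apply/cvgrPdist_le => eps eps0; near=> x.
  have x1 : 1 <= x by near: x; apply: nbhs_pinfty_ge; exact: num_real.
  have xe : eps^-1 ^+ 2 <= x by near: x; apply: nbhs_pinfty_ge; exact: num_real.
  have x0 : 0 < x by exact: lt_le_trans x1.
  have s0 : 0 < Num.sqrt x by rewrite sqrtr_gt0.
  rewrite DF// sub0r normrN ger0_norm; last by rewrite invr_ge0 mulr_ge0// ltW.
  rewrite invf_ple ?posrE ?mulr_gt0//.
  have : eps^-1 <= Num.sqrt x by rewrite (le_trans (ler_norm _))// -sqrtr_sqr ler_wsqrtr.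
  by move=> /le_trans; apply; rewrite ler_peMl ?ltW// ltr1n.
- split.
    by move=> x; rewrite in_itv /= andbT => x1; have [] := dF x (lt_trans ltr01 x1).
  by apply: cvg_at_right_filter; exact: sqrt_continuous.
- apply/cvgryPge => A; near=> x.
  have x0 : 0 <= x by near: x; apply: nbhs_pinfty_ge; exact: num_real.
  have xA : A ^+ 2 <= x by near: x; apply: nbhs_pinfty_ge; exact: num_real.
  by rewrite (le_trans (ler_norm A))// -sqrtr_sqr ler_wsqrtr.
- exact: continuous_subspaceT.
- by move=> x; rewrite in_itv /= andbT => x1; apply: H0; rewrite ltW// (lt_trans _ x1).
Unshelve. all: by end_near. Qed.

(* The substitution [t = r ^ 2]. It is split at 1 because the library requires
   the derivative to have a finite limit at both ends. *)
Lemma integral_Gamma_gam p :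
  (\int[mu]_(t in [set t : R | (0 < t)%R]) (t `^ (p%:R / 2) * expR (- t))%:E =
   2%:E * gam R p.+1)%E.
Proof.
pose G (t : R) := Num.sqrt t ^+ p * expR (- t).
pose H (r : R) := 2 * (r ^+ p.+1 * expR (- r ^+ 2)).
have cG : continuous G.
  move=> t; apply: cvgM.
    apply: (@continuous_comp _ _ _ (@Num.sqrt R) (fun x : R => x ^+ p)).
      exact: sqrt_continuous.
    exact: exprn_continuous.
  apply: (@continuous_comp _ _ _ (fun x : R => - x) expR); last exact: continuous_expR.
  by apply: cvgN; exact: cvg_id.
have cH : continuous H.
  move=> r; apply: cvgM; first exact: cvg_cst.
  apply: cvgM; first exact: exprn_continuous.
  apply: (@continuous_comp _ _ _ (fun x : R => - x ^+ 2) expR); last exact: continuous_expR.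
  by apply: cvgN; exact: exprn_continuous.
have mG : measurable_fun setT (fun t => (G t)%:E) by rewrite /G; meas.
have mH : measurable_fun setT (fun t => (H t)%:E) by rewrite /H; meas.
have G0 t : (0 <= (G t)%:E)%E by rewrite lee_fin mulr_ge0 ?expR_ge0// exprn_ge0// sqrtr_ge0.
have H0 t : 0 <= t -> 0 <= H t.
  by move=> t0; rewrite !mulr_ge0 ?expR_ge0// exprn_ge0.
(* [H] can be negative for r < 0; the even extension is nonnegative on the whole line and agrees
   with it on the half-line of integration. *)
pose H' (r : R) := H `|r|.
have mH' : measurable_fun setT (fun t => (H' t)%:E) by rewrite /H' /H; meas.
have H'0 t : (0 <= (H' t)%:E)%E by rewrite lee_fin H0.
transitivity (\int[mu]_(t in `[0%R, +oo[) (G t)%:E)%E.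
  rewrite -integral_itv_obnd_cbnd; last exact: measurable_funTS.
  rewrite (_ : [set t | 0 < t] = `]0, +oo[%classic); last first.
    by apply/seteqP; split => t /=; rewrite in_itv /= andbT.
  apply: eq_integral => t; rewrite inE /= in_itv /= andbT => t0.
  by rewrite /G (mulrC p%:R) powRrM powR_mulrn ?powR_ge0// powR12_sqrt ?ltW.
transitivity (\int[mu]_(t in `[0%R, +oo[) (H' t)%:E)%E; last first.
  rewrite -integral_itv_obnd_cbnd; last exact: measurable_funTS.
  rewrite -(@integral_ind R `]0, +oo[ (fun r => 0 < r)) //; last first.
    by move=> x /=; rewrite in_itv /= andbT.
  rewrite /gam -ge0_integralZl; last 4 first.
  - exact: measurableT.
  - by meas.
  - by move=> r _; rewrite lee_fin mulrA mulr_ge0 ?expR_ge0// pos_pow_ge0.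
  - by [].
  apply: eq_integral => r _; rewrite /H' /H; case: ltP => r0; last by rewrite !mul0r mul0e mule0.
  by rewrite !mul1r mul1e gtr0_norm.
rewrite !integral_split1//; congr (_ + _)%E.
  rewrite integral_square01//; apply: eq_integral => r; rewrite inE /= in_itv /= => /andP[r0 _].
  by rewrite /H' /H /G ger0_norm// sqrtr_sqr ger0_norm// (exprS r p); congr EFin; ring.
transitivity (\int[mu]_(x in `[1%R, +oo[) (H x)%:E)%E.
  rewrite (integral_sqrt1y cH H0); apply: eq_integral => t; rewrite inE /= in_itv /= andbT => t1.
  have t0 : 0 < Num.sqrt t by rewrite sqrtr_gt0 (lt_le_trans _ t1).
  rewrite /H /G sqr_sqrtr ?(le_trans _ t1)// (exprS _ p); congr EFin; field.
  by rewrite gt_eqF.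
apply: eq_integral => r; rewrite inE /= in_itv /= andbT => r1.
by rewrite /H' ger0_norm// (le_trans _ r1).
Qed.

Lemma GammaE (s : R) p : s - 1 = p%:R / 2 -> Gamma s = 2 * fine (gam R p.+1).
Proof.
move=> sp; rewrite /Gamma sp integral_Gamma_gam.
have := gam_pos_fin R p.+1; case: (gam R p.+1) => [r _|/andP[_]|/andP[]//].
  by rewrite -EFinM.
by rewrite ltxx.
Qed.

End GammaValue.

(** * The expected internal angle *)

Section ExpectedAngle.
Variable R : realType.
Variable e : nat.
Let d := e.+1.
Let beta : R := (d.+1%:R + 1) / 2.

Lemma gam_fine m : exists2 g : R, 0 < g & gam R m = g%:E.
Proof.
have := gam_pos_fin R m; case: (gam R m) => [g /andP[g0 _]|/andP[_]|/andP[]//].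
  by exists g.
by rewrite ltxx.
Qed.

(** The density has total mass 1. Here beta - d / 2 = 1, so the two Gamma values of [ctilde] are
    twice [gam R d.+1] and twice [gam R 1], the constants of [bmass_gam]. *)
Lemma ctilde_bmass : exists2 b : R, bmass R e = b%:E & ctilde d beta ^+ d.+1 * b = 1.
Proof.
have [g g0 gE] := gam_fine d.+1; have [h h0 hE] := gam_fine 1.
have gn0 : g ^+ d.+1 != 0 by rewrite expf_neq0// gt_eqF.
have hn0 : h ^+ d.+1 != 0 by rewrite expf_neq0// gt_eqF.
have s0 : Num.sqrt pi != 0 :> R by rewrite sqrtr_eq0 -ltNge pi_gt0.
have bE := bmass_gam R e; rewrite gE hE !prodEFin !prodr_const !card_ord -EFinM in bE.
exists (h ^+ d.+1 * Num.sqrt pi ^+ (d.+1 * d) / g ^+ d.+1).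
  move/(congr1 (fun x => x * ((g ^+ d.+1)^-1)%:E)%E): bE.
  by rewrite -muleA -!EFinM divff// mule1.
have -> : ctilde d beta = g / (Num.sqrt pi ^+ d * h).
  rewrite /ctilde (@GammaE R beta d); last by rewrite /beta -natr1; field.
  rewrite (@GammaE R (beta - d%:R / 2) 0); last by rewrite /beta -natr1; field.
  rewrite gE hE /= (mulrC d%:R) powRrM powR_mulrn ?powR_ge0// powR12_sqrt ?pi_ge0//.
  by field; rewrite gt_eqF//= expf_neq0.
rewrite mulnC exprM expr_div_n exprMn; set q := _ ^+ d ^+ d.+1.
have q0 : q != 0 by rewrite !expf_neq0.
by field; rewrite gn0 hn0 q0.
Qed.

Lemma exp_angleE k : (0 < k <= d.+1)%N ->
  exp_angle d.+1 k beta =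
  fine ((ctilde d beta ^+ d.+1 / fine (ballv R e))%:E * @Pk R e k)%E.
Proof.
move=> hk; have /andP[b0 boo] := ballv_pos_fin R e.
have bfin : ballv R e \is a fin_num by rewrite ge0_fin_numE// ltW.
have fb0 : 0 < fine (ballv R e) by rewrite fine_gt0// b0.
have c0 : 0 <= ctilde d beta.
  rewrite /ctilde (@GammaE R beta d); last by rewrite /beta -natr1; field.
  rewrite (@GammaE R (beta - d%:R / 2) 0); last by rewrite /beta -natr1; field.
  have [g g0 ->] := gam_fine d.+1; have [h h0 ->] := gam_fine 1.
  by rewrite divr_ge0 ?mulr_ge0 ?powR_ge0 ?ltW.
pose f (X : 'M[R]_(d.+1, d)) : \bar R :=
  ((`|\det (aug (const_mx 1) X)| * bprod X)%:E * @coneball R e k X)%E.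
have mf : measurable_fun setT f.
  apply: emeasurable_funM; last by apply: measurable_coneball; meas.
  by apply: measurable_EFinr; apply: measurable_funM;
    [meas|apply: measurable_bprod; meas].
have f0 X : (0 <= f X)%E by rewrite mule_ge0 ?coneball_ge0// lee_fin mulr_ge0// bprod_ge0.
set c := _ / _; have c1 : 0 <= c by rewrite divr_ge0 ?exprn_ge0// ltW.
rewrite /exp_angle (_ : (fun M => _) = fun X => (c%:E * f X)%E); last first.
  apply/funext => X; rewrite /f /dens_bp big_split /= prodr_const card_ord.
  rewrite -/(bprod X) det_aug1 mulrC EFinM.
  have -> : (int_angle k (fun i => row i X))%:E =
      (((fine (ballv R e))^-1)%:E * (`|\det (edges X)|%:E * coneball k X))%E.
    rewrite -int_angleE// muleC -muleA -{1}(fineK bfin) -!EFinM divff ?mulr1//.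
    by rewrite gt_eqF.
  rewrite [in RHS]mulrC [(bprod X * _)%:E]EFinM /c !muleA; congr (_ * _)%E.
  by rewrite -!EFinM; congr EFin; ring.
rewrite cfg_int_intM; last 2 first.
- by apply: emeasurable_funM.
- by move=> X; rewrite mule_ge0.
rewrite /intM ge0_integralZl//; first exact: (measurableT_comp mf (measurable_vec_mx (@measurable_id _ _ setT))).
Qed.

(** [Pk_Dk] is used at [k] and at n: the quotient of the two instances contains only the values of
    [Dk], in which the powers of pi and of 4 cancel, and the mass in [Pk_full] is removed by the
    normalisation of the density. *)
Lemma exp_angle_value k : (0 < k <= d.+1)%N ->
  exp_angle d.+1 k beta = 'C(d + k.-1, d)%:R / 'C(d + d, d)%:R.
Proof.
move=> hk; rewrite exp_angleE//.
have /andP[b0 boo] := ballv_pos_fin R e.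
have bfin : ballv R e \is a fin_num by rewrite ge0_fin_numE// ltW.
have fb0 : fine (ballv R e) != 0 by rewrite gt_eqF// fine_gt0// b0.
have [b bE cb] := ctilde_bmass.
have hd : (0 < d.+1 <= d.+1)%N by rewrite leqnn.
have PkE := Pk_Dk R e k; have PnE := Pk_Dk R e d.+1.
rewrite DkE// in PkE; rewrite DkE// Pk_full bE in PnE.
set A := (polarI d _ * polarI _ _)%E in PkE PnE.
have [x x0 xE] : exists2 x : R, 0 < x & (\prod_(i < d.+1) gam R d.+1 *
    polarI d (@expsq R) * polarI (d.+1 + d) (@expsq R) = x%:E)%E.
  have pf p : exists2 y : R, 0 < y & polarI p.+1 (@expsq R) = y%:E.
    have := polarI_expsq R p; case: (polarI _ _) => [y /andP[y0 _]|/andP[_]|/andP[]//].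
      by exists y.
    by rewrite ltxx.
  have [g g0 gE] := gam_fine d.+1; have [y y0 yE] := pf e; have [z z0 zE] := pf (d + d)%N.
  exists (g ^+ d.+1 * y * z); first exact: mulr_gt0 (mulr_gt0 (exprn_gt0 _ g0) y0) z0.
  by rewrite gE prodEFin prodr_const card_ord yE zE -!EFinM.
rewrite {}xE in PkE PnE; rewrite -(fineK bfin) -!EFinM in PnE.
have A0 : (0 <= A)%E.
  by rewrite mule_ge0 ?polarI_ge0// => y; [exact: Psi_ge0|exact: hnorm_ge0].
set t : R := (Num.sqrt pi / 2) ^+ d.+1 in PkE PnE.
set u : R := 4^-1 ^+ d in PkE PnE.
have tp : 0 < t by rewrite exprn_gt0// divr_gt0// sqrtr_gt0 pi_gt0.
have up : 0 < u by rewrite exprn_gt0// invr_gt0 ltr0n.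
have C0 : 'C(d + d, d)%:R != 0 :> R by rewrite pnatr_eq0 -lt0n bin_gt0 leq_addr.
have D0 : 0 < t * (u * 'C(d + d, d)%:R).
  by rewrite mulr_gt0// mulr_gt0// lt_def C0 ler0n.
(* In the instance k = n the left side is finite and the value of [Dk] is positive, so [A] cannot be
   infinite. *)
have [a aE] : exists a, A = a%:E.
  move: PnE A0; case: (A) => [a _ _|/esym|//]; first by exists a.
  by rewrite gt0_mulye.
rewrite aE -EFinM in PnE; rewrite aE -EFinM in PkE; case: PnE => PnE.
move/(congr1 (fun y => y * (x^-1)%:E)%E): PkE.
rewrite -muleA -!EFinM divff ?gt_eqF// mule1 => ->.
rewrite -EFinM /=.
have -> : a = b * fine (ballv R e) * x / (t * (u * 'C(d + d, d)%:R)).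
  by rewrite PnE mulfK// gt_eqF.
have xn0 : x != 0 by rewrite gt_eqF.
transitivity (ctilde d beta ^+ d.+1 * b * ('C(d + k.-1, d)%:R / 'C(d + d, d)%:R)).
  by field; rewrite C0 xn0 fb0 !gt_eqF.
by rewrite cb mul1r.
Qed.

End ExpectedAngle.

Theorem theorem2p4 (R : realType) (n k : nat) :
  (1 <= k <= n)%N ->
  ('C(2 * n, n))%:R * Jt n k ((n%:R + 1) / 2 : R) =
  ('C(n, k) * 'C(n + k, k))%:R
    - gbin R (n%:Z - 2) k * gbin R (n%:Z - 2 + k%:Z) k.
Proof.
move=> /andP[k1 kn]; rewrite /Jt; have [->|knn] := eqVneq k n.
  by rewrite mulr1 gbin_identity_diag// (leq_trans k1).
have {knn}kn : (k < n)%N by rewrite ltn_neqAle knn.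
(* From 1 <= k < n one gets n >= 2, so that d = n - 1 is positive and R^n has the two axes needed
   above. *)
case: n kn => [|[|e]] kn //; first by case: k k1 kn => [|[]].
by rewrite exp_angle_value ?gbin_identity ?k1//= ltnW.
Qed.
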